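(* Let $\ell$ be a prime and let $L$ be a Galois extension of $\mathbb{Q}$ with $\mathrm{Gal}(L/\mathbb{Q})\cong\mathbb{Z}/\ell\mathbb{Z}$ that is tamely ramified (i.e. $\ell$ does not ramify in $L$). Then the lattice $\left\langle O_L^0,\frac{1}{\mathrm{rad}_L}q_L\right\rangle$ is isometric to the root lattice $\mathbb{A}_{\ell-1}$.
   Context: $O_L$ is the ring of integers of $L$, $O_L^0=\{x\in O_L:\mathrm{tr}_{L/\mathbb{Q}}(x)=0\}$, and $q_L$ is the quadratic form on $O_L^0$ with bilinear form $(x,y)\mapsto\mathrm{tr}_{L/\mathbb{Q}}(xy)$; $\frac{1}{\mathrm{rad}_L}q_L$ means this form multiplied by $1/\mathrm{rad}_L$. $\mathrm{rad}_L$ is the squarefree integer divisible exactly by the primes ramified in $L$ and having the same sign as the discriminant of $L$. $\mathbb{A}_n$ is the lattice with quadratic form $\sum_{i=1}^n 2x_i^2-\sum_{|i-j|=1}x_ix_j$ (sum over ordered pairs $1\le i,j\le n$). *)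

(* Defs.v *)
From mathcomp Require Import all_boot all_order all_algebra.
From mathcomp Require Import all_fingroup all_solvable all_field.
From mathcomp Require Import boolp classical_sets functions.

Set Implicit Arguments.
Unset Strict Implicit.
Unset Printing Implicit Defensive.

Import Order.TTheory GRing.Theory Num.Theory.
Local Open Scope ring_scope.
Local Open Scope classical_set_scope.

Section NumberField.
Variable L : fieldExtType rat.

Definition ring_of_integers : set L :=
  [set x | integralOver (intr : int -> L) x].

Definition trQ (x : L) : rat :=
  \tr (passmx.mxof (vbasis {:L}) (vbasis {:L}) (amull x)).

Definition trace_zero_integers : set L :=
  [set x | ring_of_integers x /\ trQ x = 0].

Definition trace_bilin (x y : L) : rat := trQ (x * y).

(* No factor 1/2: x |-> tr(x^2), as for the form of A_n below. *)
Definition trace_form (x : L) : rat := trace_bilin x x.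

Definition integral_basis (e : (\dim {:L}).-tuple L) : Prop :=
  basis_of {:L} e /\
  ring_of_integers =
    [set x | exists c : 'I_(\dim {:L}) -> int,
       x = \sum_(i < \dim {:L}) tnth e i *~ c i].

(* The set below is a singleton: integral bases exist, and the determinant does
   not depend on the chosen one. *)
Definition discriminant : rat :=
  xget 0 [set d | exists2 e : (\dim {:L}).-tuple L, integral_basis e &
    d = \det (\matrix_(i < \dim {:L}, j < \dim {:L})
                trace_bilin (tnth e i) (tnth e j))].

Definition is_ideal (I : set L) : Prop :=
  [/\ I `<=` ring_of_integers,
      I 0,
      forall x y, I x -> I y -> I (x + y)
    & forall a x, ring_of_integers a -> I x -> I (a * x)].

Definition is_prime_ideal (P : set L) : Prop :=
  [/\ is_ideal P,
      ~ P 1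
    & forall x y, ring_of_integers x -> ring_of_integers y ->
        P (x * y) -> P x \/ P y].

Definition ideal_mul (I J : set L) : set L :=
  [set z | exists2 s : seq (L * L),
     (forall u, u \in s -> I u.1 /\ J u.2) & z = \sum_(u <- s) u.1 * u.2].

(* The ideal p O_L has a repeated prime factor. *)
Definition ramified (p : nat) : Prop :=
  exists P I : set L,
    [/\ is_prime_ideal P, is_ideal I &
        [set p%:R * x | x in ring_of_integers] =
          ideal_mul (ideal_mul P P) I].

(* The squarefreeness clause excludes 0, which every p ^ 2 divides. *)
Definition is_rad (r : int) : Prop :=
  [/\ forall p, prime p -> ~~ (p ^ 2 %| `|r|)%N,
      forall p, prime p -> ((p %| `|r|)%N <-> ramified p)
    & sgz r = sgz discriminant].

(* At most one integer satisfies is_rad, and one does since only finitely many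
   primes ramify and the discriminant is nonzero. *)
Definition signed_radical : int := xget 0 [set r | is_rad r].

End NumberField.

Definition An_form (n : nat) (x : 'rV[int]_n) : int :=
  \sum_(i < n) 2 * x 0 i ^+ 2
  - \sum_(i < n) \sum_(j < n | `|(i : nat)%:Z - (j : nat)%:Z| == 1)
      x 0 i * x 0 j.

(* The lattices are the subgroups M and N of V and W, with rational-valued
   quadratic forms q and q' (only their values on M and N matter). *)
Definition isometric (V W : zmodType) (M : set V) (q : V -> rat)
    (N : set W) (q' : W -> rat) : Prop :=
  exists f : V -> W,
    [/\ set_bij M N f,
        forall x y, M x -> M y -> f (x + y) = f x + f y
      & forall x, M x -> q' (f x) = q x].

(* Main.v *)
(* The trace form of a tame cyclic field of prime degree l is computed on a normal
   integral basis e_g = g(e) with tr(e_g e_h) = N [g = h] - (N - 1) / l, where N is the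
   signed radical; on trace-zero elements sum c_g e_g (sum c_g = 0) the form is then
   N sum c_g^2, which is N times A_(l-1).

   For l = 2 one takes e = (1 + sqrt N) / 2.  For odd l, the prime p = 1 mod l is totally
   ramified, and the values on G of a Gaussian period of conductor p, labelled through the
   tame character, form a vector f with the prescribed autocorrelation; convolving over
   the ramified primes gives the vector f for N.  The Galois group permutes the values of
   f, and Psi(x) = sum_g g(x) f(g) is integral on the dual lattice of O_L.  Comparing
   determinants, Minkowski's theorem on linear forms gives x <> 0 in the dual lattice with
   |Psi(g x)| <= 1 for all g, up to a harmless rescaling which makes the integer
   prod_g Psi(g x) vanish.  A zero of Psi forces Psi to be rational valued, hence f to be
   the vector of conjugates of an element e of L.  No Kronecker-Weber theorem is needed. *)
Require Import Defs.
From HB Require Import structures.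
From mathcomp Require Import all_boot all_order all_algebra.
From mathcomp Require Import all_fingroup all_solvable all_field.
From mathcomp Require Import ring lra zify.
From mathcomp Require Import boolp.

Set Implicit Arguments.
Unset Strict Implicit.
Unset Printing Implicit Defensive.

Import Order.TTheory GRing.Theory Num.Theory.
Local Open Scope ring_scope.

(** Local rings are taken inside [algC]: z is p-local if some multiple of it by an integer prime to
    p is an algebraic integer. Elements of L and Gaussian periods, which need not lie in L, are thus
    compared in one ring. Since l is prime, at each p either G acts trivially modulo the radical of
    p, or the local ring of L is its own trace dual; the first case is ramification.

    The obstacle is the integrality of Psi at a ramified p, where the dual lattice has poles of
    order up to l - 1. It holds because the tame labelling of the period matches the action of G on
    a uniformizer: expanding zeta^s in powers of lambda = 1 - zeta, each power cancels the pole of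
    the sum of conjugates it multiplies.

    The rescaling weights one form by 2 and another by 1/2. Were the integer prod_g Psi(g x)
    nonzero, all bounds would be equalities and Psi(x) would be 1/2 or -1/2, not integral. Given y
    <> 0 with Psi(y) = 0, every automorphism tau of [algC] satisfies tau Psi(x) = Psi(t x) for one t
    in G; if t were not 1, all Psi(g y) would vanish, although the l forms are independent. So tau
    fixes all values of Psi. *)

(** * Integrality and the radical at a prime p, inside the algebraic numbers *)

Section PLocal.
Variable p : nat.
Hypothesis p_pr : prime p.

(** The integral closure in [algC] of Z localised at p. No number field is fixed, so that roots of
    unity and elements of L can be multiplied. *)
Definition ploc (z : algC) : Prop :=
  exists2 m : nat, ~~ (p %| m)%N & m%:R * z \in Aint.

Let p_neq0 : (p%:R : algC) != 0.
Proof. by rewrite pnatr_eq0 -lt0n prime_gt0. Qed.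

Let ndvd_neq0 (m : nat) : ~~ (p %| m)%N -> (m%:R : algC) != 0.
Proof. by rewrite pnatr_eq0; apply: contraNneq => ->; rewrite dvdn0. Qed.

Lemma ploc_Aint z : z \in Aint -> ploc z.
Proof. by exists 1%N; rewrite ?mul1r // dvdn1 neq_ltn prime_gt1 ?orbT. Qed.

Lemma ploc_int (a : int) : ploc a%:~R.
Proof. exact/ploc_Aint/Aint_int. Qed.

Lemma ploc_nat (n : nat) : ploc n%:R.
Proof. exact: (ploc_int n). Qed.

Lemma ploc0 : ploc 0. Proof. exact: (ploc_nat 0). Qed.
Lemma ploc1 : ploc 1. Proof. exact: (ploc_nat 1). Qed.

Lemma ploc_invn (m : nat) : ~~ (p %| m)%N -> ploc m%:R^-1.
Proof. by move=> pm; exists m => //; rewrite divff ?Aint1 ?ndvd_neq0. Qed.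

Lemma plocM y z : ploc y -> ploc z -> ploc (y * z).
Proof.
move=> [m pm my] [k pk kz]; exists (m * k)%N.
  by rewrite Euclid_dvdM // negb_or pm.
by rewrite natrM mulrACA rpredM.
Qed.

Lemma plocD y z : ploc y -> ploc z -> ploc (y + z).
Proof.
move=> [m pm my] [k pk kz]; exists (m * k)%N.
  by rewrite Euclid_dvdM // negb_or pm.
have -> : (m * k)%:R * (y + z) = k%:R * (m%:R * y) + m%:R * (k%:R * z).
  by rewrite natrM; ring.
by rewrite rpredD // rpredM ?rpred_nat.
Qed.

Lemma plocN z : ploc z -> ploc (- z).
Proof. by move=> z_loc; rewrite -mulN1r; apply: plocM => //; apply: (ploc_int (- 1)). Qed.

Lemma plocB y z : ploc y -> ploc z -> ploc (y - z).
Proof. by move=> ? /plocN; apply: plocD. Qed.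

Lemma plocX z k : ploc z -> ploc (z ^+ k).
Proof.
move=> z_loc; elim: k => [|k IHk]; first exact: ploc1.
by rewrite exprS; apply: plocM.
Qed.

Lemma ploc_sum (I : Type) (r : seq I) (P : pred I) (F : I -> algC) :
  (forall i, P i -> ploc (F i)) -> ploc (\sum_(i <- r | P i) F i).
Proof. by move=> locF; apply: big_ind => //; [apply: ploc0 | apply: plocD]. Qed.

Lemma ploc_prod (I : Type) (r : seq I) (P : pred I) (F : I -> algC) :
  (forall i, P i -> ploc (F i)) -> ploc (\prod_(i <- r | P i) F i).
Proof. by move=> locF; apply: big_ind => //; [apply: ploc1 | apply: plocM]. Qed.

Lemma Aint_root z k : (0 < k)%N -> z ^+ k \in Aint -> z \in Aint.
Proof.
move=> k_gt0 zk; have mon_k : ('X^k : {poly algC}) \is monic by apply: monicXn.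
apply: (@root_monic_Aint (minCpoly (z ^+ k) \Po 'X^k)).
- by rewrite /root horner_comp hornerXn; apply: root_minCpoly.
- rewrite monicE lead_coef_comp ?size_polyXn // (monicP (minCpoly_monic _)).
  by rewrite mul1r lead_coefXn expr1n.
- by rewrite polyOver_comp // ?rpredX ?polyOverX.
Qed.

Lemma ploc_root z k : (0 < k)%N -> ploc (z ^+ k) -> ploc z.
Proof.
case: k => // k _ [m pm mz]; exists m => //; apply: (@Aint_root _ k.+1) => //.
by rewrite exprMn exprSr -mulrA rpredM ?rpredX ?rpred_nat.
Qed.

Lemma ploc_aut (nu : {rmorphism algC -> algC}) z : ploc z -> ploc (nu z).
Proof.
move=> [m pm mz]; exists m => //.
by rewrite -(rmorph_nat nu) -rmorphM Aint_aut.
Qed.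

Lemma ploc_rat z : z \in Crat -> ploc z ->
  exists a : int, exists2 m : nat, ~~ (p %| m)%N & z = a%:~R / m%:R.
Proof.
move=> Qz [m pm mz].
have /intrP[a Da] : m%:R * z \in Num.int.
  by rewrite Cint_rat_Aint // rpredM // rpred_nat.
by exists a, m => //; rewrite -Da mulrC mulKf ?ndvd_neq0.
Qed.

Lemma ploc_ratP (a : int) : ploc (a%:~R / p%:R) -> (p%:Z %| a)%Z.
Proof.
move=> /ploc_rat[|b [m pm Db]]; first by rewrite rpred_div ?rpred_int ?rpred_nat.
have Dab : a * m = b * p.
  apply/(intr_inj (R := algC)); rewrite !rmorphM /=.
  move/(congr1 (fun x => x * p%:R * m%:R)): Db.
  rewrite divfK // => ->; rewrite -mulrA [p%:R * _]mulrC mulrA divfK ?ndvd_neq0 //.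
have : (p%:Z %| a * m)%Z by rewrite Dab dvdz_mull.
rewrite !dvdzE abszM /= Euclid_dvdM // => /orP[//|]; by rewrite (negPf pm).
Qed.

Lemma ploc_modp z : z \in Crat -> ploc z ->
  exists n : nat, ploc ((z - n%:R) / p%:R).
Proof.
move=> Qz /(ploc_rat Qz)[a [m pm ->]].
have [u mu] : exists u : int, (p%:Z %| a - u * m)%Z.
  have /coprimeP : coprime m p by rewrite coprime_sym prime_coprime.
  have m_gt0 : (0 < m)%N by rewrite lt0n; apply: contraNneq pm => ->; rewrite dvdn0.
  case=> // -[u v] /= Duv.
  exists (a * u); apply/dvdzP; exists (- a * v)%R.
  have : (u * m)%:Z - (v * p)%:Z = 1 by rewrite -[RHS]/(1%N : int) -Duv; lia.
  rewrite !PoszM => D1; transitivity (a * 1 - a * u * m); first by ring.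
  by rewrite -D1; ring.
have p0 : p != 0%N by rewrite -lt0n prime_gt0.
exists `|(u %% p)%Z|%N.
have -> : (`|(u %% p)%Z|%N)%:R = (u %% p)%Z%:~R :> algC.
  by rewrite -[X in X%:~R](gez0_abs (modz_ge0 _ _)).
have /dvdzP[b Db] : (p%:Z %| a - (u %% p)%Z * m)%Z.
  have -> : a - (u %% p)%Z * m = (a - u * m) + (u %/ p)%Z * m * p.
    by rewrite [in u * m](divz_eq u p); ring.
  by rewrite rpredD // dvdz_mull.
have -> : (a%:~R / m%:R - (u %% p)%Z%:~R) / p%:R = b%:~R / m%:R :> algC.
  apply: (mulIf p_neq0); rewrite divfK //; apply: (mulIf (ndvd_neq0 pm)).
  rewrite mulrBl divfK ?ndvd_neq0 // mulrAC divfK ?ndvd_neq0 //.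
  by have := congr1 (fun x : int => x%:~R : algC) Db; rewrite rmorphB !rmorphM.
by apply: plocM; [apply: ploc_int | apply: ploc_invn].
Qed.

(** The radical of p in the ring [ploc], that is, the intersection of the maximal ideals above p.
    Allowing k = 0 is harmless because 1 / p is not p-local. *)
Definition pnil (z : algC) : Prop := exists k, ploc (z ^+ k / p%:R).

Lemma pnil_pdiv z : ploc (z / p%:R) -> pnil z.
Proof. by move=> z_loc; exists 1%N. Qed.

Lemma not_pnil1 : ~ pnil 1.
Proof.
case=> k; rewrite expr1n => /(@ploc_ratP 1); rewrite dvdzE /= dvdn1 => /eqP p1.
by move: p_pr; rewrite p1.
Qed.

Lemma pnil_ploc z : pnil z -> ploc z.
Proof.
case=> -[|k] zk; first by case: not_pnil1; exists 0%N; rewrite expr1n.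
apply: (@ploc_root _ k.+1) => //; rewrite -[_ ^+ _](divfK p_neq0).
by apply: plocM => //; apply: ploc_nat.
Qed.

Lemma pnilM y z : ploc y -> pnil z -> pnil (y * z).
Proof.
by move=> y_loc [k zk]; exists k; rewrite exprMn -mulrA; apply: plocM => //; apply: plocX.
Qed.

Lemma pnilMr y z : pnil y -> ploc z -> pnil (y * z).
Proof. by move=> ? ?; rewrite mulrC; apply: pnilM. Qed.

Lemma pnil0 : pnil 0.
Proof. by apply: pnil_pdiv; rewrite mul0r; apply: ploc0. Qed.

Lemma pnilN z : pnil z -> pnil (- z).
Proof. by rewrite -mulN1r; apply/pnilM/(ploc_int (- 1)). Qed.

Lemma pnilD y z : pnil y -> pnil z -> pnil (y + z).
Proof.
move=> ny nz; have [y_loc z_loc] := (pnil_ploc ny, pnil_ploc nz).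
case: ny nz => k yk [m zm]; exists (k + m)%N; rewrite exprDn mulr_suml.
apply: ploc_sum => i _; rewrite mulrnAl -mulr_natl; apply: plocM; first exact: ploc_nat.
have [le_mi | /ltnW le_im] := leqP m i.
  rewrite -[in z ^+ _](subnK le_mi) exprD -!mulrA.
  by apply: plocM; [apply: plocX | apply: plocM => //; apply: plocX].
rewrite -addnBA // exprD -[_ / _]mulrA -mulrA mulrCA [z ^+ i / _]mulrC !mulrA.
rewrite mulrC -[_ * y ^+ k / _]mulrA.
by apply: plocM; [|apply: plocM => //]; apply: plocX.
Qed.

Lemma pnilB y z : pnil y -> pnil z -> pnil (y - z).
Proof. by move=> ? /pnilN; apply: pnilD. Qed.

Lemma pnil_sum (I : Type) (r : seq I) (P : pred I) (F : I -> algC) :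
  (forall i, P i -> pnil (F i)) -> pnil (\sum_(i <- r | P i) F i).
Proof. by move=> nilF; apply: big_ind => //; [apply: pnil0 | apply: pnilD]. Qed.

Lemma pnil_root z k : pnil (z ^+ k) -> pnil z.
Proof. by case=> m zkm; exists (k * m)%N; rewrite exprM. Qed.

Lemma pnil_aut (nu : {rmorphism algC -> algC}) z : pnil z -> pnil (nu z).
Proof.
by move=> [k /(ploc_aut nu)]; rewrite fmorph_div rmorphXn rmorph_nat; exists k.
Qed.

Lemma pnil_int (a : int) : pnil a%:~R -> (p%:Z %| a)%Z.
Proof.
case=> k; rewrite -rmorphXn => /ploc_ratP; rewrite !dvdzE abszX /=.
by rewrite Euclid_dvdX // => /andP[].
Qed.

Lemma pnil_rat z : z \in Crat -> pnil z -> ploc (z / p%:R).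
Proof.
move=> Qz nz; have [a [m pm Dz]] := ploc_rat Qz (pnil_ploc nz).
have /pnil_int/dvdzP[b Da] : pnil a%:~R.
  have -> : a%:~R = m%:R * z by rewrite Dz mulrC divfK // ndvd_neq0.
  by apply: pnilM => //; apply: ploc_nat.
rewrite Dz Da rmorphM /= mulrAC mulfK //.
by apply: plocM; [apply: ploc_int | apply: ploc_invn].
Qed.

Lemma ploc_rat_unit z : z \in Crat -> ploc z -> ~ pnil z -> ploc z^-1.
Proof.
move=> Qz /(ploc_rat Qz)[a [m pm Dz]] nz; rewrite Dz invf_div.
have pa : ~~ (p %| `|a|)%N.
  apply/negP => /dvdnP[b Db]; apply: nz; apply: pnil_pdiv.
  have -> : z / p%:R = (sgz a * b)%:~R / m%:R.
    rewrite Dz [in LHS](intEsg a) Db PoszM !rmorphM /= !mulrA.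
    by rewrite mulrAC mulfK.
  by apply: plocM; [apply: ploc_int | apply: ploc_invn].
have -> : m%:R / a%:~R = (m%:Z * sgz a)%:~R / `|a|%N%:R :> algC.
  have a0 : a != 0 by apply: contraNneq pa => ->; rewrite dvdn0.
  have Da : `|a|%N%:R = (sgz a)%:~R * a%:~R :> algC.
    by rewrite -rmorphM /= -[sgz a * a]abszEsg.
  rewrite Da invfM rmorphM /= mulrA -[_ * _ / (sgz a)%:~R]mulrA divff ?mulr1 //.
  by rewrite intr_eq0 sgz_eq0.
by apply: plocM; [apply: ploc_int | apply: ploc_invn].
Qed.

(** Bezout between p and the denominator m, with u m - v p = 1: z / p is u m (z / p) - v z, and both
    terms are algebraic integers. *)
Lemma ploc_pdiv_Aint z : z \in Aint -> ploc (z / p%:R) -> z / p%:R \in Aint.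
Proof.
move=> Az [m pm mz]; have /coprimeP : coprime m p by rewrite coprime_sym prime_coprime.
have m_gt0 : (0 < m)%N by rewrite lt0n; apply: contraNneq pm => ->; rewrite dvdn0.
case=> // -[u v] /= Duv.
have -> : z / p%:R = u%:R * (m%:R * (z / p%:R)) - v%:R * z.
  transitivity ((u * m - v * p)%:R * (z / p%:R)); first by rewrite Duv mul1r.
  rewrite natrB; last by lia.
  by rewrite !natrM mulrBl mulrA -!mulrA [p%:R * _]mulrC divfK.
by rewrite rpredB // rpredM // rpred_nat.
Qed.

End PLocal.

(** The least m > 0 with m z integral is 1: for a prime p dividing m, the gcd of m with a
    denominator prime to p would be a smaller choice. *)
Lemma ploc_all_Aint z : (forall p, prime p -> ploc p z) -> z \in Aint.
Proof.
move=> z_loc; have [m0 _ z0] := z_loc 2%N isT.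
pose P m := (0 < m)%N && (m%:R * z \in Aint).
have [|m /andP[m_gt0 mz] min_m] := @ex_minnP P.
  have [m pm mz] := z_loc 2%N isT; exists m; rewrite /P mz andbT lt0n.
  by apply: contraNneq pm => ->; rewrite dvdn0.
have [m_le1 | m_gt1] := leqP m 1.
  by have -> : z = m%:R * z by rewrite (_ : m = 1%N) ?mul1r //; lia.
have p_pr := pdiv_prime m_gt1; set p := pdiv m in p_pr.
have [k pk kz] := z_loc p p_pr.
have gmz : (gcdn m k)%:R * z \in Aint.
  have [u v Duv _] := egcdnP k m_gt0.
  have -> : (gcdn m k)%:R * z = u%:R * (m%:R * z) - v%:R * (k%:R * z).
    by rewrite !mulrA -!natrM Duv natrD mulrDl addrC addKr.
  by rewrite rpredB // rpredM ?rpred_nat.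
have := min_m (gcdn m k); rewrite /P gmz gcdn_gt0 m_gt0 => /(_ isT) le_m.
case/negP: pk; apply: dvdn_trans (pdiv_dvd m) _.
suff -> : m = gcdn m k by apply: dvdn_gcdr.
by apply/eqP; rewrite eqn_leq le_m dvdn_leq ?dvdn_gcdl.
Qed.

Lemma prime_group_cycle (G : finGroupType) (g h : G) :
  prime #|G| -> g != 1%g -> exists k, h = (g ^+ k)%g.
Proof.
move=> /primeP[_ dvG] g1; have /cycleP[k ->] : h \in <[g]>%g; last by exists k.
suff -> : <[g]>%g = [set: G]%SET by rewrite inE.
apply/eqP; rewrite eqEcard subsetT cardsT /= -orderE.
have /dvG/orP[|/eqP->//] : (#[g]%g %| #|G|)%N by rewrite -cardsT order_dvdG ?in_setT.
by rewrite order_eq1 (negPf g1).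
Qed.

(** The non-leading coefficients are symmetric functions of positive degree in the roots, so they
    stay in an ideal C of a ring S. Predicates are used because C is an ideal of values in
    [grep_separate], while C = S is the set of almost integral elements in [ploc_complete]. *)
Lemma coef_prod_XsubC_ideal (A : idomainType) (S C : A -> Prop) (s : seq A) :
    S 1 -> (forall x, C x -> S x) -> C 0 ->
    (forall x y, C x -> C y -> C (x - y)) -> (forall x y, S x -> C y -> C (x * y)) ->
    (forall x, x \in s -> C x) ->
  forall i, (i < size s)%N -> C (\prod_(x <- s) ('X - x%:P))`_i.
Proof.
move=> S1 CS C0 CB CM; elim: s => [|a s IHs] Cs i //= lt_i.
have Ca : C a by apply/Cs/mem_head.
have {}IHs j : (j < size s)%N -> C (\prod_(x <- s) ('X - x%:P))`_j.
  by apply: IHs => x sx; apply: Cs; rewrite inE sx orbT.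
set q := \prod_(x <- s) _ in IHs *.
have Sq j : S q`_j.
  have [lt_j | lt_j | ->] := ltngtP j (size s); first exact/CS/IHs.
    by rewrite nth_default ?size_prod_XsubC //; apply: CS.
  have /monicP := monic_prod_XsubC s xpredT idfun; rewrite /= -/q.
  by rewrite lead_coefE size_prod_XsubC /= => ->.
rewrite big_cons -/q mulrBl coefB coefXM coefCM; apply: CB; last first.
  by rewrite mulrC; apply: CM.
by case: i lt_i => // i lt_i; apply: IHs.
Qed.

(** * Galois extensions of prime degree, with a fixed embedding in the algebraic numbers *)

(** The interface through which the arithmetic is done. [gf_extend] and [gf_restrict] tie G to the
    automorphisms of [algC], which also act on periods; [gf_basis] is the linear independence of the
    elements of G, in determinant form. *)
Record galois_field := GaloisField {
  gf_field :> fieldType;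
  gf_group : finGroupType;
  gf_act : gf_group -> {rmorphism gf_field -> gf_field};
  gf_emb : {rmorphism gf_field -> algC};
  gf_actM : forall g h x, gf_act (g * h)%g x = gf_act g (gf_act h x);
  gf_fixed : forall x, (forall g, gf_act g x = x) -> gf_emb x \in Crat;
  gf_faithful : forall g, g != 1%g -> exists x, gf_act g x != x;
  gf_extend : forall g, exists nu : {rmorphism algC -> algC},
    forall x, nu (gf_emb x) = gf_emb (gf_act g x);
  gf_restrict : forall nu : {rmorphism algC -> algC}, exists g,
    forall x, nu (gf_emb x) = gf_emb (gf_act g x);
  gf_prime : prime #|gf_group|;
  gf_basis : exists b : 'I_#|gf_group| -> gf_field,
    \det (\matrix_(i, j) gf_act (enum_val i) (b j)) != 0}.

Section GaloisField.
Variable L : galois_field.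
Local Notation G := (gf_group L).
Local Notation act := (@gf_act L).
Local Notation iota := (@gf_emb L).
Local Notation l := #|G|.

Lemma gmulC : commutative (@mulg G).
Proof.
have G_pr := gf_prime L.
move=> g h; have [->|/(prime_group_cycle h G_pr)[k ->]] := eqVneq g 1%g.
  by rewrite mul1g mulg1.
by rewrite -expgS -expgSr.
Qed.

Lemma act1 x : act 1%g x = x.
Proof. by apply: (fmorph_inj (act 1%g)); rewrite -gf_actM mulg1. Qed.

Lemma actK g : cancel (act g) (act g^-1%g).
Proof. by move=> x; rewrite -gf_actM mulVg act1. Qed.

Lemma actC g h x : act g (act h x) = act h (act g x).
Proof. by rewrite -!gf_actM gmulC. Qed.

Lemma emb_inj : injective iota. Proof. exact: fmorph_inj. Qed.

Lemma emb_fixed x g : iota x \in Crat -> act g x = x.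
Proof.
move=> /CratP[q Dq]; have -> : x = ratr q.
  apply: emb_inj; rewrite Dq; move: (q) => q'.
  by rewrite fmorph_rat.
by rewrite fmorph_rat.
Qed.

Lemma gcard_gt1 : (1 < l)%N. Proof. exact/prime_gt1/gf_prime. Qed.

Lemma gnontrivial : exists g : G, g != 1%g.
Proof.
have [g|] := pickP (fun g : G => g != 1%g); first by exists g.
move=> G1; have := gcard_gt1; rewrite (@eq_card1 _ 1%g) // => g.
by rewrite !inE; have /negbFE-> := G1 g.
Qed.

Definition gtr (x : L) : L := \sum_(g : G) act g x.
Definition gnorm (x : L) : L := \prod_(g : G) act g x.

Lemma gtr_act g x : act g (gtr x) = gtr x.
Proof.
rewrite /gtr rmorph_sum /= [RHS](reindex_inj (mulgI g)) /=.
by apply: eq_bigr => h _; rewrite gf_actM.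
Qed.

Lemma gtr_actl g x : gtr (act g x) = gtr x.
Proof. by rewrite -[RHS](gtr_act g) /gtr rmorph_sum; apply: eq_bigr => h _; rewrite actC. Qed.

Lemma gnorm_act g x : act g (gnorm x) = gnorm x.
Proof.
rewrite /gnorm rmorph_prod /= [RHS](reindex_inj (mulgI g)) /=.
by apply: eq_bigr => h _; rewrite gf_actM.
Qed.

Lemma gtr_rat x : iota (gtr x) \in Crat.
Proof. by apply: gf_fixed => g; apply: gtr_act. Qed.

Lemma gnorm_rat x : iota (gnorm x) \in Crat.
Proof. by apply: gf_fixed => g; apply: gnorm_act. Qed.

Lemma gtrD x y : gtr (x + y) = gtr x + gtr y.
Proof. by rewrite /gtr -big_split; apply: eq_bigr => g _; rewrite rmorphD. Qed.

Lemma gtrZ a x : iota a \in Crat -> gtr (a * x) = a * gtr x.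
Proof. by move=> Qa; rewrite /gtr mulr_sumr; apply: eq_bigr => g _; rewrite rmorphM /= emb_fixed. Qed.

Lemma gtr_id a : iota a \in Crat -> gtr a = a *+ l.
Proof.
move=> Qa; rewrite /gtr (eq_bigr (fun=> a)) ?sumr_const // => g _.
by rewrite emb_fixed.
Qed.

Lemma gnormM x y : gnorm (x * y) = gnorm x * gnorm y.
Proof. by rewrite /gnorm -big_split; apply: eq_bigr => g _; rewrite rmorphM. Qed.

Lemma gnorm_id a : iota a \in Crat -> gnorm a = a ^+ l.
Proof.
move=> Qa; rewrite /gnorm (eq_bigr (fun=> a)) ?prodr_const // => g _.
by rewrite emb_fixed.
Qed.

Lemma gnorm_eq0 x : (gnorm x == 0) = (x == 0).
Proof.
apply/prodf_eq0/eqP => [[g _]|->]; last by exists 1%g; rewrite ?rmorph0.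
by rewrite fmorph_eq0 => /eqP.
Qed.

Lemma gnormE x : gnorm x = x * \prod_(g : G | g != 1%g) act g x.
Proof. by rewrite /gnorm (bigD1 1%g) //= act1. Qed.

Definition gchar (x : L) : {poly L} := \prod_(g : G) ('X - (act g x)%:P).

Lemma gchar_seq x : gchar x = \prod_(y <- [seq act g x | g : G]) ('X - y%:P).
Proof. by rewrite /gchar big_image. Qed.

Lemma gchar_rat x i : iota (gchar x)`_i \in Crat.
Proof.
apply: gf_fixed => g; rewrite -coef_map.
suff -> : map_poly (act g) (gchar x) = gchar x by [].
rewrite /gchar rmorph_prod /= [RHS](reindex_inj (mulgI g)) /=.
by apply: eq_bigr => h _; rewrite rmorphB /= map_polyX map_polyC /= gf_actM.
Qed.

Lemma gchar_root x : root (gchar x) x.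
Proof. by rewrite gchar_seq root_prod_XsubC; apply/imageP; exists 1%g; rewrite ?act1. Qed.

Lemma gchar_monic x : gchar x \is monic.
Proof. by rewrite gchar_seq monic_prod_XsubC. Qed.

Lemma size_gchar x : size (gchar x) = l.+1.
Proof. by rewrite gchar_seq size_prod_XsubC size_image cardE -cardT. Qed.

Lemma gchar_eq0 x : x ^+ l = - \sum_(i < l) (gchar x)`_i * x ^+ i.
Proof.
have /eqP := gchar_root x; rewrite horner_coef size_gchar big_ord_recr /=.
have /monicP := gchar_monic x; rewrite lead_coefE size_gchar /= => ->.
by rewrite mul1r addrC => /eqP; rewrite addr_eq0 => /eqP.
Qed.

(** * Trivial action modulo p, or self-duality for the trace at p *)

Section Prime.
Variable p : nat.
Hypothesis p_pr : prime p.
Local Notation R x := (ploc p (iota x)).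
Local Notation J x := (pnil p (iota x)).

Lemma ploc_act g x : R x -> R (act g x).
Proof. by have [nu <-] := gf_extend g; apply: ploc_aut. Qed.

Lemma pnil_act g x : J x -> J (act g x).
Proof. by have [nu <-] := gf_extend g; apply: pnil_aut. Qed.

Lemma pnil_act_sub g x : (forall y, R y -> J (act g y - y)) -> forall k, R x -> J (act (g ^+ k)%g x - x).
Proof.
move=> triv_g k Rx; elim: k => [|k IHk]; first by rewrite expg0 act1 subrr rmorph0; apply: pnil0.
have -> : act (g ^+ k.+1)%g x - x = act g (act (g ^+ k)%g x - x) + (act g x - x).
  by rewrite expgS gf_actM rmorphB addrA subrK.
rewrite rmorphD.
by apply: pnilD => //; [apply: pnil_act | apply: triv_g].
Qed.

(** The inertia group at p is all of G. As G has prime order, the alternative is that p is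
    unramified; the lemmas below extract this without factoring p into primes of L. *)
Definition inertial := forall g x, R x -> J (act g x - x).

(** The image of the tensor square of the local ring in the functions on G, a tensor b giving h |->
    a h(b). In the unramified case it contains the indicator of 1, the image of the separability
    idempotent. *)
Definition grep (F : G -> L) := exists2 s : seq (L * L),
  (forall u, u \in s -> R u.1 /\ R u.2) & forall h, F h = \sum_(u <- s) u.1 * act h u.2.

Lemma grep_monomial a b : R a -> R b -> grep (fun h => a * act h b).
Proof.
move=> Ra Rb; exists [:: (a, b)] => [u|h]; last by rewrite big_seq1.
by rewrite inE => /eqP->.
Qed.

Lemma grep_ext F F' : F =1 F' -> grep F -> grep F'.
Proof. by move=> eqF [s Rs DF]; exists s => // h; rewrite -eqF. Qed.

Lemma grepD F F' : grep F -> grep F' -> grep (fun h => F h + F' h).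
Proof.
move=> [s Rs DF] [s' Rs' DF']; exists (s ++ s') => [u|h].
  by rewrite mem_cat => /orP[/Rs|/Rs'].
by rewrite big_cat DF DF'.
Qed.

Lemma grepM F F' : grep F -> grep F' -> grep (fun h => F h * F' h).
Proof.
move=> [s Rs DF] [s' Rs' DF'].
exists [seq (u.1 * v.1, u.2 * v.2) | u <- s, v <- s'] => [_ /allpairsP[[u v] /= [us vs ->]]|h].
  have [[Ru1 Ru2] [Rv1 Rv2]] := (Rs u us, Rs' v vs).
  by rewrite !rmorphM; split; apply: plocM.
rewrite big_allpairs_dep DF DF' mulr_suml; apply: eq_bigr => u _; rewrite mulr_sumr.
by apply: eq_bigr => v _ /=; rewrite rmorphM mulrACA.
Qed.

Lemma grep1 : grep (fun=> 1).
Proof.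
have R1 : R 1 by rewrite rmorph1; apply: ploc1.
by apply: grep_ext (grep_monomial R1 R1) => h; rewrite rmorph1 mulr1.
Qed.

Lemma grep_prod (I : Type) (r : seq I) (P : pred I) (F : I -> G -> L) :
  (forall i, P i -> grep (F i)) -> grep (fun h => \prod_(i <- r | P i) F i h).
Proof.
move=> gF; elim: r => [|i r IHr].
  by apply: grep_ext grep1 => h; rewrite big_nil.
have [Pi|nPi] := boolP (P i); last by apply: grep_ext IHr => h; rewrite big_cons (negPf nPi).
by apply: grep_ext (grepM (gF i Pi) IHr) => h; rewrite big_cons Pi.
Qed.

(** The values F(1), for represented F vanishing at g, form an ideal C containing every g(y) - y.
    Since g generates G, some c = g(x) - x is outside the radical. The non-leading coefficients of
    the characteristic polynomial of c are rational and in C; if all were in the radical, so would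
    be c^l and c. One of them is thus a unit, and 1 is in C. *)
Lemma grep_separate : ~ inertial -> forall g, g != 1%g ->
  exists2 F, grep F & F g = 0 /\ F 1%g = 1.
Proof.
move=> not_in g g1.
have [x Rx nJx] : exists2 x, R x & ~ J (act g x - x).
  apply: contrapT => no_x; apply: not_in => h x Rx.
  have [k ->] := prime_group_cycle h (gf_prime L) g1.
  by apply: pnil_act_sub => // y Ry; apply: contrapT => nJy; apply: no_x; exists y.
pose C z := exists2 F, grep F & F g = 0 /\ F 1%g = z.
suff : C 1 by [].
have R1 : R 1 by rewrite rmorph1; apply: ploc1.
have C0 : C 0.
  by exists (fun=> 0) => //; exists [::] => // h; rewrite big_nil.
have CD y z : C y -> C z -> C (y + z).
  move=> [F gF [F0 <-]] [F' gF' [F'0 <-]].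
  by exists (fun h => F h + F' h); [apply: grepD | rewrite F0 F'0 addr0].
have CM y z : R y -> C z -> C (y * z).
  move=> Ry [F gF [F0 <-]]; exists (fun h => y * F h); last by rewrite F0 mulr0.
  apply: (@grep_ext (fun h => (y * act h 1) * F h)) => [h|]; first by rewrite rmorph1 mulr1.
  by apply: grepM => //; apply: grep_monomial.
have CB y z : C y -> C z -> C (y - z).
  move=> Cy Cz; apply: CD => //; rewrite -mulN1r; apply: CM => //.
  by rewrite rmorphN1; apply: (@ploc_int p p_pr (-1)).
have CR y : C y -> R y.
  move=> [F [s Rs DF] [_ <-]]; rewrite DF rmorph_sum /=.
  rewrite big_seq; apply: ploc_sum => // u /Rs[Ru1 Ru2].
  by rewrite rmorphM; apply: plocM => //; apply: ploc_act.
have Csub y : R y -> C (act g y - y).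
  move=> Ry; exists (fun h => act g y * act h 1 + (-1) * act h y); last first.
    by rewrite !rmorph1 !mulr1 act1 !mulN1r subrr.
  apply: grepD; apply: grep_monomial => //; first exact: ploc_act.
  by rewrite rmorphN1; apply: (@ploc_int p p_pr (-1)).
set c := act g x - x in nJx.
have Rc : R c by rewrite rmorphB; apply: plocB => //; apply: ploc_act.
have Cc i : (i < l)%N -> C (gchar c)`_i.
  move=> lt_i; rewrite gchar_seq; apply: (@coef_prod_XsubC_ideal _ (fun z => R z) C) => //.
    move=> _ /imageP[h _ ->]; rewrite rmorphB /= actC.
    by apply: Csub; apply: ploc_act.
  by rewrite size_image cardE -cardT.
have [nJ | J_all] := pselect (exists i : 'I_l, ~ J (gchar c)`_i).
  have [i nJi] := nJ; rewrite -(@mulVf _ (gchar c)`_i); last first.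
    by apply/eqP => c0; apply: nJi; rewrite c0 rmorph0; apply: pnil0.
  apply: CM; last exact: Cc.
  by rewrite fmorphV; apply: ploc_rat_unit => //; [apply: gchar_rat | apply/CR/Cc].
case: nJx; apply: (@pnil_root p _ l); rewrite -rmorphXn gchar_eq0 rmorphN rmorph_sum /=.
apply: pnilN => //; apply: pnil_sum => // i _; rewrite rmorphM; apply: pnilMr => //.
  by apply: contrapT => nJi; apply: J_all; exists i.
by rewrite rmorphXn; apply: plocX.
Qed.

Lemma grep_delta : ~ inertial -> grep (fun h => (h == 1%g)%:R).
Proof.
move=> /grep_separate sep.
have {sep} [F FP] : exists F : G -> G -> L,
    forall g, g != 1%g -> [/\ grep (F g), F g g = 0 & F g 1%g = 1].
  suff /choice[F FP] : forall g, exists Fg : G -> L,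
    g != 1%g -> [/\ grep Fg, Fg g = 0 & Fg 1%g = 1] by exists F.
  move=> g; have [->|/sep[F gF [F0 F1]]] := eqVneq g 1%g; first by exists (fun=> 0).
  by exists F.
apply: (@grep_ext (fun h => \prod_(g | g != 1%g) F g h)) => [h|].
  have [->|h1] := eqVneq h 1%g; first by rewrite big1 // => g /FP[].
  by rewrite (bigD1 h) //=; have [_ -> _] := FP h h1; rewrite mul0r.
by apply: grep_prod => g /FP[].
Qed.

(** Writing the indicator of 1 as h |-> sum_i a_i h(b_i) gives x = sum_i a_i tr(x b_i): the
    different is trivial at p. *)
Lemma noninertial_trace_dual x : ~ inertial ->
  (forall y, R y -> R (gtr (x * y))) -> R x.
Proof.
move=> /grep_delta[s Rs Ds] Rtr.
have -> : x = \sum_(u <- s) u.1 * gtr (x * u.2).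
  transitivity (\sum_(h : G) (h == 1%g)%:R * act h x).
    by rewrite (bigD1 1%g) //= big1 ?addr0 ?eqxx ?mul1r ?act1 // => h /negPf->; rewrite mul0r.
  under eq_bigr => h _ do rewrite Ds mulr_suml.
  rewrite [LHS]exchange_big; apply: eq_bigr => u _; rewrite /gtr mulr_sumr.
  by apply: eq_bigr => h _; rewrite rmorphM /=; ring.
rewrite rmorph_sum /= big_seq; apply: ploc_sum => // u /Rs[Ru1 Ru2].
by rewrite rmorphM; apply: plocM => //; apply: Rtr.
Qed.

Lemma ploc_gtr x : R x -> R (gtr x).
Proof. by move=> Rx; rewrite rmorph_sum; apply: ploc_sum => // g _; apply: ploc_act. Qed.

Lemma pnil_gtr x : J x -> J (gtr x).
Proof. by move=> Rx; rewrite rmorph_sum; apply: pnil_sum => // g _; apply: pnil_act. Qed.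

Lemma ploc_gnorm x : R x -> R (gnorm x).
Proof. by move=> Rx; rewrite rmorph_prod; apply: ploc_prod => // g _; apply: ploc_act. Qed.

(** Each tr(x y) with y local is rational and in the radical, hence divisible by p; so x / p lies in
    the trace dual, which is the local ring itself. *)
Lemma noninertial_pnil x : ~ inertial -> J x -> R (x / p%:R).
Proof.
move=> not_in Jx; apply: noninertial_trace_dual => // y Ry.
have Qp : iota p%:R^-1 \in Crat by rewrite fmorphV rmorph_nat rpredV rpred_nat.
rewrite mulrAC mulrC gtrZ // mulrC fmorph_div rmorph_nat.
apply: pnil_rat => //; first exact: gtr_rat.
by apply: pnil_gtr; rewrite rmorphM; apply: pnilMr.
Qed.

End Prime.
End GaloisField.

(** m z is a root of m^n q(X / m), which is monic; in each lower coefficient one factor m already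
    clears the denominator. *)
Lemma Aint_scaled_root (q : {poly algC}) (m : nat) z :
  q \is monic -> root q z -> (forall i, m%:R * q`_i \in Num.int) -> m%:R * z \in Aint.
Proof.
move=> mon_q qz0 mq; have [m0|m_neq0] := eqVneq (m%:R : algC) 0.
  by rewrite m0 mul0r Aint0.
pose n := (size q).-1.
have Dn : size q = n.+1 by rewrite prednK // lt0n size_poly_eq0 monic_neq0.
have qn : q`_n = 1 by apply/eqP; rewrite -[_ == _]/(q \is monic) ?lead_coefE.
pose r := \poly_(i < n.+1) (m%:R ^+ (n - i) * q`_i).
apply: (@root_monic_Aint r).
- rewrite /root horner_poly; move: qz0; rewrite /root horner_coef Dn => /eqP q0.
  apply/eqP; rewrite -[RHS](mulr0 (m%:R ^+ n)) -[X in _ = _ * X]q0 mulr_sumr.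
  apply: eq_bigr => i _.
  have Dni : (n - i + i)%N = n by rewrite subnK // -ltnS.
  by rewrite -[X in _ = _ ^+ X * _]Dni exprMn exprD; ring.
- by rewrite monicE lead_coef_poly ?qn ?subnn ?mul1r ?oner_neq0.
- apply/polyOverP => i; rewrite coef_poly; case: ltnP => [lt_i|_]; last by rewrite rpred0.
  have [->|lt_in] : i = n \/ (i < n)%N by lia.
    by rewrite subnn qn mulr1 expr0 rpred1.
  by rewrite -[(n - i)%N]prednK ?subn_gt0 // exprSr -mulrA rpredM // rpredX // natr_int.
Qed.

Lemma ratr_num_den (q : rat) : ratr q = (numq q)%:~R / (denq q)%:~R :> algC.
Proof. by rewrite -[in LHS](divq_num_den q) fmorph_div !rmorph_int. Qed.

Lemma Aint_scale z : exists2 m : nat, (0 < m)%N & m%:R * z \in Aint.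
Proof.
have [q [Dq mon_q] _] := minCpolyP z.
have [m m_gt0 mq] : exists2 m : nat, (0 < m)%N & forall i, m%:R * ratr q`_i \in (Num.int : qualifier 1 algC).
  exists (\prod_(i < size q) `|denq q`_i|%N)%N.
    by rewrite prodn_gt0 // => i; rewrite absz_gt0 denq_neq0.
  move=> i; have [lt_i|ge_i] := ltnP i (size q); last by rewrite nth_default // rmorph0 mulr0.
  rewrite (bigD1 (Ordinal lt_i)) //= natrM mulrAC rpredM ?natr_int //.
  have -> : `|denq q`_i|%N%:R = (denq q`_i)%:~R :> algC.
    by rewrite -[in RHS](gez0_abs (denq_ge0 _)).
  rewrite ratr_num_den mulrC divfK ?intr_int //.
  by rewrite intr_eq0 denq_neq0.
exists m => //; apply: (@Aint_scaled_root (minCpoly z)) => [||i].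
- exact: minCpoly_monic.
- exact: root_minCpoly.
- by rewrite Dq coef_map; apply: mq.
Qed.

(** * Almost integral elements and congruences at p *)

Section PLocal2.
Variable p : nat.
Hypothesis p_pr : prime p.

Let p_neq0 : (p%:R : algC) != 0.
Proof. by rewrite pnatr_eq0 -lt0n prime_gt0. Qed.

Lemma ploc_monic_root (q : {poly algC}) z : q \is monic -> root q z ->
  (forall i, q`_i \in Crat /\ ploc p q`_i) -> ploc p z.
Proof.
move=> mon_q qz0 qP.
have /choice[m mP] : forall i, exists m : nat, ~~ (p %| m)%N /\ m%:R * q`_i \in Num.int.
  move=> i; have [Qi [m pm Ai]] := qP i; exists m; split=> //.
  by rewrite Cint_rat_Aint // rpredM // rpred_nat.
exists (\prod_(i < size q) m i)%N.
  elim/big_rec: _ => [|i k _ pk]; first by rewrite dvdn1 neq_ltn prime_gt1 ?orbT.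
  by rewrite Euclid_dvdM // negb_or pk; have [->] := mP i.
apply: Aint_scaled_root mon_q qz0 _ => i.
have [lt_i|ge_i] := ltnP i (size q); last by rewrite nth_default // mulr0.
by rewrite (bigD1 (Ordinal lt_i)) //= natrM mulrAC rpredM ?natr_int //; have [] := mP i.
Qed.

Lemma ploc_scale z : exists k, ploc p (p%:R ^+ k * z).
Proof.
have [m m_gt0 Amz] := Aint_scale z.
have [m' pm' Dm] := pfactor_coprime p_pr m_gt0.
exists (logn p m), m'; first by rewrite -prime_coprime.
by rewrite -natrX mulrA -natrM -Dm.
Qed.

Lemma not_ploc_Vp : ~ ploc p p%:R^-1.
Proof.
by move=> nV; apply: (@not_pnil1 p p_pr); exists 1%N; rewrite mul1r.
Qed.

(** If z <> 0 then p^k / z is local for some k, and its product with z / p^(k+1) would make 1 / p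
    local. *)
Lemma ploc_infinite z : (forall k, ploc p (z / p%:R ^+ k)) -> z = 0.
Proof.
move=> zP; apply/eqP/negP => /negP z0; have [k zVk] := ploc_scale z^-1.
have := plocM p_pr zVk (zP k.+1).
rewrite exprS invfM mulrA -[_ * z^-1 * z]mulrA mulVf // mulr1.
by rewrite mulrC -mulrA mulVf ?expf_neq0 // mulr1; apply: not_ploc_Vp.
Qed.

Lemma ploc_rat_or z : z \in Crat -> ploc p z \/ ploc p (z^-1 / p%:R).
Proof.
move=> /CratP[q ->{z}].
have Dq : ratr q = (numq q)%:~R / (denq q)%:~R :> algC.
  exact: ratr_num_den.
have d_gt0 := denq_gt0 q.
have Dd : (denq q)%:~R = `|denq q|%N%:R :> algC by rewrite -[in LHS](gez0_abs (denq_ge0 _)).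
have [/dvdnP[b Db]|pd] := boolP (p %| `|denq q|)%N; last first.
  by left; rewrite Dq Dd; apply: plocM; [|apply: ploc_int|apply: ploc_invn].
right; have pn : ~~ (p %| `|numq q|)%N.
  apply: contraL (coprime_num_den q) => pn; rewrite /coprime.
  apply: contraTneq (prime_gt1 p_pr) => g1.
  by rewrite -leqNgt dvdn_leq // -g1 dvdn_gcd pn Db dvdn_mull.
have -> : (ratr q)^-1 / p%:R = b%:R / (numq q)%:~R :> algC.
  by rewrite Dq invf_div Dd Db natrM mulrAC mulfK.
apply: plocM => //; first exact: ploc_nat.
by apply: ploc_rat_unit (ploc_int p_pr _) _ => //; [apply: rpred_int | move/(pnil_int p_pr); rewrite dvdzE (negPf pn)].
Qed.

(** Almost integrality: one power of p clears the denominators of all powers of z. For rationals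
    this is integrality ([palmost_rat]), and [ploc_complete] passes from there to L through
    characteristic polynomials. *)
Definition palmost z := exists c, forall m, ploc p (p%:R ^+ c * z ^+ m).

Lemma palmost_rat z : z \in Crat -> palmost z -> ploc p z.
Proof.
move=> Qz [c zc]; have [//|zV] := ploc_rat_or Qz.
have [->|z0] := eqVneq z 0; first exact: ploc0.
have := plocM p_pr (zc c.+1) (plocX p_pr c.+1 zV); rewrite exprMn mulrA.
rewrite -[_ * _ * z^-1 ^+ _]mulrA -exprMn divff // expr1n mulr1 exprVn exprS invfM mulrCA.
by rewrite divff ?expf_neq0 // mulr1 => /not_ploc_Vp.
Qed.

Lemma palmost_ploc z : ploc p z -> palmost z.
Proof. by move=> z_loc; exists 0%N => m; rewrite mul1r; apply: plocX. Qed.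

Lemma palmostM y z : palmost y -> palmost z -> palmost (y * z).
Proof.
move=> [c yc] [d zd]; exists (c + d)%N => m.
by rewrite exprD exprMn mulrACA; apply: plocM.
Qed.

Lemma palmostB y z : palmost y -> palmost z -> palmost (y - z).
Proof.
move=> ya /(palmostM (palmost_ploc (ploc_int p_pr (-1)))).
rewrite rmorphN1 mulN1r; case: ya => c yc [d zd]; exists (c + d)%N => m.
rewrite exprDn mulr_sumr; apply: ploc_sum => // i _.
rewrite mulrnAr -mulr_natl exprD mulrACA; apply: plocM => //; first exact: ploc_nat.
exact: plocM.
Qed.

Lemma ploc_frobenius y z : ploc p y -> ploc p z ->
  ploc p (((y + z) ^+ p - y ^+ p - z ^+ p) / p%:R).
Proof.
move=> y_loc z_loc; have p_gt0 := prime_gt0 p_pr.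
have max0 : ord_max != ord0 :> 'I_p.+1 by rewrite -val_eqE /= -lt0n.
rewrite exprDn (bigD1 ord0) //= (bigD1 ord_max) //=.
rewrite subn0 subnn bin0 binn !mulr1n !expr0 mul1r mulr1.
set s := \sum_(i < _ | _) _; have -> : y ^+ p + (z ^+ p + s) - y ^+ p - z ^+ p = s by ring.
rewrite mulr_suml; apply: ploc_sum => // i /andP[i0 imax].
have /(prime_dvd_bin p_pr)/dvdnP[c ->] : (0 < i < p)%N.
  by rewrite lt0n -val_eqE in i0 *; rewrite i0; move: imax (ltn_ord i); rewrite -val_eqE /=; lia.
rewrite -mulr_natl natrM mulrAC mulfK //.
apply: plocM; [exact: p_pr|exact: ploc_nat|].
by apply: plocM; [exact: p_pr|apply: plocX|apply: plocX].
Qed.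

Definition pcong y z := pnil p (y - z).

Lemma pcong_refl z : pcong z z.
Proof. by rewrite /pcong subrr; apply: pnil0. Qed.

Lemma pcong_sym y z : pcong y z -> pcong z y.
Proof. by rewrite /pcong -opprB => /(pnilN p_pr); rewrite opprK. Qed.

Lemma pcong_trans x y z : pcong x y -> pcong y z -> pcong x z.
Proof. by move=> xy yz; rewrite /pcong -(subrK y x) -addrA; apply: pnilD. Qed.

Lemma pcongM x x' y y' : ploc p x -> ploc p y' ->
  pcong x x' -> pcong y y' -> pcong (x * y) (x' * y').
Proof.
move=> Rx Ry' xx yy.
have Dxy : x * y - x' * y' = x * (y - y') + (x - x') * y' by ring.
by rewrite /pcong Dxy; apply: pnilD => //; [apply: pnilM | apply: pnilMr].
Qed.

Lemma pcong_ploc x y : pcong x y -> ploc p y -> ploc p x.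
Proof. by move=> /(pnil_ploc p_pr) Rxy Ry; rewrite -(subrK y x); apply: plocD. Qed.

Lemma pcong_pnil x y : pcong x y -> pnil p y -> pnil p x.
Proof. by move=> Rxy Ry; rewrite -(subrK y x); apply: pnilD. Qed.

Lemma pcong_prod (I : Type) (r : seq I) (P : pred I) (F F' : I -> algC) :
    (forall i, P i -> pcong (F i) (F' i)) -> (forall i, P i -> ploc p (F i)) ->
  pcong (\prod_(i <- r | P i) F i) (\prod_(i <- r | P i) F' i).
Proof.
move=> cF RF; suff [] : pcong (\prod_(i <- r | P i) F i) (\prod_(i <- r | P i) F' i)
   /\ ploc p (\prod_(i <- r | P i) F' i) by [].
elim/big_rec2: _ => [|i y x Pi [IH Rx]]; first by split; [apply: pcong_refl | apply: ploc1].
have RF' : ploc p (F' i) by apply: pcong_ploc (RF i Pi); apply/pcong_sym/cF.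
by split; [apply: pcongM => //; [apply: RF | apply: cF] | apply: plocM].
Qed.

Lemma pcongX x y k : ploc p x -> pcong x y -> pcong (x ^+ k) (y ^+ k).
Proof.
move=> Rx xy; elim: k => [|k IHk]; first exact: pcong_refl.
by rewrite !exprS; apply: pcongM => //; apply: plocX => //; apply: pcong_ploc (pcong_sym xy) Rx.
Qed.

Lemma pcong_nat (a b : nat) : pcong a%:R b%:R -> a = b %[mod p].
Proof.
have -> : a%:R = b%:R + (a%:Z - b%:Z)%:~R :> algC by rewrite rmorphB addrC subrK.
rewrite /pcong addrC addKr => h; have := pnil_int p_pr h.
by rewrite -eqz_mod_dvd => /eqP; rewrite !modz_nat => -[].
Qed.

Lemma pcong_eqmod (a b : nat) : a = b %[mod p] -> pcong a%:R b%:R.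
Proof.
move=> ab; apply: pnil_pdiv => //.
have /dvdzP[c Dc] : (p%:Z %| a%:Z - b%:Z)%Z by rewrite -eqz_mod_dvd !modz_nat ab.
have -> : a%:R - b%:R = c%:~R * p%:R :> algC.
  by transitivity ((a%:Z - b%:Z)%:~R : algC); [rewrite rmorphB | rewrite Dc rmorphM].
by rewrite mulfK //; apply: ploc_int.
Qed.

End PLocal2.

(** * Linear relations among l + 1 elements *)

Section Dependence.
Variable L : galois_field.
Local Notation G := (gf_group L).
Local Notation act := (@gf_act L).
Local Notation iota := (@gf_emb L).
Local Notation l := #|G|.

Lemma gcard_neq0 : (l%:R : L) != 0.
Proof.
rewrite -(fmorph_eq0 iota) rmorph_nat pnatr_eq0 -lt0n.
exact: ltnW (gcard_gt1 L).
Qed.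

(** The matrix of conjugates has l + 1 rows and l columns, so some nonzero vector v over L gives a
    relation valid for all conjugates at once. This allows replacing v by the traces of its entries;
    normalising one entry to 1 beforehand gives that entry trace l, so the relation stays
    nontrivial. *)
Lemma rat_dependence (u : 'I_l.+1 -> L) :
  exists2 q : 'I_l.+1 -> rat, exists j, q j != 0 & \sum_j ratr (q j) * iota (u j) = 0.
Proof.
pose A := \matrix_(j < l.+1, i < l) act (enum_val i) (u j).
have /rowV0Pn[v /sub_kermxP vA v0] : kermx A != 0.
  by rewrite kermx_eq0 -row_leq_rank -ltnNge ltnS rank_leq_col.
have {}vA g : \sum_j v 0 j * act g (u j) = 0.
  have /rowP/(_ (enum_rank g)) := vA; rewrite !mxE => vAg; rewrite -[RHS]vAg.
  by apply: eq_bigr => j _; rewrite !mxE enum_rankK.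
have [j0 vj0] : exists j, v 0 j != 0.
  apply/existsP; apply: contraNT v0 => /existsPn v0.
  by apply/eqP/rowP => j; rewrite mxE; apply/eqP/negbNE/v0.
pose w j := gtr (v 0 j / v 0 j0).
have /choice[q Dq] : forall j, exists q : rat, iota (w j) = ratr q.
  move=> j; have /CratP[q Dq] := gtr_rat (v 0 j / v 0 j0).
  by exists q.
exists q.
  exists j0; suff : ratr (q j0) != 0 :> algC by rewrite fmorph_eq0.
  rewrite -Dq fmorph_eq0 /w divff //.
  by rewrite gtr_id ?gcard_neq0 // rmorph1 rpred1.
under eq_bigr => j _ do rewrite -Dq -rmorphM.
rewrite -rmorph_sum -[RHS](rmorph0 iota); congr (iota _).
transitivity (\sum_(g : G) act g (\sum_j v 0 j / v 0 j0 * act g^-1%g (u j))).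
  under eq_bigr => j _ do rewrite /w mulr_suml.
  rewrite exchange_big; apply: eq_bigr => g _ /=.
  rewrite rmorph_sum; apply: eq_bigr => j _.
  by rewrite [in RHS]rmorphM -[act g (act _ _)]gf_actM mulgV act1.
rewrite big1 // => g _; rewrite -[RHS](rmorph0 (act g)); congr (act g _).
transitivity ((v 0 j0)^-1 * \sum_j v 0 j * act g^-1%g (u j)).
  by rewrite mulr_sumr; apply: eq_bigr => j _; rewrite mulrCA mulrA mulrAC.
by rewrite vA mulr0.
Qed.

(** Denominators are cleared and the gcd D of the coefficients is divided out, after which p cannot
    divide all of them. *)
Lemma int_dependence (u : 'I_l.+1 -> L) (p : nat) : prime p ->
  exists2 a : 'I_l.+1 -> int, exists j, ~~ (p%:Z %| a j)%Z & \sum_j (a j)%:~R * u j = 0.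
Proof.
move=> p_pr; have [q [j0 qj0] Dq] := rat_dependence u.
pose d := \prod_j denq (q j).
have d0 : d != 0 by apply/prodf_neq0 => j _; rewrite denq_neq0.
pose b j := numq (q j) * \prod_(i | i != j) denq (q i).
have Db j : (b j)%:~R = d%:~R * ratr (q j) :> algC.
  rewrite ratr_num_den /d (bigD1 j) //= /b !rmorphM /=.
  by field; rewrite intr_eq0 denq_neq0.
pose D := (\big[gcdn/0]_j `|b j|)%N.
have D_gt0 : (0 < D)%N.
  rewrite lt0n; apply: contra_neq qj0 => D0.
  have : (D %| `|b j0|)%N by apply: (dvdn_biggcdP _ _ _ (dvdnn D)).
  rewrite D0 dvd0n absz_eq0 => /eqP bj0; apply/eqP; move: (Db j0).
  by rewrite bj0 mulr0z => /esym/eqP; rewrite mulf_eq0 intr_eq0 (negPf d0) fmorph_eq0.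
have DD j : (D%:Z %| b j)%Z by rewrite dvdzE; apply: (dvdn_biggcdP _ _ _ (dvdnn D)).
exists (fun j => (b j %/ D%:Z)%Z).
  apply: contrapT => no_j; suff : (p * D %| D)%N.
    by rewrite -[X in (_ %| X)%N]mul1n dvdn_pmul2r // dvdn1 => /eqP p1; move: p_pr; rewrite p1.
  apply/dvdn_biggcdP => j _; rewrite -[b j](divzK (DD j)) abszM dvdn_mul //.
  by apply: contrapT => npj; apply: no_j; exists j; apply/negP.
have cD : (D%:R : L) != 0.
  by rewrite -(fmorph_eq0 iota) rmorph_nat pnatr_eq0 -lt0n.
apply: (mulfI cD); rewrite mulr0 mulr_sumr; apply: (@emb_inj L).
rewrite rmorph0; transitivity (d%:~R * \sum_j ratr (q j) * iota (u j)); last first.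
  by rewrite Dq mulr0.
rewrite rmorph_sum mulr_sumr; apply: eq_bigr => j _.
rewrite !rmorphM /= rmorph_nat rmorph_int !mulrA; congr (_ * _).
transitivity ((b j)%:~R : algC); last by rewrite Db ratr_num_den mulrA.
by rewrite -[in RHS](divzK (DD j)) rmorphM /= mulrC.
Qed.

End Dependence.

(** * The local ring at an inertial prime *)

Section Inertial.
Variable L : galois_field.
Local Notation G := (gf_group L).
Local Notation act := (@gf_act L).
Local Notation iota := (@gf_emb L).
Local Notation l := #|G|.
Variable p : nat.
Hypotheses (p_pr : prime p) (inert : inertial L p).
Local Notation R x := (ploc p (iota x)).
Local Notation J x := (pnil p (iota x)).

Let p_neq0 : (p%:R : algC) != 0.
Proof. by rewrite pnatr_eq0 -lt0n prime_gt0. Qed.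
Let pL_neq0 : (p%:R : L) != 0.
Proof. by rewrite -(fmorph_eq0 iota) rmorph_nat. Qed.

Lemma ploc_embM x y : R x -> R y -> R (x * y).
Proof. by rewrite rmorphM; apply: plocM. Qed.

Lemma pnil_embM x y : R x -> J y -> J (x * y).
Proof. by rewrite rmorphM; apply: pnilM. Qed.

Lemma pnil_emb_ploc x : J x -> R x.
Proof. exact: pnil_ploc. Qed.

Lemma inertial_gnorm x : R x -> pcong p (iota (gnorm x)) (iota x ^+ l).
Proof.
move=> Rx; rewrite /gnorm rmorph_prod /= -prodr_const.
apply: pcong_prod => // g _; last exact: ploc_act.
by rewrite /pcong -rmorphB; apply: inert.
Qed.

Lemma inertial_gtr x : R x -> pcong p (iota (gtr x)) (iota x *+ l).
Proof.
move=> Rx; rewrite /pcong /gtr rmorph_sum /= -sumr_const -sumrB.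
by apply: pnil_sum => // g _; rewrite -rmorphB; apply: inert.
Qed.

(** The residue field is F_p. If p <> l, x is congruent to tr(x) / l, which is rational. If p = l,
    x^p is congruent to the norm of x, hence to some n and to n^p; then (x - n)^p is in the radical,
    and so is x - n. *)
Lemma inertial_residue x : R x -> exists n : nat, pcong p (iota x) n%:R.
Proof.
move=> Rx; have [p_l|p'l] := boolP (p %| l)%N.
  have Dl : l = p by apply/eqP; rewrite eq_sym -dvdn_prime2 ?gf_prime.
  have [n Nn] := ploc_modp p_pr (gnorm_rat x) (ploc_gnorm p_pr Rx).
  exists n; have {}Nn : pcong p (iota (gnorm x)) n%:R by apply: pnil_pdiv.
  apply: (@pnil_root p _ p).
  have xp : pcong p (iota x ^+ p) n%:R.
    by apply: pcong_trans Nn => //; rewrite -{2}Dl; apply/pcong_sym/inertial_gnorm.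
  have nn : pcong p (n%:R ^+ p) n%:R.
    by rewrite -natrX; apply: pcong_eqmod => //; apply: fermat_little.
  have frob : pcong p (iota x ^+ p) ((iota x - n%:R) ^+ p + n%:R ^+ p).
    apply: pnil_pdiv => //.
    have := ploc_frobenius p_pr (plocB p_pr Rx (ploc_nat p_pr n)) (ploc_nat p_pr n).
    by rewrite subrK opprD addrA.
  have {}frob := pcong_trans p_pr (pcong_sym p_pr xp) frob.
  have := pnilN p_pr (pnilD p_pr frob nn); congr pnil; ring.
have Rl : R l%:R^-1 by rewrite fmorphV rmorph_nat; apply: ploc_invn.
have Ql : iota l%:R^-1 \in Crat by rewrite fmorphV rmorph_nat rpredV rpred_nat.
have [n Nn] : exists n : nat, ploc p ((iota (l%:R^-1 * gtr x) - n%:R) / p%:R).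
  apply: ploc_modp => //; first by rewrite rmorphM rpredM ?gtr_rat.
  by apply: ploc_embM => //; apply: ploc_gtr.
exists n; apply: pcong_trans (pnil_pdiv Nn) => //.
have Dx : x = l%:R^-1 * (l%:R * x) by rewrite mulKf ?gcard_neq0.
rewrite [X in iota X]Dx !rmorphM; apply: pcongM => //; try exact: pcong_refl.
  exact: ploc_gtr.
rewrite rmorph_nat mulr_natl; apply: pcong_sym => //; exact: inertial_gtr.
Qed.

(** The radical is the only maximal ideal: the norm of x is congruent to x^l, so it is a unit of Z
    localised at p, and x divides it. *)
Lemma inertial_inv x : R x -> ~ J x -> R x^-1.
Proof.
move=> Rx nJx; have nJN : ~ J (gnorm x).
  move=> JN; apply: nJx; apply: (@pnil_root p _ l).
  by apply: pcong_pnil JN => //; apply/pcong_sym/inertial_gnorm.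
have x0 : x != 0 by apply: contra_notN nJx => /eqP->; rewrite rmorph0; apply: pnil0.
have -> : x^-1 = (gnorm x)^-1 * \prod_(g : G | g != 1%g) act g x.
  rewrite gnormE invfM mulfVK //; apply/prodf_neq0 => g _; by rewrite fmorph_eq0.
apply: ploc_embM.
  by rewrite fmorphV; apply: ploc_rat_unit => //; [apply: gnorm_rat | apply: ploc_gnorm].
by rewrite rmorph_prod; apply: ploc_prod => // g _; apply: ploc_act.
Qed.

(** If p generated the radical, every local r would be n + p r', whence g(r) - r = p (g(r') - r').
    Iterating, g(x) - x would be divisible by all powers of p, so zero, for an x moved by g. *)
Lemma inertial_nonreduced : exists2 x, J x & ~ R (x / p%:R).
Proof.
apply: contrapT => red.
have {}red x : J x -> R (x / p%:R).
  by move=> Jx; apply: contrapT => nRx; apply: red; exists x.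
have [g /gf_faithful[z gz]] := gnontrivial L.
have [m m_gt0 Amz] := Aint_scale (iota z).
pose x := m%:R * z.
have Rx : R x by apply: ploc_Aint => //; rewrite rmorphM rmorph_nat.
have gx : act g x - x != 0.
  rewrite subr_eq0 rmorphM rmorph_nat (inj_eq (mulfI _)) //.
  by rewrite -(fmorph_eq0 iota) rmorph_nat pnatr_eq0 -lt0n.
have xP k : exists2 r, R r & act g x - x = p%:R ^+ k * (act g r - r).
  elim: k => [|k [r Rr ->]]; first by exists x; rewrite ?mul1r.
  have [n rn] := inertial_residue Rr.
  have : R ((r - n%:R) / p%:R) by apply: red; rewrite rmorphB rmorph_nat.
  exists ((r - n%:R) / p%:R) => //.
  rewrite exprSr -mulrA; congr (_ * _); rewrite mulrBr [p%:R * (_ / _)]mulrC divfK //.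
  by rewrite fmorph_div rmorphB !rmorph_nat [p%:R * (_ / _)]mulrC divfK // opprB addrA subrK.
suff : iota (act g x - x) = 0 by move/eqP; rewrite fmorph_eq0 (negPf gx).
apply: (ploc_infinite p_pr) => k; have [r Rr ->] := xP k.
rewrite rmorphM rmorphXn rmorph_nat mulrAC mulfV ?expf_neq0 // mul1r rmorphB.
by apply: plocB => //; apply: ploc_act.
Qed.

(** The partial products u_0, ..., u_l satisfy an integer relation; let j be the first index whose
    coefficient is prime to p. The terms from j on equal u_j times that coefficient plus a radical
    element, a unit, and the earlier terms are divisible by p. So p divides u_j, hence u_l. *)
Lemma pnil_prod_card (y : nat -> L) : (forall i, J (y i)) ->
  R ((\prod_(0 <= i < l) y i) / p%:R).
Proof.
move=> Jy; pose u (j : nat) := \prod_(0 <= i < j) y i.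
have Ru m n : R (\prod_(m <= i < n) y i).
  by rewrite rmorph_prod; apply: ploc_prod => // i _; apply: pnil_emb_ploc.
apply: contrapT => nRl.
have nR j : (j <= l)%N -> ~ R (u j / p%:R).
  move=> le_jl Ruj; apply: nRl; rewrite (big_cat_nat _ le_jl) //= mulrAC.
  by apply: ploc_embM => //; apply: Ru.
have [a [j0 pj0] Da] := int_dependence (fun j : 'I_l.+1 => u j) p_pr.
have [j pj min_j] : exists2 j : 'I_l.+1, ~~ (p%:Z %| a j)%Z &
    forall i : 'I_l.+1, (i < j)%N -> (p%:Z %| a i)%Z.
  case: (@arg_minnP _ j0 (fun j => ~~ (p%:Z %| a j)%Z) (fun j : 'I_l.+1 => j : nat)) => // j pj min_j.
  by exists j => // i lt_ij; apply: contraLR lt_ij => /min_j; rewrite -leqNgt.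
have le_jl : (j <= l)%N by rewrite -ltnS.
pose t := \sum_(i < l.+1 | (j < i)%N) (a i)%:~R * \prod_(j <= k < i) y k.
have Jt : J t.
  rewrite rmorph_sum; apply: pnil_sum => // i lt_ji; apply: pnil_embM.
    by rewrite rmorph_int; apply: ploc_int.
  by rewrite big_ltn // mulrC; apply: pnil_embM.
have ploc_a i : R (a i)%:~R by rewrite rmorph_int; apply: ploc_int.
have nJ : ~ J ((a j)%:~R + t).
  move=> Jat; have : J ((a j)%:~R + t - t) by rewrite rmorphB; apply: pnilB.
  by rewrite addrK rmorph_int => /(pnil_int p_pr); rewrite (negPf pj).
have Rat : R ((a j)%:~R + t).
  by rewrite rmorphD; apply: plocD => //; apply: pnil_emb_ploc.
apply: (nR j le_jl).
have -> : u j / p%:R = ((a j)%:~R + t)^-1 * (u j * ((a j)%:~R + t) / p%:R).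
  have nz : (a j)%:~R + t != 0.
    by apply: contra_notN nJ => /eqP->; rewrite rmorph0; apply: pnil0.
  by field; rewrite pL_neq0 nz.
apply: ploc_embM; first exact: inertial_inv.
have -> : u j * ((a j)%:~R + t) = - \sum_(i < l.+1 | (i < j)%N) (a i)%:~R * u i.
  apply/eqP; rewrite -addr_eq0 addrC; apply/eqP; rewrite -[RHS]Da.
  rewrite [RHS](bigID (fun i : 'I_l.+1 => (i < j)%N)) /=; congr (_ + _).
  rewrite [RHS](bigD1 j) ?ltnn //= mulrDr [u j * _]mulrC; congr (_ + _).
  rewrite /t mulr_sumr; apply: eq_big => [i|i lt_ji].
    by rewrite -leqNgt -val_eqE /= ltn_neqAle eq_sym andbC.
  by rewrite mulrCA /u -big_cat_nat // ltnW.
rewrite mulNr rmorphN; apply: plocN => //; rewrite mulr_suml rmorph_sum.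
apply: ploc_sum => // i /min_j/dvdzP[c ->].
have -> : (c * p%:Z)%:~R * u i / p%:R = c%:~R * u i.
  by rewrite rmorphM /= mulrAC mulfK.
by apply: ploc_embM; [rewrite rmorph_int; apply: ploc_int | apply: Ru].
Qed.

End Inertial.

(** * Existence of a uniformizer, and total ramification *)

Section Uniformizer.
Variable L : galois_field.
Local Notation G := (gf_group L).
Local Notation act := (@gf_act L).
Local Notation iota := (@gf_emb L).
Local Notation l := #|G|.
Variable p : nat.
Hypotheses (p_pr : prime p) (inert : inertial L p).
Local Notation R x := (ploc p (iota x)).
Local Notation J x := (pnil p (iota x)).

Let pL_neq0 : (p%:R : L) != 0.
Proof. by rewrite -(fmorph_eq0 iota) rmorph_nat pnatr_eq0 -lt0n prime_gt0. Qed.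

Definition punit (x : L) := [/\ x != 0, R x & R x^-1].

Lemma punit1 : punit 1.
Proof. by split; rewrite ?invr1 ?oner_neq0 // rmorph1; apply: ploc1. Qed.

Lemma punitM x y : punit x -> punit y -> punit (x * y).
Proof.
move=> [x0 Rx RVx] [y0 Ry RVy]; split; first by rewrite mulf_neq0.
  exact: ploc_embM.
by rewrite invfM; apply: ploc_embM.
Qed.

Lemma punitV x : punit x -> punit x^-1.
Proof. by move=> [x0 Rx RVx]; split; rewrite ?invrK ?invr_eq0. Qed.

Lemma punitX x k : punit x -> punit (x ^+ k).
Proof.
by move=> Ux; elim: k => [|k IHk]; [apply: punit1 | rewrite exprS; apply: punitM].
Qed.

Lemma punit_npnil x : punit x -> ~ J x.
Proof.
move=> [x0 Rx RVx] Jx; apply: (@not_pnil1 p p_pr).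
by rewrite -(rmorph1 iota) -(mulVf x0); apply: pnil_embM.
Qed.

Lemma npnil_punit x : R x -> ~ J x -> punit x.
Proof.
move=> Rx nJx; split=> //; last exact: inertial_inv.
by apply: contra_notN nJx => /eqP->; rewrite rmorph0; apply: pnil0.
Qed.

(** A non-integral element of the inverse of the radical: a product of k radical elements divided by
    p, where k is such that some product of length k is not divisible by p but all those of length k
    + 1 are. [inertial_nonreduced] and [pnil_prod_card] ensure that such a k exists. *)
Lemma inertial_codifferent : exists2 w, ~ R w & forall x, J x -> R (w * x).
Proof.
pose P k := exists2 y : nat -> L, (forall i, J (y i)) & ~ R ((\prod_(0 <= i < k) y i) / p%:R).
have [k Pk nPk] : exists2 k, P k & ~ P k.+1.
  apply: contrapT => noP; have PS k : P k -> P k.+1.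
    by move=> Pk; apply: contrapT => nPk; apply: noP; exists k.
  have P1 k : P k.+1.
    elim: k => [|k IHk]; last exact: PS.
    have [x Jx nRx] := inertial_nonreduced p_pr inert.
    by exists (fun=> x); rewrite ?big_nat1.
  have [y Jy] := P1 l.-1; rewrite prednK; first by case; apply: pnil_prod_card.
  exact: ltnW (gcard_gt1 L).
have [y Jy nRy] := Pk; exists ((\prod_(0 <= i < k) y i) / p%:R) => // x Jx.
apply: contrapT => nR; apply: nPk; exists (fun i => if (i < k)%N then y i else x).
  by move=> i; case: ifP.
rewrite big_nat_recr //= ltnn; under eq_big_nat => i /andP[_ ->] do [].
by rewrite mulrAC.
Qed.

(** All conjugates of w are almost integral, so the coefficients of its characteristic polynomial
    are rational and almost integral, hence local. *)
Lemma ploc_complete w : (forall m, R (p%:R * w ^+ m)) -> R w.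
Proof.
move=> wP; have w_almost : palmost p (iota w).
  by exists 1%N => m; have := wP m; rewrite rmorphM rmorphXn rmorph_nat.
have act_almost g : palmost p (iota (act g w)).
  have [nu <-] := gf_extend g; case: w_almost => c wc; exists c => m.
  by have := ploc_aut nu (wc m); rewrite rmorphM !rmorphXn rmorph_nat.
pose C z := palmost p (iota z).
have Rcoef i : R (gchar w)`_i.
  have [lt_il|] := ltnP i l; last first.
    rewrite leq_eqVlt => /predU1P[<-|gt_il].
      have /monicP := gchar_monic w; rewrite lead_coefE size_gchar /= => ->.
      by rewrite rmorph1; apply: ploc1.
    by rewrite nth_default ?size_gchar // rmorph0; apply: ploc0.
  apply: palmost_rat => //; first exact: gchar_rat.
  rewrite gchar_seq; apply: (@coef_prod_XsubC_ideal _ C C) => //.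
  - by rewrite /C rmorph1; apply/palmost_ploc/ploc1.
  - by rewrite /C rmorph0; apply/palmost_ploc/ploc0.
  - by move=> x y; rewrite /C rmorphB; apply: palmostB.
  - by move=> x y; rewrite /C rmorphM; apply: palmostM.
  - by move=> _ /imageP[g _ ->]; apply: act_almost.
  - by rewrite size_image cardE -cardT.
apply: (@ploc_monic_root p p_pr (map_poly iota (gchar w))).
- by rewrite map_monic gchar_monic.
- by rewrite fmorph_root gchar_root.
- by move=> i; rewrite coef_map; split; [apply: gchar_rat | apply: Rcoef].
Qed.

(** The classical argument for discrete valuation rings. If w mapped the radical into itself, all p
    w^m would be local and w would be integral. So w x is a unit for some radical x, and 1 / w is a
    generator. *)
Lemma inertial_generator :
  exists pi, [/\ pi != 0, J pi & forall x, J x -> R (x / pi)].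
Proof.
have [w nRw wP] := inertial_codifferent.
have w0 : w != 0 by apply: contra_notN nRw => /eqP->; rewrite rmorph0; apply: ploc0.
have [x Jx nJwx] : exists2 x, J x & ~ J (w * x).
  apply: contrapT => noJ; apply: nRw; apply: ploc_complete => m.
  apply: pnil_emb_ploc => //; elim: m => [|m IHm].
    by rewrite mulr1 rmorph_nat; apply: pnil_pdiv; rewrite divff ?pnatr_eq0 -?lt0n ?prime_gt0 //; apply: ploc1.
  rewrite exprS mulrCA; apply: contrapT => nJ; apply: noJ.
  by exists (p%:R * w ^+ m).
exists w^-1; split; first by rewrite invr_eq0.
  have -> : w^-1 = (w * x)^-1 * x.
    have x0 : x != 0.
      by apply: contra_notN nJwx => /eqP->; rewrite mulr0 rmorph0; apply: pnil0.
    by rewrite invfM mulrVK ?unitfE.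
  by apply: pnil_embM => //; apply: inertial_inv => //; apply: wP.
by move=> y Jy; rewrite invrK mulrC; apply: wP.
Qed.

Lemma ploc_rat_valuation z : z \in Crat -> z != 0 -> ploc p z ->
  exists a, [/\ ploc p (z / p%:R ^+ a), ploc p (z^-1 * p%:R ^+ a) & (pnil p z -> (0 < a)%N)].
Proof.
move=> Qz z0 z_loc.
have [a za nza] : exists2 a, ploc p (z / p%:R ^+ a) & ~ ploc p (z / p%:R ^+ a.+1).
  apply: contrapT => noa; case/eqP: z0; apply: (ploc_infinite p_pr).
  elim=> [|k IHk]; first by rewrite divr1.
  by apply: contrapT => nzk; apply: noa; exists k.
have nJ : ~ pnil p (z / p%:R ^+ a).
  move=> /(pnil_rat p_pr) zp; apply: nza; rewrite exprSr invfM mulrA.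
  by apply: zp; rewrite rpred_div ?rpredX ?rpred_nat.
exists a; split=> //; last by case: a nJ {za nza}; rewrite ?divr1.
rewrite mulrC -invf_div; apply: ploc_rat_unit => //.
by rewrite rpred_div ?rpredX ?rpred_nat.
Qed.

Section WithGenerator.
Variable pi : L.
Hypotheses (pi0 : pi != 0) (Jpi : J pi) (piP : forall x, J x -> R (x / pi)).

Lemma punit_act_div g : punit (act g pi / pi).
Proof.
have RV h : R (act h pi / pi) by apply: piP; apply: pnil_act.
split=> //; first by rewrite mulf_neq0 ?invr_eq0 ?fmorph_eq0.
have -> : (act g pi / pi)^-1 = act g (act g^-1%g pi / pi).
  by rewrite invf_div fmorph_div -gf_actM mulgV act1.
exact: ploc_act.
Qed.

(** Some power of pi is divisible by p, so a nonzero x is divisible by only finitely many powers of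
    pi; the last quotient is a unit. *)
Lemma generator_valuation x : x != 0 -> R x -> exists k : nat, punit (x / pi ^+ k).
Proof.
move=> x0 Rx.
have [k xk nxk] : exists2 k, R (x / pi ^+ k) & ~ R (x / pi ^+ k.+1).
  apply: contrapT => nok.
  have xP k : R (x / pi ^+ k).
    elim: k => [|k IHk]; first by rewrite divr1.
    by apply: contrapT => nRk; apply: nok; exists k.
  have [j pij] := Jpi.
  have : iota x = 0.
    apply: (ploc_infinite p_pr) => k.
    have -> : iota x / p%:R ^+ k = iota (x / pi ^+ (j * k)) * (iota pi ^+ j / p%:R) ^+ k.
      rewrite fmorph_div rmorphXn expr_div_n -exprM mulrA divfK //.
      by rewrite expf_neq0 // fmorph_eq0.
    by apply: plocM => //; apply: plocX.
  by move/eqP; rewrite fmorph_eq0 (negPf x0).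
exists k; apply: npnil_punit => // /piP; rewrite -mulrA -invfM -exprSr.
exact: nxk.
Qed.

Lemma generator_expz_ploc k : R (pi ^ k) -> (0 <= k)%R.
Proof.
case: k => // k; rewrite NegzE; set z := pi ^ _ => Rz.
case: (@not_pnil1 p p_pr); rewrite -(rmorph1 iota).
have -> : 1 = (z * pi ^+ k) * pi :> L.
  by rewrite /z -mulrA -exprSr -exprnN mulVf // expf_neq0.
apply: pnil_embM => //; apply: ploc_embM => //.
by rewrite rmorphXn; apply: plocX => //; apply: pnil_emb_ploc.
Qed.

Lemma punit_expz k : punit (pi ^ k) -> k = 0.
Proof.
move=> [_ /generator_expz_ploc k_ge0]; rewrite invr_expz => /generator_expz_ploc.
by rewrite oppr_ge0 => k_le0; apply/eqP; rewrite eq_le k_le0.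
Qed.

Lemma generator_gnorm : punit (gnorm pi / pi ^+ l).
Proof.
have -> : gnorm pi / pi ^+ l = \prod_(g : G) (act g pi / pi).
  by rewrite prodf_div prodr_const.
by apply: big_ind => //; [apply: punit1 | apply: punitM | move=> g _; apply: punit_act_div].
Qed.

(** Up to units p is pi^e, the norm of pi is p^a, and this norm is also pi^l; so l = e a. As e = 1
    would make p generate the radical, primality gives e = l. *)
Lemma generator_card : punit (pi ^+ l / p%:R).
Proof.
have [e Ue] : exists e : nat, punit (p%:R / pi ^+ e).
  by apply: generator_valuation => //; rewrite rmorph_nat; apply: ploc_nat.
have N0 : gnorm pi != 0 by rewrite gnorm_eq0.
have RN : R (gnorm pi) by apply: ploc_gnorm => //; apply: pnil_emb_ploc.
have [|a [Ra RVa a_gt0]] := ploc_rat_valuation (gnorm_rat pi) _ RN.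
  by rewrite fmorph_eq0.
have {}a_gt0 : (0 < a)%N.
  apply: a_gt0; rewrite gnormE mulrC; apply: pnil_embM => //.
  by rewrite rmorph_prod; apply: ploc_prod => // g _; apply/ploc_act/pnil_emb_ploc.
have Ua : punit (gnorm pi / p%:R ^+ a).
  split; first by rewrite mulf_neq0 ?invr_eq0 ?expf_neq0.
    by rewrite fmorph_div rmorphXn rmorph_nat.
  by rewrite invf_div mulrC rmorphM fmorphV rmorphXn rmorph_nat.
have UN := generator_gnorm.
have Dl : l = (e * a)%N.
  have : punit (pi ^ (l%:Z - (e * a)%:Z)).
    have -> : pi ^ (l%:Z - (e * a)%:Z) =
        (gnorm pi / pi ^+ l)^-1 * (gnorm pi / p%:R ^+ a) * (p%:R / pi ^+ e) ^+ a.
      rewrite expfzDr // -exprnN -!exprnP expr_div_n -exprM invf_div.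
      by field; rewrite ?N0 ?pi0 ?expf_neq0.
    by apply: punitM; [apply: punitM => //; apply: punitV | apply: punitX].
  by move/punit_expz/eqP; rewrite subr_eq0 eqz_nat => /eqP.
have e_neq1 : e != 1%N.
  apply/eqP => e1; have [x Jx nRx] := inertial_nonreduced p_pr inert; apply: nRx.
  have -> : x / p%:R = (x / pi) * (p%:R / pi ^+ e)^-1 by rewrite e1 invf_div mulrA divfK.
  by apply: (ploc_embM p_pr); [apply: piP | case: Ue].
have De : e = l.
  have /primeP[_ /(_ e)] := gf_prime L; rewrite {1}Dl dvdn_mulr // (negPf e_neq1).
  by move/(_ isT)/eqP.
by rewrite -De -invf_div; apply: punitV.
Qed.

Lemma generator_gnorm_scaled m : ~~ (p %| m)%N -> punit (gnorm (m%:R * pi) / p%:R).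
Proof.
move=> pm; have -> : gnorm (m%:R * pi) / p%:R = m%:R ^+ l * (gnorm pi / pi ^+ l) * (pi ^+ l / p%:R).
  rewrite gnormM gnorm_id ?rmorph_nat ?rpred_nat //.
  by field; rewrite ?pL_neq0 ?expf_neq0.
apply: punitM; last exact: generator_card.
apply: punitM; last exact: generator_gnorm.
apply: punitX; have m0 : m != 0%N by apply: contraNneq pm => ->; rewrite dvdn0.
split; first by rewrite -(fmorph_eq0 iota) rmorph_nat pnatr_eq0.
  by rewrite rmorph_nat; apply: ploc_nat.
by rewrite fmorphV rmorph_nat; apply: ploc_invn.
Qed.

Lemma generator_valuation_int x : x != 0 -> exists k : int, punit (x / pi ^ k).
Proof.
move=> x0; have [m px] := ploc_scale p_pr (iota x).
have y0 : p%:R ^+ m * x != 0 by rewrite mulf_neq0 ?expf_neq0.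
have [|k Uk] := generator_valuation y0; first by rewrite rmorphM rmorphXn rmorph_nat.
exists (k%:Z - (l * m)%:Z).
have -> : x / pi ^ (k%:Z - (l * m)%:Z) = (p%:R ^+ m * x / pi ^+ k) * (pi ^+ l / p%:R) ^+ m.
  rewrite expfzDr // -exprnN -!exprnP expr_div_n -exprM.
  by field; rewrite ?pi0 ?pL_neq0 ?expf_neq0.
by apply: punitM => //; apply/punitX/generator_card.
Qed.

End WithGenerator.
End Uniformizer.

(** * From Galois number fields to the abstract setting *)

(** The generator is sent to a root z of its minimal polynomial. The polynomial expression chosen
    for an element does not matter, since two choices differ by a multiple of the minimal
    polynomial. *)
Lemma num_field_embedding (L : fieldExtType rat) (theta : L) :
  (<<1; theta>>%VS = {:L})%VS -> {rmorphism L -> algC}.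
Proof.
move=> genL.
have /sig_eqW[m Dm] : exists m, minPoly 1 theta = map_poly (in_alg L) m.
  exact/polyOver1P/minPolyOver.
have m_dvd q : (map_poly (in_alg L) q).[theta] = 0 -> m %| q.
  move=> q0; rewrite -(dvdp_map (in_alg L)) -Dm minPoly_dvdp //; last exact/rootP.
  by apply/polyOver1P; exists q.
have [z z0] : {z : algC | root (map_poly ratr m) z}.
  apply/sig_eqW/closed_rootP; rewrite size_map_poly -(size_map_poly (in_alg L)) -Dm.
  by rewrite size_minPoly.
have z_poly q : (map_poly (in_alg L) q).[theta] = 0 -> (map_poly ratr q).[z] = 0 :> algC.
  by move/m_dvd/dvdpP=> [r ->]; rewrite rmorphM hornerM (rootP z0) mulr0.
have polyP x : {q | x = (map_poly (in_alg L) q).[theta]}.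
  apply/sig_eqW; have : x \in <<1; theta>>%VS by rewrite genL memvf.
  by case/Fadjoin_polyP=> q /polyOver1P[r ->] ->; exists r.
pose f x : algC := (map_poly ratr (sval (polyP x))).[z].
have fE q : f (map_poly (in_alg L) q).[theta] = (map_poly ratr q).[z].
  rewrite /f; case: (polyP _) => r /= Dr; apply/eqP; rewrite -subr_eq0 -hornerN -hornerD -rmorphB.
  by apply/eqP/z_poly; rewrite rmorphB hornerD hornerN -Dr subrr.
have fB : zmod_morphism f.
  move=> x y; have [[q ->] [r ->]] := (polyP x, polyP y).
  by rewrite -hornerN -hornerD -rmorphB !fE rmorphB hornerD hornerN.
have fM : monoid_morphism f.
  split=> [|x y]; first by have := fE 1; rewrite !rmorph1 !hornerE.
  have [[q ->] [r ->]] := (polyP x, polyP y).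
  by rewrite -hornerM -rmorphM !fE rmorphM hornerM.
pose fA := GRing.isZmodMorphism.Build L algC f fB.
pose fR := GRing.isMonoidMorphism.Build L algC f fM.
exact: (HB.pack f fA fR : {rmorphism L -> algC}).
Qed.

Section GaloisNumberField.
Variable L : splittingFieldType rat.
Hypothesis galois_L : galois 1%VS {:L}.
Local Notation G := (gal_of {:L}).

Lemma galT : 'Gal({:L} / 1%VS)%g = [set: G]%SET.
Proof. by apply/setP=> g; rewrite inE gal_kHom ?sub1v // k1AHom. Qed.

Lemma gal_actM (g h : G) x : (g * h)%g x = h (g x).
Proof. by rewrite galM ?memvf. Qed.

Lemma gal_fixed_rat x : (forall g : G, g x = x) -> exists q : rat, x = ratr q.
Proof.
move=> gx; have : x \in fixedField ('Gal({:L} / 1%VS)%g).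
  by apply/fixedFieldP => [|g _]; rewrite ?memvf.
have -> : fixedField ('Gal({:L} / 1%VS)%g) = 1%VS by apply/galois_fixedField.
by case/vlineP => q ->; exists q; rewrite alg_num_field.
Qed.

Lemma exists_embedding : exists f : {rmorphism L -> algC}, True.
Proof.
have /and3P[sep1 sepL _] := galois_L.
by have f := num_field_embedding (esym (eq_adjoin_separable_generator sepL (sub1v _))); exists f.
Qed.

Lemma dim_gal : \dim {:L} = #|{: G}|.
Proof.
have := galois_dim galois_L; rewrite dimv1 divn1 => ->.
by rewrite galT cardsT.
Qed.

Lemma gal_lin_dep (c : G -> L) : (forall i : 'I_(\dim {:L}), \sum_(g : G) c g * g (vbasis {:L})`_i = 0) ->
  forall g, c g = 0.
Proof.
move=> c0 g; apply: (@gal_independent rat L {:L}%AS xpredT) => // a _.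
rewrite (coord_vbasis (memvf a)).
transitivity (\sum_(i < \dim {:L}) coord (vbasis {:L}) i a *: \sum_(h : G) c h * h (vbasis {:L})`_i).
  under [RHS]eq_bigr => i _ do rewrite scaler_sumr.
  rewrite [RHS]exchange_big; apply: eq_bigr => h _ /=.
  rewrite linear_sum mulr_sumr; apply: eq_bigr => i _.
  by rewrite linearZ scalerAr.
by rewrite big1 // => i _; rewrite c0 scaler0.
Qed.

Lemma gal_basis : exists b : 'I_#|{: G}| -> L,
  \det (\matrix_(i, j) (enum_val i : G) (b j)) != 0.
Proof.
exists (fun j => (vbasis {:L})`_j).
rewrite -unitfE -unitmxE -row_free_unit -kermx_eq0; apply/rowV0P => v /sub_kermxP vW.
apply/rowP => i; rewrite mxE -(enum_valK i).
apply: (@gal_lin_dep (fun g => v 0 (enum_rank g))) => j.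
have /rowP/(_ (cast_ord dim_gal j)) := vW; rewrite !mxE => vWj; rewrite -[RHS]vWj.
rewrite (reindex (enum_val : 'I_#|{: G}| -> G)) /=; last first.
  by exists enum_rank => g _; rewrite ?enum_valK ?enum_rankK.
by apply: eq_bigr => g _; rewrite !mxE enum_valK.
Qed.

Hypothesis G_prime : prime #|{: G}|.

Lemma gal_comm (g h : G) : (g * h)%g = (h * g)%g.
Proof.
have [->|/(prime_group_cycle h G_prime)[k ->]] := eqVneq g 1%g.
  by rewrite mul1g mulg1.
by rewrite -expgS -expgSr.
Qed.

Variable emb : {rmorphism L -> algC}.

Definition gal_act (g : G) : {rmorphism L -> L} := (g : 'AEnd(L)).

(** Products in [gal_of] compose in the opposite order; commutativity of a group of prime order
    makes this a left action. *)
Lemma gal_act_mul g h x : gal_act (g * h)%g x = gal_act g (gal_act h x).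
Proof. by rewrite gal_comm /= gal_actM. Qed.

Lemma gal_act_fixed x : (forall g, gal_act g x = x) -> emb x \in Crat.
Proof.
by move=> /gal_fixed_rat[q ->]; apply/CratP; exists q; rewrite fmorph_rat.
Qed.

Lemma gal_act_faithful g : g != 1%g -> exists x, gal_act g x != x.
Proof.
move=> g1; apply: contrapT => no_x; case/eqP: g1; apply/eqP/gal_eqP => x _.
rewrite gal_id; apply: contrapT => /eqP gx; apply: no_x; by exists x.
Qed.

Lemma gal_act_extend g : exists nu : {rmorphism algC -> algC},
  forall x, nu (emb x) = emb (gal_act g x).
Proof.
have [nu nuP] := extend_algC_subfield_aut emb (gal_act g).
by exists nu => x; rewrite -nuP.
Qed.

Lemma gal_act_restrict (nu : {rmorphism algC -> algC}) : exists g,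
  forall x, nu (emb x) = emb (gal_act g x).
Proof.
have [nu0 nu0P] := restrict_aut_to_normal_num_field emb nu.
have nu0_hom : kHom 1 {:L} (linfun nu0).
  apply/kHom_lrmorphism; split=> [x y|]; first by rewrite !lfunE rmorphM.
  by rewrite lfunE rmorph1.
have /andP[nu0_ahom _] := nu0_hom.
exists (gal {:L} (AHom nu0_ahom)) => x.
rewrite /= galK ?memvf ?subvf //= lfunE; exact/esym/nu0P.
Qed.

Definition galois_field_of : galois_field :=
  GaloisField gal_act_mul gal_act_fixed gal_act_faithful gal_act_extend
    gal_act_restrict G_prime gal_basis.

End GaloisNumberField.

(** The conjugates of z generate a Galois number field whose automorphisms extend to [algC], so its
    Galois group fixes z. *)
Lemma aut_fixed_rat (z : algC) : (forall nu : {rmorphism algC -> algC}, nu z = z) -> z \in Crat.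
Proof.
move=> nuz; have [rs Drs] := closed_field_poly_normal (minCpoly z).
rewrite (monicP (minCpoly_monic z)) scale1r in Drs.
have [Q [QC [s sC genQ]]] := num_field_exists rs.
have [q [Dq _] _] := minCpolyP z.
pose p := \prod_(y <- s) ('X - y%:P).
have Dp : p = map_poly (in_alg Q) q.
  apply: (map_poly_inj QC); rewrite -map_poly_comp /=.
  transitivity (minCpoly z).
    rewrite Drs -sC big_map rmorph_prod; apply: eq_bigr => y _.
    by rewrite /= map_polyXsubC.
  rewrite Dq; apply: eq_map_poly => a /=; by rewrite alg_num_field fmorph_rat.
have axQ : SplittingField.axiom Q.
  exists p; first by apply/polyOver1P; exists q.
  by exists s; rewrite ?eqpxx.
pose Qm := FieldExt_isSplittingField.Build rat Q axQ.
pose QS : splittingFieldType rat := HB.pack Q Qm.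
have galQ : galois 1%VS {:QS}.
  apply/and3P; split; [exact: sub1v | | exact: normalFieldf].
  apply/separableP => y _; apply: pcharf0_separable.
  by move=> n; rewrite pchar_lalg pchar_num.
have [z1 Dz] : exists z1 : QS, QC z1 = z.
  have : z \in rs by rewrite -root_prod_XsubC -Drs root_minCpoly.
  by rewrite -sC => /mapP[z1 _ ->]; exists z1.
have [a Da] : exists a : rat, z1 = ratr a.
  apply: (gal_fixed_rat galQ) => g; apply: (fmorph_inj QC).
  have [nu nuP] := extend_algC_subfield_aut QC (gal_act g : {rmorphism Q -> Q}).
  by rewrite [LHS]nuP Dz nuz.
by rewrite -Dz Da fmorph_rat; apply/CratP; exists a.
Qed.

(** * Cyclotomic integers and falling factorials *)

Lemma prod_1_sub_prim (k : nat) (z : algC) : k.-primitive_root z ->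
  \prod_(1 <= i < k) (1 - z ^+ i) = k%:R.
Proof.
move=> prim_z; have k_gt0 := prim_order_gt0 prim_z.
have := factor_Xn_sub_1 prim_z; rewrite big_ltn // expr0 polyC1 subrX1.
have X1 : 'X - 1 != 0 :> {poly algC} by rewrite -polyC1 polyXsubC_eq0.
move=> /(mulfI X1)/(congr1 (fun q => q.[1])); rewrite horner_prod horner_sum.
under eq_bigr => i _ do rewrite !hornerE.
under [X in _ = X]eq_bigr => i _ do rewrite hornerXn expr1n.
by rewrite sumr_const card_ord.
Qed.

(** z is itself a power of z^i, so the quotient is a geometric sum. *)
Lemma Aint_cyclotomic_unit (k i : nat) (z : algC) : k.-primitive_root z -> coprime i k ->
  (1 - z) / (1 - z ^+ i) \in Aint.
Proof.
move=> prim_z ik; have prim_zi : k.-primitive_root (z ^+ i) by rewrite prim_root_exp_coprime.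
have [j Dz] := prim_rootP prim_zi (prim_expr_order prim_z).
have [->|zi1] := eqVneq (z ^+ i) 1; first by rewrite subrr invr0 mulr0.
rewrite [X in 1 - X]Dz -opprB subrX1 -[1 - _]opprB invrN mulrN mulNr opprK mulrC mulKf ?subr_eq0 //.
by rewrite rpred_sum // => m _; rewrite rpredX // (Aint_prim_root prim_zi).
Qed.

(** p is the product of the p - 1 numbers 1 - z^i, and each of them divides 1 - z. *)
Lemma Aint_1_sub_prim (p : nat) (z : algC) : prime p -> p.-primitive_root z ->
  (1 - z) ^+ p.-1 / p%:R \in Aint.
Proof.
move=> p_pr prim_z; rewrite -(prod_1_sub_prim prim_z) -subn1 -prodr_const_nat -prodf_div.
rewrite big_seq rpred_prod // => i; rewrite mem_index_iota => /andP[i_gt0 lt_ip].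
by apply: Aint_cyclotomic_unit prim_z _; rewrite coprime_sym prime_coprime // gtnNdvd.
Qed.

(** With integer coefficients, k! times a binomial coefficient C(s, k) becomes an integer
    combination of the s^d with d <= k; this turns binomial sums over F_p into values of
    [twisted_sum]. *)
Lemma ffact_poly k : exists2 q : {poly int}, (size q <= k.+1)%N &
  forall s : nat, (s ^_ k)%:Z = q.[s%:Z].
Proof.
exists (\prod_(i < k) ('X - (i : nat)%:Z%:P)) => [|s].
  by rewrite size_prod_XsubC /index_enum -enumT size_enum_ord.
elim: k => [|k IHk]; first by rewrite big_ord0 hornerC.
rewrite big_ord_recr /= hornerM -IHk ffactnSr PoszM hornerXsubC.
have [le_ks|lt_sk] := leqP k s; first by rewrite subzn.
by rewrite ffact_small ?mul0r.
Qed.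

(** * The tame character and the integrality of Gauss sums *)

Section TameCharacter.
Variable L : galois_field.
Local Notation G := (gf_group L).
Local Notation act := (@gf_act L).
Local Notation iota := (@gf_emb L).
Local Notation l := #|G|.
Variable p : nat.
Hypotheses (p_pr : prime p) (inert : inertial L p) (tame : ~~ (p %| l)%N).
Local Notation R x := (ploc p (iota x)).
Local Notation J x := (pnil p (iota x)).

Let pL_neq0 : (p%:R : L) != 0.
Proof. by rewrite -(fmorph_eq0 iota) rmorph_nat pnatr_eq0 -lt0n prime_gt0. Qed.

Lemma pcong_Fp (a b : nat) : pcong p a%:R b%:R <-> a%:R = b%:R :> 'F_p.
Proof.
split=> [/(pcong_nat p_pr) ab | /(congr1 val)].
  by rewrite -(Fp_nat_mod p_pr) ab Fp_nat_mod.
by rewrite /= !val_Fp_nat //; apply: pcong_eqmod.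
Qed.

Variable pi : L.
Hypotheses (pi0 : pi != 0) (Jpi : J pi) (piP : forall x, J x -> R (x / pi)).

(** The tame character: g |-> g(pi) / pi in the residue field, which is F_p. *)
Lemma tame_residue : exists chi : G -> 'F_p,
  forall g, pcong p (iota (act g pi / pi)) (nat_of_ord (chi g))%:R.
Proof.
suff /choice[chi chiP] : forall g, exists c : 'F_p, pcong p (iota (act g pi / pi)) (nat_of_ord c)%:R.
  by exists chi.
move=> g; have [n nP] : exists n : nat, pcong p (iota (act g pi / pi)) n%:R.
  by apply: inertial_residue => //; apply/piP/pnil_act.
exists n%:R; apply: pcong_trans nP _ => //.
by apply/pcong_Fp; rewrite natr_Zp.
Qed.

Variable chi : G -> 'F_p.
Hypothesis chiP : forall g, pcong p (iota (act g pi / pi)) (nat_of_ord (chi g))%:R.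

Lemma chi_unique g (c : 'F_p) : pcong p (iota (act g pi / pi)) (nat_of_ord c)%:R -> chi g = c.
Proof.
move=> cP; rewrite -[chi g]natr_Zp -[c]natr_Zp; apply/pcong_Fp.
exact: pcong_trans (pcong_sym p_pr (chiP g)) cP.
Qed.

Lemma ploc_act_div g : R (act g pi / pi).
Proof. by apply/piP/pnil_act. Qed.

Lemma chiM g h : chi (g * h)%g = chi g * chi h.
Proof.
apply: chi_unique.
have -> : act (g * h)%g pi / pi = act g (act h pi / pi) * (act g pi / pi).
  by rewrite gf_actM fmorph_div mulrA divfK // fmorph_eq0.
rewrite rmorphM mulrC.
apply: (@pcong_trans p p_pr _ ((nat_of_ord (chi g))%:R * (nat_of_ord (chi h))%:R)).
  apply: pcongM => //; [exact: ploc_act_div | exact: ploc_nat |].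
  apply: pcong_trans (chiP h) => //; rewrite /pcong -rmorphB; apply: inert.
  exact: ploc_act_div.
by rewrite -natrM; apply/pcong_Fp; rewrite natrM !natr_Zp.
Qed.

Lemma chi1 : chi 1%g = 1.
Proof.
apply: chi_unique; rewrite act1 mulfV // rmorph1.
by apply: (pcong_Fp 1 _).2; rewrite natr_Zp.
Qed.

(** If chi(g) = 1 then chi is trivial, as g generates G. Let d be a nonzero local multiple of some
    g(x) - x; it has trace 0 and is a unit times a power of pi, so every h(d) / d is congruent to 1.
    Summing over h gives 0 = l modulo p, against tameness. *)
Lemma chi_neq1 g : g != 1%g -> chi g != 1.
Proof.
move=> g1; apply/eqP => chig.
have chiX k : chi (g ^+ k)%g = 1.
  by elim: k => [|k IHk]; rewrite ?expg0 ?chi1 // expgS chiM chig IHk mulr1.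
have {chiX chig} chi_triv h : chi h = 1.
  by have [k ->] := prime_group_cycle h (gf_prime L) g1; apply: chiX.
have [x gx] := gf_faithful g1.
have [m dm] := ploc_scale p_pr (iota (act g x - x)).
pose d := p%:R ^+ m * (act g x - x).
have d0 : d != 0 by rewrite mulf_neq0 ?expf_neq0 // subr_eq0.
have Trd : gtr d = 0.
  rewrite /d gtrZ ?rmorphXn ?rmorph_nat ?rpredX ?rpred_nat //.
  by rewrite gtrD -[- x]mulN1r gtrZ ?rmorphN1 ?rpredN ?rpred1 // mulN1r gtr_actl subrr mulr0.
have [|k [du0 Rdu RVdu]] := generator_valuation p_pr inert pi0 Jpi piP d0.
  by rewrite rmorphM rmorphXn rmorph_nat.
have J1 h : pcong p (iota (act h d / d)) 1.
  have -> : act h d / d = (act h pi / pi) ^+ k * (act h (d / pi ^+ k) / (d / pi ^+ k)).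
    by rewrite !fmorph_div rmorphXn /= expr_div_n; field; rewrite ?d0 ?expf_neq0 ?fmorph_eq0.
  rewrite rmorphM -[X in pcong p _ X]mulr1; apply: pcongM => //.
  - by rewrite rmorphXn; apply/plocX/ploc_act_div.
  - exact: ploc1.
  - rewrite rmorphXn -(expr1n _ k); apply: pcongX => //; first exact: ploc_act_div.
    by have := chiP h; rewrite chi_triv.
  - rewrite /pcong -(rmorph1 iota) -(mulfV du0) -rmorphB -mulrBl mulrC.
    by apply: pnil_embM => //; apply: inert.
have : pcong p (iota (\sum_h act h d / d)) l%:R.
  by rewrite /pcong rmorph_sum -sumr_const -sumrB; apply: pnil_sum => // h _; apply: J1.
rewrite -mulr_suml -/(gtr d) Trd mul0r rmorph0 => /(pcong_nat p_pr (a := 0)).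
by rewrite mod0n => /esym/eqP; apply/negP.
Qed.

Lemma chi_inj : injective chi.
Proof.
move=> g h gh; apply/eqP; rewrite eq_mulgV1; apply/negPn/negP => /chi_neq1/eqP[].
have : chi (h * h^-1)%g = chi (g * h^-1)%g by rewrite !chiM gh.
by rewrite mulgV chi1 => <-.
Qed.

Lemma chiX g k : chi (g ^+ k)%g = chi g ^+ k.
Proof. by elim: k => [|k IHk]; rewrite ?expg0 ?chi1 // expgS chiM IHk exprS. Qed.

Lemma chi_card g : chi g ^+ l = 1.
Proof. by rewrite -chiX -cardsT expg_cardG ?inE ?chi1. Qed.

Lemma chi_primitive g : g != 1%g -> l.-primitive_root (chi g).
Proof.
move=> g1; have l_gt0 : (0 < l)%N := ltnW (gcard_gt1 L).
have [k prim_k dvd_k] := prim_order_exists l_gt0 (chi_card g).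
have /primeP[_ /(_ k dvd_k)/orP[/eqP k1|/eqP <- //]] := gf_prime L.
by have := prim_expr_order prim_k; rewrite k1 expr1 => /eqP; rewrite (negPf (chi_neq1 g1)).
Qed.

Lemma chi_surj (c : 'F_p) : c ^+ l = 1 -> exists g, chi g = c.
Proof.
have [g g1] := gnontrivial L; move=> /(prim_rootP (chi_primitive g1))[i ->].
by exists (g ^+ i)%g; rewrite chiX.
Qed.

Lemma Fp_fermat (s : 'F_p) : s != 0 -> s ^+ p.-1 = 1.
Proof.
move=> s0; apply: (mulfI s0); rewrite -exprS prednK ?prime_gt0 // mulr1.
by have := expf_card s; rewrite card_Fp.
Qed.

Lemma tame_dvd : (l %| p.-1)%N.
Proof.
have [g g1] := gnontrivial L; rewrite (prim_order_dvd (chi_primitive g1)).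
by rewrite Fp_fermat //; apply: contra_eq_neq (chi_card g) => ->; rewrite expr0n; have := gcard_gt1 L; case: l => // _ _; rewrite eq_sym oner_neq0.
Qed.

Local Notation n := (p.-1 %/ l)%N.

Lemma tame_index : p.-1 = (n * l)%N.
Proof. by rewrite divnK ?tame_dvd. Qed.

Lemma tame_index_gt0 : (0 < n)%N.
Proof.
rewrite divn_gt0 ?(ltnW (gcard_gt1 L)) // dvdn_leq ?tame_dvd //.
by rewrite -subn1 subn_gt0 prime_gt1.
Qed.

(** chi identifies G with the l-th roots of unity in F_p, so s |-> s^n lifts to G. This rho plays
    the part of the reciprocity map at p; its value at 0 is a dummy. *)
Lemma exists_power_section : exists rho : 'F_p -> G, forall s, s != 0 -> chi (rho s) = s ^+ n.
Proof.
suff /choice[rho rhoP] : forall s, exists g, s != 0 -> chi g = s ^+ n by exists rho.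
move=> s; have [->|s0] := eqVneq s 0; first by exists 1%g.
have [|g chig] := @chi_surj (s ^+ n); first by rewrite -exprM -tame_index Fp_fermat.
by exists g.
Qed.

Variable rho : 'F_p -> G.
Hypothesis rhoP : forall s, s != 0 -> chi (rho s) = s ^+ n.

Lemma rhoM r s : r != 0 -> s != 0 -> rho (r * s) = (rho r * rho s)%g.
Proof. by move=> r0 s0; apply: chi_inj; rewrite chiM !rhoP ?mulf_neq0 // exprMn. Qed.

(** Modulo p, a projection to the part on which rho(r) acts as r^(-d). Integer representatives stand
    in for Teichmueller lifts, so the eigenvalue equation holds only modulo p times the lattice
    containing the conjugates of x. *)
Definition twisted_sum d (x : L) : L :=
  \sum_(s : 'F_p | s != 0) (nat_of_ord s)%:R ^+ d * act (rho s) x.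

(** Otherwise all p - 1 nonzero residues would be roots of unity of order dividing e - d < p - 1. *)
Lemma Fp_power_inj d e : (d < p.-1)%N -> (e < p.-1)%N ->
  (forall r : 'F_p, r != 0 -> r ^+ d = r ^+ e) -> d = e.
Proof.
wlog le_de : d e / (d <= e)%N.
  move=> W lt_d lt_e de; have [/W|/ltnW/W] := leqP d e; first exact.
  by move=> ed; apply/esym/ed => // r r0; rewrite de.
move=> lt_d lt_e de; have [//|neq_de] := eqVneq d e.
suff : (p.-1 <= e)%N by rewrite leqNgt lt_e.
have em_gt0 : (0 < e - d)%N by rewrite subn_gt0 ltn_neqAle neq_de.
have := @max_unity_roots 'F_p (e - d) (enum (predC1 0)) em_gt0.
rewrite enum_uniq // => /(_ _ isT) le_size.
have size_p : size (enum (predC1 (0 : 'F_p))) = p.-1 by rewrite -cardE cardC1 card_Fp.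
rewrite -size_p; apply: leq_trans (leq_subr d e); apply: le_size.
apply/allP => r; rewrite mem_enum inE => r0; rewrite unity_rootE.
by apply/eqP/(mulfI (expf_neq0 d r0)); rewrite -exprD subnKC // mulr1 de.
Qed.

Lemma ploc_act_codiff g x : R (x * pi ^+ l.-1) -> R (act g x * pi ^+ l.-1).
Proof.
move=> Rx; have [gpi0 _ RV] := punit_act_div pi0 Jpi piP g.
have -> : act g x * pi ^+ l.-1 = act g (x * pi ^+ l.-1) * (act g pi / pi)^-1 ^+ l.-1.
  by rewrite rmorphM rmorphXn /= invf_div expr_div_n; field; rewrite expf_neq0 // fmorph_eq0.
apply: ploc_embM => //; first exact: ploc_act.
by rewrite rmorphXn; apply: plocX.
Qed.

Lemma twisted_sum_valuation d x : (d < p.-1)%N -> R (x * pi ^+ l.-1) ->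
  exists2 j, (n * j <= d)%N & R (twisted_sum d x * pi ^+ j).
Proof.
move=> lt_d Rx; set z := twisted_sum d x.
have [->|z0] := eqVneq z 0; first by exists 0%N; rewrite ?muln0 // mul0r rmorph0; apply: ploc0.
have [[i|i] Uz] := generator_valuation_int p_pr inert pi0 Jpi piP z0.
  exists 0%N; rewrite ?muln0 // mulr1.
  rewrite -(divfK (expf_neq0 i pi0) z); apply: ploc_embM => //; first by case: Uz.
  by rewrite rmorphXn; apply: plocX => //; apply: pnil_emb_ploc.
move: Uz; rewrite NegzE invr_expz opprK -exprnP; set u := z * _ => Uu.
have Rpi : R pi by apply: pnil_emb_ploc.
have Rz : R (z * pi ^+ l.-1).
  rewrite mulr_suml rmorph_sum; apply: ploc_sum => // s _; rewrite -mulrA.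
  apply: ploc_embM => //; last exact: ploc_act_codiff.
  by rewrite rmorphXn rmorph_nat; apply/plocX/ploc_nat.
have lt_il : (i < l.-1)%N.
  rewrite ltnNge; apply/negP => le_li; apply: (punit_npnil p_pr Uu).
  have -> : u = z * pi ^+ l.-1 * pi ^+ (i - l.-1) * pi.
    by rewrite -mulrA -exprSr -mulrA -exprD addnS subnKC.
  by apply: pnil_embM => //; apply: ploc_embM => //; rewrite rmorphXn; apply: plocX.
exists i.+1; last by case: Uu.
have Upi := generator_card p_pr inert pi0 Jpi piP.
suff -> : d = (n * i.+1)%N by [].
apply: Fp_power_inj => // [|r r0].
  by rewrite [X in (_ < X)%N]tame_index ltn_mul2l tame_index_gt0; have := gcard_gt1 L; lia.
rewrite exprM -rhoP //; set g := rho r; set c := chi g.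
(* D vanishes up to the difference between the integer product of two representatives and the
   representative of their product, which is divisible by p. *)
pose D := (nat_of_ord r)%:R ^+ d * act g z - z.
have RD : R (D * pi ^+ l.-1 / p%:R).
  have -> : D = \sum_(s : 'F_p | s != 0)
      ((nat_of_ord r * nat_of_ord s) ^ d)%:R * act (rho (r * s)) x
      - \sum_(s : 'F_p | s != 0) (nat_of_ord (r * s)%R ^ d)%:R * act (rho (r * s)) x.
    congr (_ - _).
      rewrite rmorph_sum mulr_sumr; apply: eq_bigr => s s0.
      rewrite rmorphM rmorphXn rmorph_nat /= -gf_actM -rhoM // natrX natrM exprMn.
      by rewrite mulrA.
    rewrite /z /twisted_sum (reindex_inj (mulfI r0)) /=; apply: eq_big => [s|s s0].
      by rewrite mulf_eq0 (negPf r0).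
    by rewrite natrX.
  rewrite -sumrB !mulr_suml rmorph_sum; apply: ploc_sum => // s s0.
  set a := (_ ^ d)%N; set b := (_ ^ d)%N.
  have -> : (a%:R * act (rho (r * s)) x - b%:R * act (rho (r * s)) x) * pi ^+ l.-1 / p%:R =
      ((a%:R - b%:R) / p%:R) * (act (rho (r * s)) x * pi ^+ l.-1) by field; rewrite pL_neq0.
  apply: ploc_embM => //; last exact: ploc_act_codiff.
  rewrite fmorph_div rmorphB !rmorph_nat; apply: pnil_rat => //.
    by rewrite rpredB ?rpred_nat.
  by apply/pcong_Fp; rewrite !natrX natrM !natr_Zp.
have JD : J (D * pi ^+ i.+1).
  have [_ _ RV] := Upi.
  have -> : D * pi ^+ i.+1 = (D * pi ^+ l.-1 / p%:R) * (pi ^+ l / p%:R)^-1 * pi ^+ i.+2.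
    have -> : pi ^+ l = pi ^+ l.-1 * pi by rewrite -exprSr prednK // ltnW // gcard_gt1.
    by rewrite [pi ^+ i.+2]exprSr; field; rewrite pi0 pL_neq0 expf_neq0.
  rewrite exprSr mulrA; apply: pnil_embM => //; apply: ploc_embM => //.
    exact: ploc_embM.
  by rewrite rmorphXn; apply: plocX.
pose w := (act g pi / pi) ^+ i.+1.
have Rw : R w by rewrite rmorphXn; apply/plocX/ploc_act_div.
have Dw : w * act g z * pi ^+ i.+1 = act g u.
  by rewrite /u rmorphM rmorphXn /w /= expr_div_n; field; rewrite expf_neq0.
have [u0 Ru RVu] := Uu.
have Jwu : J ((nat_of_ord r)%:R ^+ d * act g u - w * u).
  have -> : (nat_of_ord r)%:R ^+ d * act g u - w * u = w * (D * pi ^+ i.+1).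
    by rewrite -Dw /D /u; ring.
  exact: pnil_embM.
have Jrc : J (((nat_of_ord r)%:R ^+ d - (nat_of_ord c)%:R ^+ i.+1) * u).
  have -> : ((nat_of_ord r)%:R ^+ d - (nat_of_ord c)%:R ^+ i.+1) * u =
      ((nat_of_ord r)%:R ^+ d * act g u - w * u) - (nat_of_ord r)%:R ^+ d * (act g u - u)
      + u * (w - (nat_of_ord c)%:R ^+ i.+1) by ring.
  rewrite rmorphD rmorphB; apply: pnilD => //; first apply: pnilB => //.
    by apply: pnil_embM => //; [rewrite rmorphXn rmorph_nat; apply/plocX/ploc_nat | apply: inert].
  apply: pnil_embM => //; rewrite rmorphB !rmorphXn rmorph_nat.
  by apply: pcongX => //; apply: ploc_act_div.
have {}Jrc : pcong p ((nat_of_ord r) ^ d)%:R ((nat_of_ord c) ^ i.+1)%:R.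
  have := pnil_embM p_pr RVu Jrc.
  by rewrite mulrC mulfK // rmorphB !rmorphXn !rmorph_nat -!natrX.
by move/pcong_Fp: Jrc; rewrite !natrX !natr_Zp.
Qed.

Variable zeta : algC.
Hypothesis prim_zeta : p.-primitive_root zeta.
Local Notation lam := (1 - zeta).

Let Alam : lam \in Aint.
Proof. by rewrite rpredB ?Aint1 // (Aint_prim_root prim_zeta). Qed.

Let p_neq0 : (p%:R : algC) != 0.
Proof. by rewrite pnatr_eq0 -lt0n prime_gt0. Qed.

(** With v(p) = 1, lambda has valuation 1 / (p - 1) and pi has 1 / l, while p - 1 = n l. The l-th
    power only involves quotients already known to be local. *)
Lemma ploc_lam_div d j : (n * j <= d)%N -> ploc p (lam ^+ d / iota pi ^+ j).
Proof.
move=> le_njd; apply: (@ploc_root p _ l); first exact: ltnW (gcard_gt1 L).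
have [_ _ RV] := generator_card p_pr inert pi0 Jpi piP.
have ipi0 : iota pi != 0 by rewrite fmorph_eq0.
have -> : (lam ^+ d / iota pi ^+ j) ^+ l =
    lam ^+ (d * l - p.-1 * j) * (lam ^+ p.-1 / p%:R) ^+ j * (iota (pi ^+ l / p%:R)^-1) ^+ j.
  have le : (p.-1 * j <= d * l)%N by rewrite tame_index mulnAC leq_mul2r le_njd orbT.
  have Dd : (d * l)%N = (d * l - p.-1 * j + p.-1 * j)%N by rewrite subnK.
  rewrite expr_div_n -!exprM Dd exprD addnK fmorphV fmorph_div rmorphXn rmorph_nat.
  rewrite invf_div !expr_div_n -!exprM [(j * l)%N]mulnC; field.
  by rewrite !expf_neq0.
apply: plocM => //; last by apply: plocX => //.
apply: plocM => //; first by apply: plocX => //; apply: ploc_Aint.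
by apply: plocX => //; apply: ploc_Aint => //; apply: Aint_1_sub_prim.
Qed.

(** Expanding zeta^s = (1 - lambda)^s, the coefficient of lambda^k is a sum of conjugates weighted
    by C(s, k). As k! is a unit at p for k < p - 1, it is a combination of twisted sums with d <= k.
    Each has a pole of order at most d / n, which lambda^d compensates. *)
Lemma gauss_ploc x : R (x * pi ^+ l.-1) ->
  ploc p (\sum_(s : 'F_p | s != 0) iota (act (rho s) x) * zeta ^+ s).
Proof.
move=> Rx.
have lt_sp (s : 'F_p) : (s < p)%N by rewrite -[X in (_ < X)%N](Fp_cast p_pr).
have Dzeta (s : 'F_p) : zeta ^+ s = \sum_(k < p) (- lam) ^+ k * 'C(s, k)%:R.
  have -> : zeta ^+ s = (1 - lam) ^+ s by congr (_ ^+ _); ring.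
  rewrite exprDn (big_ord_widen p (fun k => 1 ^+ (s - k) * (- lam) ^+ k *+ 'C(s, k))) ?lt_sp //.
  rewrite big_mkcond; apply: eq_bigr => k _; rewrite expr1n mul1r -mulr_natr ltnS.
  by case: leqP => // lt_sk; rewrite bin_small // mulr0.
pose S k : algC := \sum_(s : 'F_p | s != 0) 'C(s, k)%:R * iota (act (rho s) x).
have -> : \sum_(s : 'F_p | s != 0) iota (act (rho s) x) * zeta ^+ s =
    \sum_(k < p) (- 1) ^+ k * (lam ^+ k * S k).
  under eq_bigr => s _ do rewrite Dzeta mulr_sumr.
  rewrite exchange_big; apply: eq_bigr => k _; rewrite /S mulrA -exprNn mulr_sumr.
  by apply: eq_bigr => s _; rewrite -mulN1r mulN1r; ring.
apply: ploc_sum => // k _; apply: plocM => //.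
  by apply: plocX => //; have := ploc_int p_pr (-1); rewrite rmorphN1.
(* The top index k = p - 1 is outside the range of [twisted_sum_valuation]; there lambda^(p-1) is
   divisible by p, hence by pi^l, which clears any pole of order l - 1. *)
have [lt_kp1|ge_kp1] := ltnP k p.-1; last first.
  have -> : k = p.-1 :> nat by have := ltn_ord k; lia.
  have -> : lam ^+ p.-1 * S p.-1 = (lam ^+ p.-1 / p%:R) * (p%:R * S p.-1).
    by rewrite mulrA divfK.
  apply: plocM => //.
    by apply: ploc_Aint => //; apply: Aint_1_sub_prim.
  rewrite mulr_sumr; apply: ploc_sum => // s _; rewrite mulrCA; apply: plocM => //.
    exact: ploc_nat.
  have [_ _ RV] := generator_card p_pr inert pi0 Jpi piP.
  have -> : p%:R * iota (act (rho s) x) = iota (act (rho s) x * pi ^+ l.-1 * (pi ^+ l / p%:R)^-1 * pi).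
    have Dl : pi ^+ l = pi ^+ l.-1 * pi by rewrite -exprSr prednK // ltnW // gcard_gt1.
    rewrite -(rmorph_nat iota) -rmorphM Dl; congr (iota _); field.
    by rewrite pi0 pL_neq0 expf_neq0.
  apply: ploc_embM => //; last exact: pnil_emb_ploc.
  by apply: ploc_embM => //; apply: ploc_act_codiff.
have pk : ~~ (p %| k`!)%N.
  elim: (k : nat) lt_kp1 => [|i IHi] lt_i; first by rewrite dvdn1 neq_ltn prime_gt1 ?orbT.
  rewrite factS Euclid_dvdM // negb_or IHi ?(ltnW lt_i) // andbT gtnNdvd //.
  by apply: leq_trans lt_i _; rewrite leq_pred.
have k_neq0 : (k`!%:R : algC) != 0 by rewrite pnatr_eq0 -lt0n fact_gt0.
rewrite -[X in ploc _ X](mulKf k_neq0); apply: plocM => //; first exact: ploc_invn.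
have [q size_q Dq] := ffact_poly k.
have -> : k`!%:R * (lam ^+ k * S k) = \sum_(d < k.+1) (q`_d)%:~R * (lam ^+ k * iota (twisted_sum d x)).
  transitivity (lam ^+ k * \sum_(s : 'F_p | s != 0) \sum_(d < k.+1) (q`_d)%:~R * s%:R ^+ d * iota (act (rho s) x)).
    rewrite mulrCA; congr (_ * _); rewrite mulr_sumr; apply: eq_bigr => s _.
    rewrite mulrA -mulr_suml -natrM mulnC bin_ffact; congr (_ * _).
    transitivity ((s ^_ k)%:Z%:~R : algC) => //; rewrite Dq (horner_coef_wide _ size_q) rmorph_sum.
    by apply: eq_bigr => d _; rewrite rmorphM rmorphXn.
  rewrite exchange_big mulr_sumr; apply: eq_bigr => d _; rewrite [RHS]mulrCA; congr (_ * _).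
  rewrite /twisted_sum rmorph_sum mulr_sumr; apply: eq_bigr => s _.
  by rewrite rmorphM rmorphXn rmorph_nat mulrA.
apply: ploc_sum => // d _; apply: plocM => //; first exact: ploc_int.
have le_dk : (d <= k)%N by rewrite -ltnS.
have [j le_j Rj] := twisted_sum_valuation (leq_ltn_trans le_dk lt_kp1) Rx.
have -> : lam ^+ k * iota (twisted_sum d x) =
    lam ^+ (k - d) * (lam ^+ d / iota pi ^+ j) * iota (twisted_sum d x * pi ^+ j).
  have Dk : (k - d + d)%N = k by rewrite subnK.
  rewrite -[X in lam ^+ X * _ = _]Dk exprD rmorphM rmorphXn; field.
  by rewrite expf_neq0 // fmorph_eq0.
apply: plocM => //; apply: plocM => //; last exact: ploc_lam_div.
by apply: ploc_Aint => //; rewrite rpredX.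
Qed.

End TameCharacter.

(** * Additive characters of F_p *)

Section AdditiveCharacter.
Variable p : nat.
Hypothesis p_pr : prime p.
Variable zeta : algC.
Hypothesis prim_zeta : p.-primitive_root zeta.
Local Notation e s := (zeta ^+ nat_of_ord (s : 'F_p)).

Lemma addchar_nat (m : nat) : e (m%:R) = zeta ^+ m.
Proof. by rewrite val_Fp_nat // prim_expr_mod. Qed.

Lemma addcharD s t : e (s + t) = e s * e t.
Proof. by rewrite -exprD -[RHS]addchar_nat natrD !natr_Zp. Qed.

Lemma addcharM (m : nat) s : e (m%:R * s) = e s ^+ m.
Proof. by rewrite -exprM -[RHS]addchar_nat natrM natr_Zp mulrC. Qed.

Lemma addchar0 : e 0 = 1.
Proof. by []. Qed.

Lemma sum_addchar : \sum_(s : 'F_p) e s = 0.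
Proof.
have p1 : zeta != 1.
  apply/eqP => z1; move: p_pr prim_zeta; rewrite z1 => pp.
  move=> /prim_order_dvd/(_ 1%N); rewrite expr1 eqxx dvdn1 => /eqP p1.
  by move: pp; rewrite p1.
have e1 : e 1 = zeta by rewrite (addchar_nat 1).
have : e 1 * (\sum_(s : 'F_p) e s) = \sum_(s : 'F_p) e s.
  rewrite mulr_sumr [RHS](reindex_inj (addrI 1)).
  by apply: eq_bigr => s _; rewrite -addcharD.
move/eqP; rewrite e1 -subr_eq0 -[X in _ - X]mul1r -mulrBl mulf_eq0 subr_eq0 (negPf p1).
by move/eqP.
Qed.

Lemma sum_addcharM v : \sum_(s : 'F_p | s != 0) e (s * v) = (if v == 0 then p%:R else 0) - 1.
Proof.
have -> : \sum_(s : 'F_p | s != 0) e (s * v) = \sum_(s : 'F_p) e (s * v) - 1.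
  have -> : \sum_(s : 'F_p) e (s * v) = e (0 * v) + \sum_(s : 'F_p | s != 0) e (s * v).
    by rewrite (bigD1 0).
  by rewrite mul0r addchar0 addrC addKr.
congr (_ - 1); have [->|v0] := eqVneq v 0.
  rewrite (eq_bigr (fun=> 1)) => [|s _]; last by rewrite mulr0.
  by rewrite sumr_const card_Fp.
by rewrite -[RHS]sum_addchar [RHS](reindex_inj (mulIf v0)).
Qed.

Lemma addchar_aut (nu : {rmorphism algC -> algC}) :
  exists2 a : 'F_p, a != 0 & forall s, nu (e s) = e (a * s).
Proof.
have prim_nu : p.-primitive_root (nu zeta) by rewrite fmorph_primitive_root.
have [i Di] := prim_rootP prim_zeta (prim_expr_order prim_nu).
exists (i%:R) => [|s].
  apply/eqP => i0; have := sum_addcharM 1.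
  have e0 : e (i%:R) = 1 by rewrite i0.
  have nz1 : nu zeta = 1 by rewrite Di -addchar_nat.
  have z1 : zeta = 1 by apply: (fmorph_inj nu); rewrite nz1 rmorph1.
  have := sum_addchar; rewrite (eq_bigr (fun=> 1)) => [|s _]; last by rewrite z1 expr1n.
  by rewrite sumr_const card_Fp // => /eqP; rewrite pnatr_eq0 -leqn0 leqNgt prime_gt0.
by rewrite rmorphXn Di addcharM -!exprM mulnC.
Qed.

Lemma addchar_conj s : (e s)^* = e (- s).
Proof.
have n1 : `|e s| = 1.
  have : `|e s| ^+ p == 1.
    by rewrite -normrX -exprM mulnC exprM (prim_expr_order prim_zeta) expr1n normr1.
  by rewrite pexpr_eq1 ?prime_gt0 // => /eqP.
have es0 : e s != 0 by rewrite -normr_eq0 n1 oner_neq0.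
apply: (mulfI es0); rewrite -normCK n1 expr1n -addcharD subrr.
by rewrite addchar0.
Qed.

End AdditiveCharacter.

(** * Gaussian periods labelled by the Galois group *)

Section GaussianPeriod.
Variable L : galois_field.
Local Notation G := (gf_group L).
Local Notation act := (@gf_act L).
Local Notation iota := (@gf_emb L).
Local Notation l := #|G|.

Definition trace_dual (x : L) := forall y : L, iota y \in Aint -> iota (gtr (x * y)) \in Num.int.

(** The form Psi; it is the trace pairing with e as soon as f(g) = g(e) for all g. *)
Definition gform (f : G -> algC) (x : L) : algC := \sum_(g : G) iota (act g x) * f g.

Section OnePrime.
Variable p : nat.
Hypotheses (p_pr : prime p) (inert : inertial L p) (tame : ~~ (p %| l)%N) (l_odd : odd l).
Local Notation R x := (ploc p (iota x)).
Local Notation J x := (pnil p (iota x)).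
Local Notation n := (p.-1 %/ l)%N.

(** If x had a pole of order at least l, 1 / (x p) would be local. Then y = m / (x p) is an
    algebraic integer for some m prime to p, and tr(x y) = m l / p is not an integer because p does
    not divide l. *)
Lemma trace_dual_ploc (pi x : L) : pi != 0 -> J pi -> (forall x, J x -> R (x / pi)) ->
  trace_dual x -> R (x * pi ^+ l.-1).
Proof.
move=> pi0 Jpi piP dual_x.
have pL0 : (p%:R : L) != 0.
  by rewrite -(fmorph_eq0 iota) rmorph_nat pnatr_eq0 -lt0n prime_gt0.
have [->|x0] := eqVneq x 0; first by rewrite mul0r rmorph0; apply: ploc0.
have [k Uk] := generator_valuation_int p_pr inert pi0 Jpi piP x0.
have Rpi m : R (pi ^+ m) by rewrite rmorphXn; apply: plocX => //; apply: pnil_emb_ploc.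
have [k_ge|k_lt] := leP (- (l.-1)%:Z) k.
  have -> : x * pi ^+ l.-1 = x / pi ^ k * pi ^+ `|(k + (l.-1)%:Z)%R|%N.
    rewrite [X in _ = _ * X]exprnP gez0_abs; last by rewrite addrC -lerBlDl sub0r.
    by rewrite [pi ^ (k + _)]expfzDr // !mulrA divfK ?expfz_neq0.
  by apply: ploc_embM => //; case: Uk.
have l_gt0 : (0 < l)%N := ltnW (gcard_gt1 L).
have {}k_lt : k <= - l%:Z by move: k_lt; lia.
have [_ _ RV] := Uk.
have [_ Rpil _] := generator_card p_pr inert pi0 Jpi piP.
have RVxp : R (x * p%:R)^-1.
  have -> : (x * p%:R)^-1 = (x / pi ^ k)^-1 * (pi ^+ l / p%:R) * pi ^+ `|(- k - l%:Z)%R|%N.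
    have -> : pi ^+ `|(- k - l%:Z)%R|%N = pi ^ (- k - l%:Z) by rewrite exprnP gez0_abs //; lia.
    rewrite !expfzDr // -exprnN -invr_expz; field.
    by rewrite x0 pL0 expf_neq0 ?expfz_neq0.
  by apply: ploc_embM => //; apply: ploc_embM.
have [m pm Am] := RVxp.
have Am' : iota (m%:R * (x * p%:R)^-1) \in Aint by rewrite rmorphM rmorph_nat.
have := dual_x _ Am'.
have -> : x * (m%:R * (x * p%:R)^-1) = m%:R / p%:R by field; rewrite x0 pL0.
rewrite gtr_id ?fmorph_div ?rmorph_nat ?rpred_div ?rpred_nat //.
rewrite rmorphMn fmorph_div !rmorph_nat => /intrP[a Da].
have : ploc p ((m * l)%N%:Z%:~R / p%:R).
  have -> : (m * l)%N%:Z%:~R / p%:R = a%:~R :> algC.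
    by rewrite -Da -[(m * l)%N%:Z%:~R]/((m * l)%N%:R) natrM mulrAC mulr_natr.
  exact: ploc_int.
move/(ploc_ratP p_pr); rewrite dvdzE /= Euclid_dvdM //.
by rewrite (negPf pm) (negPf tame).
Qed.

(** f(g) sums zeta^s over the n elements s with rho(s) = g. In the autocorrelation, pairs (s, s u)
    with rho(u) = k contribute the sum over s of zeta^(s (u + 1)), which is -1 unless u = -1, where
    it is p - 1. Since rho(-1) = 1, that exception occurs for k = 1 only, and the periods are
    real. *)
Lemma exists_gaussian_period :
  (l %| p.-1)%N /\ exists f : G -> algC, [/\
    forall g, f g \in Aint,
    forall k, \sum_h f h * f (h * k)%g = (if k == 1%g then p%:R else 0) - n%:R,
    forall nu : {rmorphism algC -> algC}, exists a, forall h, nu (f h) = f (a * h)%g,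
    forall g, (f g)^* = f g
  & forall x, trace_dual x -> ploc p (gform f x)].
Proof.
have [pi [pi0 Jpi piP]] := inertial_generator p_pr inert.
have [chi chiP] := tame_residue p_pr inert Jpi piP.
have chi_injP : injective chi := chi_inj p_pr inert tame pi0 Jpi piP chiP.
have chi1P : chi 1%g = 1 := chi1 p_pr pi0 chiP.
have [rho rhoP] := exists_power_section p_pr inert tame pi0 Jpi piP chiP.
have rhoM r s : r != 0 -> s != 0 -> rho (r * s) = (rho r * rho s)%g.
  by move=> r0 s0; apply: (rhoM p_pr inert tame pi0 Jpi piP chiP rhoP).
have Dp : p.-1 = (n * l)%N := tame_index p_pr inert tame pi0 Jpi piP chiP.
split; first by rewrite Dp dvdn_mull.
have [zeta prim_zeta] := C_prim_root_exists (prime_gt0 p_pr).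
pose e (s : 'F_p) := zeta ^+ nat_of_ord s.
have eD s t : e (s + t) = e s * e t by apply: addcharD.
(* The l-th power of (-1)^n is 1, and l is odd, so (-1)^n = 1. *)
have rhoN1 : rho (- 1) = 1%g.
  have N1 : (-1 : 'F_p) != 0 by rewrite oppr_eq0 oner_neq0.
  apply: chi_injP; rewrite rhoP // chi1P.
  have := chi_card p_pr inert pi0 Jpi piP chiP (rho (-1)).
  rewrite rhoP // -exprM -[in X in X -> _]signr_odd oddM l_odd andbT signr_odd.
  by [].
pose f g := \sum_(s | (s != 0) && (rho s == g)) e s.
pose fib (h : G) := [pred s : 'F_p | (s != 0) && (rho s == h)].
(* A fibre consists of roots of X^n - chi(h), so it has at most n elements; together the l fibres
   contain p - 1 = n l. *)
have fiber_card k : #|fib k| = n.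
  have le_card (h : G) : (#|fib h| <= n)%N.
    have n_gt0 := tame_index_gt0 p_pr inert tame pi0 Jpi piP chiP.
    have mon : ('X^n - (chi h)%:P : {poly 'F_p}) \is monic by apply: monicXnsubC.
    have := @max_poly_roots _ ('X^n - (chi h)%:P) (enum [pred s : 'F_p | (s != 0) && (rho s == h)])
      (monic_neq0 mon).
    rewrite enum_uniq size_XnsubC // -cardE ltnS; apply=> //.
    apply/allP => s; rewrite mem_enum inE => /andP[s0 /eqP <-].
    by rewrite /root !hornerE rhoP // subrr.
  have sum_card : (\sum_h #|fib h| = n * l)%N.
    rewrite -Dp; transitivity #|predC1 (0 : 'F_p)|; last by rewrite cardC1 card_Fp.
    rewrite -[RHS]sum1_card.
    rewrite (partition_big rho xpredT) //=; apply: eq_bigr => h _.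
    by rewrite -sum1_card; apply: eq_bigl => s; rewrite !inE.
  apply/eqP; rewrite eqn_leq le_card leqNgt; apply/negP => lt_k.
  have : (\sum_h #|fib h| < \sum_(h : G) n)%N.
    rewrite (bigD1 k) //= [X in (_ < X)%N](bigD1 k) //= -addSn leq_add //.
    by apply: leq_sum => h _.
  by rewrite sum_card sum_nat_const mulnC ltnn.
have sum_f (F : G -> algC) : \sum_g F g * f g = \sum_(s : 'F_p | s != 0) F (rho s) * e s.
  rewrite [RHS](partition_big rho xpredT) //=; apply: eq_bigr => g _.
  by rewrite mulr_sumr; apply: eq_bigr => s /andP[_ /eqP->].
have f_shift a h : a != 0 -> \sum_(s | (s != 0) && (rho s == h)) e (a * s) = f (rho a * h)%g.
  move=> a0; rewrite /f [RHS](reindex_inj (mulfI a0)) /=; apply: eq_bigl => s.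
  rewrite mulf_eq0 (negPf a0) /=; have [//|s0 /=] := eqVneq s 0.
  by rewrite rhoM // (inj_eq (mulgI _)).
exists f; split.
- move=> g; rewrite rpred_sum // => s _; rewrite rpredX //.
  exact: Aint_prim_root prim_zeta.
- move=> k; under eq_bigr => h _ do rewrite mulrC.
  rewrite (sum_f (fun h => f (h * k)%g)).
  transitivity (\sum_(u | (u != 0) && (rho u == k)) \sum_(s : 'F_p | s != 0) e (s * (u + 1))).
    rewrite exchange_big; apply: eq_bigr => s s0.
    rewrite -f_shift // mulr_suml; apply: eq_bigr => u _.
    by rewrite -eD mulrDr mulr1.
  have sum_e v : \sum_(s : 'F_p | s != 0) e (s * v) = (if v == 0 then p%:R else 0) - 1.
    exact: sum_addcharM.
  under eq_bigr => u _ do rewrite sum_e.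
  rewrite sumrB sumr_const fiber_card; congr (_ - _).
  have N1 : (-1 : 'F_p) != 0 by rewrite oppr_eq0 oner_neq0.
  have [k1|k1] := eqVneq k 1%g; last first.
    rewrite big1 // => u /andP[_ /eqP Du]; rewrite addr_eq0; case: eqP => // u1.
    by move: k1; rewrite -Du u1 rhoN1 eqxx.
  rewrite (bigD1 (-1)) /=; last by rewrite N1 rhoN1 k1 eqxx.
  rewrite addNr eqxx big1 ?addr0 // => u /andP[_ u1].
  by rewrite addr_eq0 (negPf u1).
- move=> nu; have [a a0 nuP] := addchar_aut p_pr prim_zeta nu.
  exists (rho a) => h; rewrite -f_shift // rmorph_sum; apply: eq_bigr => s _.
  exact: nuP.
- move=> g; rewrite -[in RHS](mul1g g) -rhoN1 -f_shift ?oppr_eq0 ?oner_neq0 //.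
  rewrite rmorph_sum; apply: eq_bigr => s _; rewrite mulN1r.
  exact: addchar_conj.
- move=> x dual_x; rewrite /gform sum_f.
  apply: (gauss_ploc p_pr inert tame pi0 Jpi piP chiP rhoP prim_zeta).
  exact: trace_dual_ploc.
Qed.

End OnePrime.
End GaussianPeriod.

(** * Convolution over the ramified primes *)

Section Convolution.
Variable L : galois_field.
Local Notation G := (gf_group L).
Local Notation act := (@gf_act L).
Local Notation iota := (@gf_emb L).
Local Notation l := #|G|.

Definition gconv (f g : G -> algC) (k : G) : algC := \sum_h f h * g (h^-1 * k)%g.

Definition gcorr (f : G -> algC) (k : G) : algC := \sum_h f h * f (h * k)%g.

Lemma gconvC f g k : gconv f g k = gconv g f k.
Proof.
rewrite /gconv (reindex_inj (inj_comp (mulgI k) (@invg_inj _))) /=.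
by apply: eq_bigr => h _; rewrite invMg invgK mulgKV mulrC gmulC.
Qed.

Lemma gform_conv f g x : gform (gconv f g) x = \sum_h f h * gform g (act h x).
Proof.
rewrite /gform; under eq_bigr => k _ do rewrite mulr_sumr.
rewrite exchange_big; apply: eq_bigr => h _ /=.
rewrite (reindex_inj (mulgI h)) mulr_sumr; apply: eq_bigr => k _ /=.
by rewrite mulKg gf_actM actC mulrCA.
Qed.

(** Autocorrelation is convolution with the reflected function, and convolution on a commutative
    group is commutative and associative. *)
Lemma gcorr_conv f g k : gcorr (gconv f g) k = gconv (gcorr f) (gcorr g) k.
Proof.
rewrite /gcorr /gconv.
transitivity (\sum_h \sum_a \sum_b f a * g (a^-1 * h)%g * (f b * g (b^-1 * (h * k))%g)).
  by apply: eq_bigr => h _; rewrite mulr_suml; apply: eq_bigr => a _; rewrite mulr_sumr.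
rewrite exchange_big /=.
transitivity (\sum_a \sum_c f a * f (a * c)%g * \sum_h g h * g (h * (c^-1 * k))%g).
  apply: eq_bigr => a _; rewrite exchange_big /= (reindex_inj (mulgI a)); apply: eq_bigr => c _ /=.
  rewrite (reindex_inj (mulgI a)) mulr_sumr; apply: eq_bigr => h _ /=.
  rewrite mulKg mulrACA; congr (_ * (_ * g _)).
  by rewrite invMg -!mulgA mulKg mulgA [(c^-1 * h)%g]gmulC -mulgA.
rewrite exchange_big; apply: eq_bigr => c _ /=.
by rewrite -mulr_suml.
Qed.

Lemma trace_dual_act h (x : L) : trace_dual x -> trace_dual (act h x).
Proof.
move=> dual_x y Ay; have -> : gtr (act h x * y) = gtr (x * act h^-1%g y).
  by rewrite -(gtr_actl h (x * _)) rmorphM -[act h (act _ y)]gf_actM mulgV act1.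
by apply: dual_x; have [nu <-] := gf_extend h^-1%g; rewrite Aint_aut.
Qed.

Lemma gmulCA : left_commutative (@mulg G).
Proof. by move=> g h k; rewrite !mulgA (gmulC g). Qed.

(** The prescribed autocorrelation is N times the indicator of 1 minus a constant, with total 1.
    Such functions are closed under convolution: the factors N multiply, the totals stay 1, and this
    determines the constant. Psi of a convolution is a combination of values of either Psi at
    conjugates with integral coefficients, so integrality at each prime comes from its own
    factor. *)
Lemma exists_period (ps : seq nat) : odd l ->
    (forall p, p \in ps -> [/\ prime p, inertial L p & ~~ (p %| l)%N]) ->
  let N := (\prod_(p <- ps) p)%N in
  [/\ (0 < N)%N, (l %| N.-1)%N & exists f : G -> algC, [/\
    forall g, f g \in Aint,
    forall k, gcorr f k = (if k == 1%g then N%:R else 0) - (N.-1 %/ l)%N%:R,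
    forall nu : {rmorphism algC -> algC}, exists a, forall h, nu (f h) = f (a * h)%g,
    forall g, (f g)^* = f g
  & forall x, trace_dual x -> forall p, p \in ps -> ploc p (gform f x)]].
Proof.
move=> l_odd; elim: ps => [_|p ps IHps psP] /=.
  rewrite big_nil; split=> //.
  exists (fun g => (g == 1%g)%:R); split=> //.
  - by move=> g; apply: Aint_Cnat; apply: natr_nat.
  - move=> k; rewrite /gcorr (bigD1 1%g) //= big1 => [|h /negPf->]; last by rewrite mul0r.
    by rewrite eqxx mul1g mul1r addr0 div0n subr0; case: eqP.
  - by move=> nu; exists 1%g => h; rewrite mul1g rmorph_nat.
  - by move=> g; rewrite rmorph_nat.
have [|N_gt0 dvdN [f [Af cf nuf conjf locf]]] := IHps.
  by move=> q psq; apply: psP; rewrite inE psq orbT.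
have [p_pr p_in tame] : [/\ prime p, inertial L p & ~~ (p %| l)%N] by apply: psP; rewrite mem_head.
have [dvdp [g [Ag cg nug conjg locg]]] := exists_gaussian_period p_pr p_in tame l_odd.
rewrite big_cons; set N := (\prod_(q <- ps) q)%N in N_gt0 dvdN cf *.
have l_gt0 : (0 < l)%N := ltnW (gcard_gt1 L).
have p_gt0 := prime_gt0 p_pr.
have DpN : (p * N).-1 = (l * (p.-1 %/ l * (N.-1 %/ l) * l + p.-1 %/ l + N.-1 %/ l))%N.
  have := divnK dvdp; have := divnK dvdN; move: (p.-1 %/ l)%N (N.-1 %/ l)%N => a b Db Da.
  have -> : p = (a * l).+1 by rewrite Da prednK.
  have -> : N = (b * l).+1 by rewrite Db prednK.
  by rewrite mulSn mulnS /=; nia.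
split; first by rewrite muln_gt0 p_gt0.
  by rewrite DpN dvdn_mulr.
exists (gconv g f); split.
- by move=> k; rewrite rpred_sum // => h _; rewrite rpredM.
- move=> k; rewrite gcorr_conv DpN mulKn // /gconv.
  under eq_bigr => c _ do rewrite [gcorr g c]cg cf.
  transitivity (p%:R * ((if k == 1%g then N%:R else 0) - (N.-1 %/ l)%:R)
      - (p.-1 %/ l)%:R * (N%:R - (l * (N.-1 %/ l))%:R) : algC).
    rewrite (eq_bigr _ (fun c _ => mulrBl _ _ _)) sumrB; congr (_ - _).
      rewrite (bigD1 1%g) //= eqxx big1 => [|c /negPf->]; last by rewrite mul0r.
      by rewrite addr0 invg1 mul1g.
    rewrite -mulr_sumr sumrB sumr_const; congr (_ * (_ - _)); last first.
      by rewrite natrM mulr_natl.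
    rewrite (bigD1 k) //= mulVg eqxx big1 ?addr0 // => c.
    by rewrite eq_mulVg1 => /negPf->.
  have DN : N%:R = 1 + l%:R * (N.-1 %/ l)%:R :> algC.
    by rewrite -natrM mulnC divnK // -[in LHS](prednK N_gt0) -natr1 addrC.
  have Dp : p%:R = 1 + l%:R * (p.-1 %/ l)%:R :> algC.
    by rewrite -natrM mulnC divnK // -[in LHS](prednK p_gt0) -natr1 addrC.
  by rewrite !natrD !natrM; case: eqP => _; rewrite DN Dp; ring.
- move=> nu; have [a nua] := nug nu; have [b nub] := nuf nu.
  exists (b * a)%g => k; rewrite rmorph_sum /gconv [RHS](reindex_inj (mulgI a)) /=.
  apply: eq_bigr => h _; rewrite rmorphM /= nua nub; congr (_ * f _).
  by rewrite invMg -!mulgA (gmulCA b a) mulKg (gmulCA b).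
- move=> k; rewrite rmorph_sum; apply: eq_bigr => h _.
  by rewrite rmorphM /= conjg conjf.
- move=> x dual_x q; rewrite inE => /predU1P[->|psq].
    have -> : gform (gconv g f) x = gform (gconv f g) x.
      by apply: eq_bigr => k _; rewrite gconvC.
    rewrite gform_conv; apply: ploc_sum => // h _; apply: plocM => //.
      exact: ploc_Aint.
    exact/locg/trace_dual_act.
  have [q_pr _ _] : [/\ prime q, inertial L q & ~~ (q %| l)%N] by apply: psP; rewrite inE psq orbT.
  rewrite gform_conv; apply: ploc_sum => // h _; apply: plocM => //.
    exact: ploc_Aint.
  by apply: locf => //; apply: trace_dual_act.
Qed.

End Convolution.

(** * Minkowski's theorem on linear forms *)

(** If A is singular a kernel vector serves. Otherwise Z^n modulo the image of A has |det A|
    classes, fewer than the k^n points of the box [0, k)^n; two points in one class differ by some A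
    c. *)
Lemma int_mx_pigeonhole n (A : 'M[int]_n) (k : nat) :
  (`|\det A| < k ^ n)%N ->
  exists2 c : 'cV[int]_n, c != 0 & forall i, (`|((A *m c) i 0)%R| < k)%N.
Proof.
move=> ltAk; have [U uU [V uV [d _ DA]]] := int_Smith_normal_form A.
have k_gt0 (i : 'I_n) : (0 < k)%N.
  by rewrite lt0n; apply: contraTneq ltAk => ->; rewrite exp0n ?ltn0 // (leq_ltn_trans _ (ltn_ord i)).
set D := \matrix_(i, j) _ in DA.
have [i /eqP di0|nz_d] := pickP (fun i : 'I_n => d`_i == 0).
  pose c : 'cV[int]_n := invmx V *m delta_mx i 0.
  have Dc : A *m c = 0.
    rewrite DA /c -!mulmxA mulKVmx //; suff -> : D *m delta_mx i (0 : 'I_1) = 0 by rewrite mulmx0.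
    apply/matrixP => a b; rewrite !mxE big1 // => j _; rewrite !mxE.
    have [->|ji] := eqVneq j i; last by rewrite /= mulr0.
    by case: eqP => [->|_]; rewrite ?di0 ?mul0rn mul0r.
  exists c => [|j]; last by rewrite Dc mxE absz0 (k_gt0 j).
  apply/eqP => c0; have /matrixP/(_ i 0) : V *m c = 0 by rewrite c0 mulmx0.
  by rewrite mulKVmx // !mxE !eqxx.
have {}nz_d (i : 'I_n) : (0 < `|(d`_i)%R|)%N by rewrite absz_gt0 nz_d.
have detA : (`|\det A| = \prod_(i < n) `|(d`_i)%R|)%N.
  have unit1 (W : 'M[int]_n) : W \in unitmx -> (`|\det W| = 1)%N.
    by rewrite unitmxE unfold_in => /orP[]/eqP->.
  rewrite DA !det_mulmx !abszM (unit1 U) // (unit1 V) // mul1n muln1.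
  have -> : D = diag_mx (\row_i d`_i).
    by apply/matrixP => i j; rewrite !mxE.
  by rewrite det_diag (big_morph _ abszM (erefl _)); apply: eq_bigr => i _; rewrite mxE.
pose vec (f : {ffun 'I_n -> 'I_k}) : 'cV[int]_n := \col_i (f i : nat)%:Z.
(* The class modulo the image of A, read through the Smith form as residues modulo the elementary
   divisors. The shape [.-1.+1] only makes the ordinal type visibly nonempty for [inord]. *)
pose res (f : {ffun 'I_n -> 'I_k}) : {dffun forall i : 'I_n, 'I_(`|(d`_i)%R|.-1.+1)} :=
  [ffun i => inord `|(((invmx U *m vec f) i 0)%R %% d`_i)%Z|%N].
have [f [g neq_fg res_fg]] : exists f, exists2 g, f != g & res f = res g.
  apply/injectivePn/negP => /injectiveP/leq_card.
  rewrite card_ffun !card_ord card_dep_ffun leqNgt => /negP[].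
  suff -> : foldr muln 1%N [seq #|'I_(`|(d`_i)%R|.-1.+1)| | i : 'I_n] = `|\det A|%N by [].
  rewrite detA foldrE big_image /=; apply: eq_bigr => i _.
  by rewrite card_ord prednK.
pose w : 'cV[int]_n := \col_i (((invmx U *m vec f) i 0 - (invmx U *m vec g) i 0)%R %/ d`_i)%Z.
have Dw : D *m w = invmx U *m (vec f - vec g).
  apply/colP => i; rewrite mxE (bigD1 i) //= big1 ?addr0; last first.
    move=> j ji; rewrite [D _ _]mxE; case: eqP => [/ord_inj ij|_]; last by rewrite mul0r.
    by rewrite ij eqxx in ji.
  rewrite [D _ _]mxE eqxx mulr1n [w _ _]mxE mulrC divzK.
    by rewrite mulmxBr; move: (invmx U *m vec f) (invmx U *m vec g) => X Y; rewrite !mxE.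
  have := congr1 (fun h : {dffun forall i : 'I_n, 'I_(`|(d`_i)%R|.-1.+1)} => val (h i)) res_fg; rewrite !ffunE /=.
  rewrite !inordK ?prednK ?ltz_mod //; last 2 first.
  - by rewrite -ltz_nat gez0_abs ?modz_ge0 -?absz_gt0 // ltz_mod -?absz_gt0.
  - by rewrite -ltz_nat gez0_abs ?modz_ge0 -?absz_gt0 // ltz_mod -?absz_gt0.
  move/(congr1 Posz); rewrite !gez0_abs ?modz_ge0 -?absz_gt0 // => /eqP.
  by rewrite eqz_mod_dvd.
have Ac : A *m (invmx V *m w) = vec f - vec g.
  by rewrite DA -!mulmxA mulKVmx // Dw mulKVmx.
exists (invmx V *m w) => [|i].
  apply: contraNneq neq_fg => c0; apply/eqP/ffunP => i; apply/val_inj.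
  have /colP/(_ i) : vec f - vec g = 0 by rewrite -Ac c0 mulmx0.
  by rewrite !mxE => /eqP; rewrite subr_eq0 => /eqP[].
rewrite Ac !mxE; have := ltn_ord (f i); have := ltn_ord (g i).
by move: (f i : nat) (g i : nat) => a b lt_b lt_a; rewrite -ltz_nat abszE ltr_norml; lia.
Qed.

Section Minkowski.
Variable R : archiRealFieldType.

(** A weak Hadamard bound: expanding the product of the row sums gives one term for every map of the
    index set to itself, the permutations among them. *)
Lemma ler_det_prod n (A : 'M[R]_n) : `|\det A| <= \prod_i \sum_j `|A i j|.
Proof.
rewrite bigA_distr_bigA /=; apply: le_trans (ler_norm_sum _ _ _) _.
pose F (f : {ffun 'I_n -> 'I_n}) := \prod_i `|A i (f i)|.
pose h (s : 'S_n) : {ffun 'I_n -> 'I_n} := [ffun i => s i].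
have h_inj : injective h.
  by move=> s t /ffunP st; apply/permP => i; have := st i; rewrite !ffunE.
rewrite (eq_bigr (fun s => F (h s))) => [|s _]; last first.
  rewrite normrM normrX normrN1 expr1n mul1r normr_prod.
  by apply: eq_bigr => i _; rewrite ffunE.
rewrite -(big_imset _ (in2W h_inj)) /=.
rewrite [X in _ <= X](bigID [in [set h s | s in 'S_n]%SET]) /= lerDl.
by apply: sumr_ge0 => f _; apply: prodr_ge0.
Qed.

Lemma mulmx_norm_le m n (A : 'M[R]_(m, n)) (v : 'cV[R]_n) (b : R) i :
  (forall k, `|v k 0| <= b) -> `|(A *m v) i 0| <= (\sum_k `|A i k|) * b.
Proof.
move=> vb; rewrite mxE mulr_suml; apply: le_trans (ler_norm_sum _ _ _) _.
by apply: ler_sum => k _; rewrite normrM ler_wpM2l.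
Qed.

Fact linear_absorb (r t x y : R) : 0 <= r -> 0 < t -> 2 * x <= t -> 1 <= t ->
  0 <= x -> 0 <= y -> r * t <= x * (t + y) + x * r -> r <= 2 * x * (1 + y).
Proof.
move=> r0 t0 xt t1 x0 y0 le_r.
have le1 : r * t <= 2 * (x * (t + y)).
  have : 2 * (x * r) <= r * t by rewrite mulrA [r * t]mulrC ler_wpM2r.
  by lra.
have le2 : x * (t + y) <= x * (1 + y) * t.
  rewrite -mulrA ler_wpM2l // mulrDl mul1r lerD2l.
  by rewrite ler_peMr.
rewrite -(ler_pM2r t0); apply: le_trans le1 _.
by rewrite -!mulrA ler_pM2l // mulrA.
Qed.

(** The pigeonhole lemma is applied to the integer part of T A. The resulting A c exceeds the bound
    1 by an error of order (1 + s) / T, with s the l1 norm of c; since A is invertible, s is bounded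
    in terms of A c, and this absorbs the error ([linear_absorb]) with a constant independent of
    T. *)
Lemma minkowski_approx n (A : 'M[R]_n) : (0 < n)%N -> \det A != 0 -> `|\det A| <= 1 ->
  exists2 B : nat, (0 < B)%N & forall T : nat, (B <= T)%N ->
  exists2 c : 'cV[int]_n, c != 0 &
    (forall i, (`|(c i ord0)%R| <= B)%N) /\
    (forall i, `|(A *m map_mx intr c) i 0| <= 1 + B%:R / T%:R).
Proof.
move=> n_gt0 detA0 detA1.
have uA : A \in unitmx by rewrite unitmxE unitfE.
pose S := \sum_i \sum_k `|invmx A i k|.
have S_ge0 : 0 <= S by apply: sumr_ge0 => i _; apply: sumr_ge0.
have [C SC] : exists C : nat, S <= C%:R.
  by exists (Num.bound S); apply/ltW/archi_boundP.
have row_le (i : 'I_n) : \sum_k `|invmx A i k| <= C%:R.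
  apply: le_trans SC; rewrite /S [X in _ <= X](bigD1 i) //= lerDl.
  by apply: sumr_ge0 => j _; apply: sumr_ge0.
(* C bounds the entries of the inverse of A, summed; C1 bounds the growth of the determinant under
   rounding, |det a| <= (T + C1)^n; and 2 C (1 + C1) bounds s. *)
pose C1 := (n * C)%N; pose B := (C1 + 2 * C * (1 + C1) + 1)%N.
exists B => [|T le_BT]; first by rewrite /B addn1.
have T_gt0 : (0 : R) < T%:R by rewrite ltr0n; apply: leq_trans le_BT; rewrite /B addn1.
have Ti_ge0 : (0 : R) <= T%:R^-1 by rewrite invr_ge0 ler0n.
pose a := map_mx (fun x => Num.floor (T%:R * x)) A.
pose E := T%:R *: A - map_mx intr a.
have E_le i j : `|E i j| <= 1.
  rewrite !mxE; have /andP[le1 le2] := floor_itv (T%:R * A i j).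
  by rewrite ger0_norm ?subr_ge0 // lerBlDr addrC ltW //; move: le2; rewrite rmorphD.
have Da : map_mx intr a = T%:R *: A - E by rewrite /E opprB addrC subrK.
have det_a : `|\det (map_mx intr a : 'M[R]_n)| <= (T + C1)%:R ^+ n.
  have -> : map_mx intr a = T%:R *: (A *m (1%:M - T%:R^-1 *: (invmx A *m E))).
    rewrite Da mulmxBr mulmx1 -scalemxAr mulKVmx // scalerBr scalerA mulfV ?scale1r //.
    by rewrite gt_eqF.
  rewrite detZ det_mulmx normrM normrX normr_nat normrM.
  apply: le_trans (_ : T%:R ^+ n * (1 * (1 + C1%:R / T%:R) ^+ n) <= _); last first.
    by rewrite mul1r -exprMn mulrDr mulr1 mulrCA mulfV ?gt_eqF // mulr1 -natrD.
  rewrite ler_wpM2l ?exprn_ge0 ?ler0n // ler_pM //.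
  apply: le_trans (ler_det_prod _) _; rewrite -[X in _ <= _ ^+ X]card_ord -prodr_const.
  apply: ler_prod => i _; rewrite sumr_ge0 //=.
  apply: le_trans (_ : \sum_j ((i == j)%:R + T%:R^-1 * C%:R) <= _).
    apply: ler_sum => j _; rewrite !mxE; apply: le_trans (ler_normB _ _) _.
    rewrite normr_nat lerD // normrM (ger0_norm Ti_ge0) ler_wpM2l //.
    apply: le_trans (ler_norm_sum _ _ _) _; apply: le_trans (row_le i).
    by apply: ler_sum => k _; rewrite normrM ler_piMr.
  rewrite big_split /= sumr_const card_ord (bigD1 i) //= eqxx big1 => [|j]; last first.
    by rewrite eq_sym => /negPf->.
  by rewrite addr0 lerD // -mulrnAr -mulrnA mulrC /C1 mulnC.
have [|c c0 ac] := @int_mx_pigeonhole n a (T + C1).+1.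
  rewrite -(ltr_nat R) natrX; apply: le_lt_trans (_ : (T + C1)%:R ^+ n < _).
    by move: det_a; rewrite det_map_mx natr_absz intr_norm.
  by rewrite ltrXn2r ?gtn_eqF ?ler0n ?ltr_nat // -lt0n.
exists c => //; pose cR : 'cV[R]_n := map_mx intr c.
pose s := \sum_i `|cR i 0|.
have s_ge0 : 0 <= s by apply: sumr_ge0.
have v_le i : `|(A *m cR) i 0| <= ((T + C1)%:R + s) / T%:R.
  rewrite ler_pdivlMr // mulrC -{1}[T%:R](ger0_norm (ler0n R T)) -normrM.
  have -> : T%:R * (A *m cR) i 0 = (map_mx intr (a *m c) : 'cV[R]_n) i 0 + (E *m cR) i 0.
    rewrite map_mxM Da mulmxBl -scalemxAl; move: (A *m cR) (E *m cR) => X Y.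
    by rewrite !mxE subrK.
  apply: le_trans (ler_normD _ _) _; rewrite lerD //.
    by rewrite mxE -intr_norm -natr_absz ler_nat -ltnS.
  rewrite mxE; apply: le_trans (ler_norm_sum _ _ _) _; apply: ler_sum => k _.
  by rewrite normrM ler_piMl.
have s_le : s <= (2 * C * (1 + C1))%:R.
  have cs : s <= C%:R * (((T + C1)%:R + s) / T%:R).
    apply: le_trans (_ : S * (((T + C1)%:R + s) / T%:R) <= _); last first.
      by rewrite ler_wpM2r // divr_ge0 // addr_ge0.
    rewrite /S mulr_suml; apply: ler_sum => i _.
    rewrite -[cR](mulKmx uA); exact: mulmx_norm_le.
  have {}cs : s * T%:R <= C%:R * (T + C1)%:R + C%:R * s.
    by rewrite -ler_pdivlMr // -mulrDr -mulrA.
  have T2C : 2 * C%:R <= T%:R :> R.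
    rewrite -natrM ler_nat; apply: leq_trans le_BT; rewrite /B mulnDr muln1.
    by apply: leq_trans (leq_addr 1 _); apply: leq_trans (leq_addl C1 _); apply: leq_addr.
  have T1 : 1 <= T%:R :> R by rewrite ler1n -(ltr0n R).
  have C_ge0 : 0 <= C%:R :> R by [].
  have C1_ge0 : 0 <= C1%:R :> R by [].
  by rewrite !natrM natrD; apply: (linear_absorb _ T_gt0) => //; rewrite -natrD.
have sB : (T + C1)%:R + s <= T%:R + B%:R.
  rewrite /B !natrD -addrA lerD2l -addrA lerD2l; apply: le_trans s_le _.
  by rewrite lerDl.
split=> i.
  rewrite -(ler_nat R) natr_absz intr_norm; apply: le_trans (_ : s <= _).
    by rewrite /s (bigD1 i) //= mxE lerDl sumr_ge0.
  apply: le_trans s_le _; rewrite ler_nat.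
  exact: leq_trans (leq_addl C1 _) (leq_addr 1 _).
apply: le_trans (v_le i) _; rewrite ler_pdivrMr // mulrDl mul1r divfK //.
by rewrite gt_eqF.
Qed.

(** Compactness in finite form: the approximate solutions lie in a box of radius B independent of T.
    If each of its finitely many nonzero points violated the bound, each would do so by a definite
    margin, and a T beyond all the resulting thresholds is impossible. *)
Theorem minkowski_linear_forms n (A : 'M[R]_n) : (0 < n)%N -> \det A != 0 -> `|\det A| <= 1 ->
  exists2 c : 'cV[int]_n, c != 0 & forall i, `|(A *m map_mx intr c) i 0| <= 1.
Proof.
move=> n_gt0 detA0 detA1; have [B B_gt0 approx] := minkowski_approx n_gt0 detA0 detA1.
apply: contrapT => no_c.
pose vec (f : {ffun 'I_n -> 'I_(2 * B).+1}) : 'cV[int]_n := \col_i ((f i : nat)%:Z - B%:Z).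
have big_c (c : 'cV[int]_n) : c != 0 -> exists i, 1 < `|(A *m map_mx intr c) i 0|.
  move=> c0; apply: contrapT => no_i; apply: no_c; exists c => // i.
  by rewrite leNgt; apply/negP => lt_i; apply: no_i; exists i.
have /choice[t tP] : forall f, exists t : nat, vec f != 0 -> forall T : nat, (t <= T)%N -> (0 < T)%N ->
    exists i, 1 + B%:R / T%:R < `|(A *m map_mx intr (vec f)) i 0|.
  move=> f; have [->|f0] := eqVneq (vec f) 0; first by exists 0%N.
  have [i lt_i] := big_c _ f0; set x := `|_| in lt_i.
  exists (Num.bound (B%:R / (x - 1))) => _ T le_T T_gt0; exists i.
  have x1 : 0 < x - 1 by rewrite subr_gt0.
  have TR : (0 : R) < T%:R by rewrite ltr0n.
  rewrite -/x -ltrBrDl ltr_pdivrMr // mulrC -ltr_pdivrMr //.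
  apply: lt_le_trans (archi_boundP _) _; first by rewrite divr_ge0 // ltW.
  by rewrite ler_nat.
pose T := (B + \sum_f t f)%N.
have [c c0 [cB cA]] := approx T (leq_addr _ _).
pose f : {ffun 'I_n -> 'I_(2 * B).+1} := [ffun i => inord `|(c i 0 + B%:Z)%R|%N].
have Dc : c = vec f.
  apply/colP => i; rewrite mxE ffunE; have := cB i; move: (c i _) => z zB.
  rewrite inordK; first by lia.
  by lia.
have f0 : vec f != 0 by rewrite -Dc.
have [||i] := tP f f0 T; last by rewrite -Dc ltNge cA.
- by rewrite /T (bigD1 f) //= addnCA leq_addr.
- by rewrite addn_gt0 B_gt0.
Qed.

End Minkowski.

(** The matrix determinant lemma, from two triangular factorisations of one block matrix. *)
Lemma det_rank1 (F : comNzRingType) n (u : 'cV[F]_n) (v : 'rV[F]_n) :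
  \det (1%:M + u *m v) = 1 + (v *m u) 0 0.
Proof.
transitivity (\det (block_mx (1%:M : 'M[F]_1) (- v) u 1%:M)).
  have -> : block_mx (1%:M : 'M[F]_1) (- v) u 1%:M =
      block_mx 1%:M 0 u 1%:M *m block_mx 1%:M (- v) 0 (1%:M + u *m v).
    rewrite mulmx_block !(mul1mx, mulmx1, mul0mx, mulmx0, addr0, mulmxN).
    by rewrite [in RHS]addrCA addNr addr0.
  by rewrite det_mulmx det_lblock det_ublock !det1 !mul1r.
have -> : block_mx (1%:M : 'M[F]_1) (- v) u 1%:M =
    block_mx (1%:M + v *m u) (- v) 0 1%:M *m block_mx 1%:M 0 u 1%:M.
  rewrite mulmx_block !(mul1mx, mulmx1, mul0mx, mulmx0, addr0, add0r, mulNmx).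
  by rewrite addrK.
by rewrite det_mulmx det_lblock det_ublock !det1 !mulr1 det_mx11 !mxE.
Qed.

(** * Integral bases, Gram determinants and divisibility of the trace form *)

Section IntegralBasis.
Variable L : galois_field.
Local Notation G := (gf_group L).
Local Notation act := (@gf_act L).
Local Notation iota := (@gf_emb L).
Local Notation l := #|G|.

Definition conj_mx (b : 'I_l -> L) : 'M[algC]_l := \matrix_(i, j) iota (act (enum_val i) (b j)).

Definition gram_mx (b : 'I_l -> L) : 'M[algC]_l := \matrix_(i, j) iota (gtr (b i * b j)).

Lemma sum_enum_val (R : nmodType) (F : G -> R) : \sum_(i < l) F (enum_val i) = \sum_g F g.
Proof.
rewrite [RHS](reindex (enum_val : 'I_l -> G)) //=.
by exists enum_rank => g _; rewrite ?enum_valK ?enum_rankK.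
Qed.

Lemma gram_mxE b : gram_mx b = (conj_mx b)^T *m conj_mx b.
Proof.
apply/matrixP => i j; rewrite !mxE /gtr -sum_enum_val rmorph_sum.
by apply: eq_bigr => k _; rewrite !mxE rmorphM rmorphM.
Qed.

Lemma det_gram b : \det (gram_mx b) = \det (conj_mx b) ^+ 2.
Proof. by rewrite gram_mxE det_mulmx det_tr. Qed.

Definition integral_family (b : 'I_l -> L) := forall j, iota (b j) \in Aint.

Lemma Aint_act g (x : L) : iota x \in Aint -> iota (act g x) \in Aint.
Proof. by have [nu <-] := gf_extend g; rewrite Aint_aut. Qed.

Lemma gtr_int (x : L) : iota x \in Aint -> iota (gtr x) \in Num.int.
Proof.
move=> Ax; apply: Cint_rat_Aint; first exact: gtr_rat.
by rewrite rmorph_sum rpred_sum // => g _; apply: Aint_act.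
Qed.

Lemma gram_int b : integral_family b -> exists M : 'M[int]_l, gram_mx b = map_mx intr M.
Proof.
move=> Ab; have /choice[f fP] : forall ij : 'I_l * 'I_l, exists a : int, gram_mx b ij.1 ij.2 = a%:~R.
  by move=> [i j]; rewrite mxE; apply/intrP/gtr_int; rewrite rmorphM rpredM ?Ab.
by exists (\matrix_(i, j) f (i, j)); apply/matrixP => i j; rewrite (fP (i, j)) !mxE.
Qed.

Lemma integral_family_exists : exists2 b, integral_family b & \det (conj_mx b) != 0.
Proof.
have [b0 det_b0] := gf_basis L.
have /choice[m mP] : forall j, exists m : nat, (0 < m)%N /\ m%:R * iota (b0 j) \in Aint.
  by move=> j; have [m m0 Am] := Aint_scale (iota (b0 j)); exists m.
exists (fun j => (m j)%:R * b0 j) => [j|].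
  by rewrite rmorphM rmorph_nat; have [] := mP j.
have -> : conj_mx (fun j => (m j)%:R * b0 j) =
    map_mx iota (\matrix_(i, j) act (enum_val i) (b0 j)) *m diag_mx (\row_j (m j)%:R).
  apply/matrixP => i j; rewrite mul_mx_diag !mxE !rmorphM !rmorph_nat mulrC.
  by [].
rewrite det_mulmx det_map_mx det_diag mulf_neq0 ?fmorph_eq0 //.
by apply/prodf_neq0 => j _; rewrite mxE pnatr_eq0 -lt0n; have [] := mP j.
Qed.

(** The coordinates solve a linear system with the traces tr(b_i b_j) and tr(b_i y) as data, all
    rational. *)
Lemma rational_coordinates b y : \det (conj_mx b) != 0 ->
  exists c : 'I_l -> rat, forall g, iota (act g y) = \sum_j ratr (c j) * iota (act g (b j)).
Proof.
move=> det_b; have det_G : \det (gram_mx b) != 0 by rewrite det_gram expf_neq0.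
have /choice[f fP] : forall ij : 'I_l * 'I_l, exists a : rat, iota (gtr (b ij.1 * b ij.2)) = ratr a.
  by move=> ij; apply/CratP/gtr_rat.
have /choice[h hP] : forall i, exists a : rat, iota (gtr (b i * y)) = ratr a.
  by move=> i; apply/CratP/gtr_rat.
pose M : 'M[rat]_l := \matrix_(i, j) f (i, j); pose v : 'cV[rat]_l := \col_i h i.
have DG : gram_mx b = map_mx ratr M by apply/matrixP => i j; rewrite !mxE (fP (i, j)).
pose w : 'cV[algC]_l := \col_i iota (act (enum_val i) y).
have Dv : map_mx ratr v = (conj_mx b)^T *m w.
  apply/colP => i; rewrite !mxE -hP /gtr -sum_enum_val rmorph_sum.
  by apply: eq_bigr => k _; rewrite !mxE !rmorphM.
have uM : M \in unitmx.
  by rewrite -(map_unitmx (ratr : {rmorphism rat -> algC})) -DG unitmxE unitfE.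
pose c := invmx M *m v.
exists (fun j => c j 0) => g.
have Dw : w = conj_mx b *m map_mx ratr c.
  have uW : (conj_mx b)^T \in unitmx by rewrite unitmx_tr unitmxE unitfE.
  apply: (can_inj (mulKmx uW)); rewrite mulmxA -gram_mxE DG -map_mxM mulKVmx //.
have /colP/(_ (enum_rank g)) := Dw; rewrite !mxE enum_rankK => ->.
by apply: eq_bigr => j _; rewrite !mxE enum_rankK mulrC.
Qed.

(** An integral family with minimal nonzero |Gram determinant|. If an integer y had a coordinate q_j
    outside Z, replacing b_j by y - floor(q_j) b_j would multiply this determinant by the square of
    the fractional part of q_j. *)
Lemma integral_basis_exists : exists b, [/\ integral_family b, \det (conj_mx b) != 0 &
  forall y : L, iota y \in Aint ->
    exists c : 'I_l -> int, forall g, iota (act g y) = \sum_j (c j)%:~R * iota (act g (b j))].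
Proof.
pose P m := exists b, [/\ integral_family b, \det (conj_mx b) != 0 & `|\det (gram_mx b)| = m%:R].
have [m [b [Ab det_b Dm]] min_m] : exists2 m, P m & forall k, P k -> (m <= k)%N.
  have [b Ab det_b] := integral_family_exists.
  have exP : exists m, `[< P m >].
    have [M DM] := gram_int Ab; exists `|(\det M)%R|%N; apply/asboolP; exists b; split=> //.
    by rewrite DM det_map_mx -intr_norm natr_absz.
  case: (ex_minnP exP) => m /asboolP Pm min_m; exists m => // k Pk.
  by apply/min_m/asboolP.
exists b; split=> // y Ay; have [q Dq] := rational_coordinates y det_b.
suff q_int j : ratr (q j) \in (Num.int : qualifier 1 algC).
  have /choice[c cP] : forall j, exists a : int, ratr (q j) = a%:~R :> algC.
    by move=> j; apply/intrP.
  by exists c => g; rewrite Dq; apply: eq_bigr => j _; rewrite cP.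
apply: contrapT => nint.
pose k := Num.floor (q j); pose f := q j - k%:~R.
have f_gt0 : 0 < f.
  rewrite lt_def subr_ge0 floor_le ?num_real // andbT subr_eq0.
  by apply: contra_notN nint => /eqP->; rewrite ratr_int intr_int.
have f_lt1 : f < 1 by rewrite ltrBlDl; have := real_floorD1_gt (num_real (q j)); rewrite rmorphD.
pose b' i := if i == j then y - k%:~R * b j else b i.
have Ab' : integral_family b'.
  move=> i; rewrite /b'; case: eqP => // _.
  by rewrite rmorphB rmorphM rmorph_int rpredB ?rpredM ?Aint_int.
(* The change of family is the identity plus u in column j; its determinant is 1 + u_j = f, whence
   the summand 1 next to k. *)
pose u : 'cV[algC]_l := \col_i (ratr (q i) - (i == j)%:R * (k%:~R + 1)).
have DW : conj_mx b' = conj_mx b *m (1%:M + u *m delta_mx 0 j).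
  apply/matrixP => a i; rewrite mulmxDr mulmx1 mulmxA.
  have -> : conj_mx b *m u *m (delta_mx 0 j : 'rV_l) = \matrix_(s, t) ((conj_mx b *m u) s 0 *+ (t == j)).
    by apply/matrixP => s t; rewrite [in RHS]mxE mxE big_ord1 [delta_mx _ _ _ _]mxE eqxx mulr_natr.
  rewrite [RHS]mxE [conj_mx b' a i]mxE [X in _ = _ + X]mxE /b'; case: eqP => [->|_]; last first.
    by rewrite mxE addr0.
  rewrite mulr1n [(_ *m u) _ _]mxE (bigD1 j) //= ![conj_mx _ _ _]mxE [u _ _]mxE eqxx mul1r.
  rewrite !rmorphB !rmorphM !rmorph_int /= Dq (bigD1 j) //=.
  rewrite [X in _ = _ + (_ + X)](eq_bigr (fun i => ratr (q i) * iota (act (enum_val a) (b i)))); first by ring.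
  by move=> s /negPf sj; rewrite !mxE sj mul0r subr0 mulrC.
have detW : \det (conj_mx b') = \det (conj_mx b) * ratr f.
  rewrite DW det_mulmx det_rank1; congr (_ * _).
  rewrite mxE (bigD1 j) //= big1 ?addr0 => [|i ij]; last by rewrite mxE (negPf ij) andbF mul0r.
  by rewrite !mxE !eqxx !mul1r rmorphB rmorph_int; ring.
have rf_gt0 : 0 < ratr f :> algC by rewrite ltr0q.
have [M DM] := gram_int Ab'.
have : P `|(\det M)%R|%N.
  exists b'; split=> //; first by rewrite detW mulf_neq0 // gt_eqF.
  by rewrite DM det_map_mx -intr_norm natr_absz.
move/min_m; apply/negP; rewrite -ltnNge -(ltr_nat algC) -Dm natr_absz intr_norm -det_map_mx -DM.
rewrite !det_gram detW !normrX normrM exprMn (gtr0_norm rf_gt0).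
rewrite -[X in _ < X]mulr1 ltr_pM2l ?exprn_gt0 ?normr_gt0 //.
by rewrite exprn_ilt1 ?(ltW rf_gt0) // -(rmorph1 (@ratr algC)) ltr_rat.
Qed.

End IntegralBasis.

Lemma prime_list_dvd (ps : seq nat) (z : int) : uniq ps -> (forall p, p \in ps -> prime p) ->
  (forall p, p \in ps -> (p%:Z %| z)%Z) -> ((\prod_(p <- ps) p)%N%:Z %| z)%Z.
Proof.
elim: ps => [|p ps IHps] /=; first by rewrite big_nil dvd1z.
move=> /andP[p_ps uniq_ps] ps_pr ps_z; rewrite big_cons dvdzE /=.
rewrite Gauss_dvd; last first.
  rewrite prime_coprime ?ps_pr ?mem_head //; apply/negP.
  rewrite big_seq Euclid_dvd_prod ?ps_pr ?mem_head // big_has_cond => /hasP[q psq /andP[_]].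
  rewrite dvdn_prime2 ?ps_pr ?mem_head // ?inE ?psq ?orbT // => /eqP pq.
  by rewrite pq psq in p_ps.
have := ps_z p (mem_head _ _); rewrite dvdzE /= => -> /=.
have := IHps uniq_ps; rewrite dvdzE; apply => q psq; [apply: ps_pr | apply: ps_z];
  by rewrite inE psq orbT.
Qed.

(** At an inertial p the trace of z is congruent to l z, so l tr(x y) = tr(x) tr(y) modulo p. Since
    l m = -1 modulo p, the left-hand side multiplied by l vanishes modulo p, and l is prime to p. *)
Lemma trace_form_divisible (L : galois_field) (ps : seq nat) (N m : int) (x y : L) :
  uniq ps -> (forall p, p \in ps -> prime p /\ inertial L p) ->
  `|N|%N = (\prod_(p <- ps) p)%N -> N = 1 + #|gf_group L|%:Z * m ->
  gf_emb L x \in Aint -> gf_emb L y \in Aint ->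
  exists a : int,
    gf_emb L (gtr (x * y)) + m%:~R * (gf_emb L (gtr x) * gf_emb L (gtr y)) = N%:~R * a%:~R.
Proof.
set l := #|_|; set iota := @gf_emb L.
move=> uniq_ps psP absN DN Ax Ay; have /intrP[a Da] := gtr_int Ax; have /intrP[b Db] := gtr_int Ay.
have Axy : iota (x * y) \in Aint by rewrite rmorphM rpredM.
have /intrP[c Dc] := gtr_int Axy.
have /dvdzP[d Dd] : (N %| c + m * (a * b))%Z.
  rewrite dvdzE absN; apply: (@prime_list_dvd _ (c + m * (a * b))) => // p psp; first by have [] := psP p psp.
  have [p_pr p_in] := psP p psp.
  have pN : (p%:Z %| N)%Z by rewrite dvdzE absN /= (big_rem p psp) /= dvdn_mulr.
  have p_l : ~~ (p %| l)%N.
    apply/negP => p_l; have : (p%:Z %| N - l%:Z * m)%Z by rewrite rpredB // dvdz_mulr.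
    by rewrite DN addrK dvdz1 /= => /eqP p1; rewrite p1 in p_pr.
  have cong1 : pcong p (iota (gtr (x * y)) *+ l) (iota (gtr x) * iota (gtr y)).
    have Rx : ploc p (iota x) by apply: ploc_Aint.
    have Ry : ploc p (iota y) by apply: ploc_Aint.
    have Rxy : ploc p (iota (x * y)) by apply: ploc_Aint.
    apply: (@pcong_trans p p_pr _ (iota (x * y) *+ l *+ l)).
      rewrite -(mulr_natr (iota (gtr (x * y)))) -(mulr_natr (iota (x * y) *+ l)); apply: pcongM => //; [|exact: ploc_nat| |exact: pcong_refl].
        exact: ploc_gtr.
      exact: inertial_gtr.
    have -> : iota (x * y) *+ l *+ l = (iota x *+ l) * (iota y *+ l).
      by rewrite rmorphM mulrnAr mulrnAl.
    apply/pcong_sym => //; apply: pcongM; [exact: p_pr|exact: ploc_gtr| |exact: inertial_gtr|exact: inertial_gtr].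
    by rewrite -mulr_natr; apply: plocM => //; apply: ploc_nat.
  have : (p%:Z %| l%:Z * c - a * b)%Z.
    apply: (pnil_int p_pr); move: cong1; rewrite /pcong /iota Da Db Dc; congr pnil.
    by rewrite rmorphB !rmorphM /= -mulr_natl.
  move=> p_lc; have p_lz : (p%:Z %| l%:Z * (c + m * (a * b)))%Z.
    have -> : l%:Z * (c + m * (a * b)) = (l%:Z * c - a * b) + N * (a * b).
      by rewrite DN; ring.
    by rewrite rpredD // dvdz_mulr.
  move: p_lz; rewrite !dvdzE abszM /= Euclid_dvdM // => /orP[pl|//].
  by rewrite pl in p_l.
exists d; rewrite /iota Da Db Dc [RHS]mulrC -[RHS]rmorphM -Dd.
by rewrite rmorphD !rmorphM.
Qed.

(** * Realising the period vector by conjugates of an element of L *)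

Section MainConstruction.
Variable L : galois_field.
Local Notation G := (gf_group L).
Local Notation act := (@gf_act L).
Local Notation iota := (@gf_emb L).
Local Notation l := #|G|.
Variable ps : seq nat.
Hypothesis uniq_ps : uniq ps.
Hypothesis psP : forall p, p \in ps -> [/\ prime p, inertial L p & ~~ (p %| l)%N].
Local Notation N := (\prod_(p <- ps) p)%N.
Hypothesis dvdN : (l %| N.-1)%N.
Hypothesis N_gt0 : (0 < N)%N.
Local Notation m := (N.-1 %/ l)%N.

Lemma NmE : N%:R = 1 + l%:R * m%:R :> algC.
Proof. by rewrite -natrM mulnC divnK // -[in LHS](prednK N_gt0) -natr1 addrC. Qed.

Lemma period_trace_divisible (x y : L) : iota x \in Aint -> iota y \in Aint ->
  exists a : int, iota (gtr (x * y)) + m%:R * (iota (gtr x) * iota (gtr y)) = N%:R * a%:~R.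
Proof.
move=> Ax Ay; apply: (@trace_form_divisible L ps N%:Z m%:Z) => //.
  by move=> p /psP[].
by rewrite -PoszM mulnC divnK // -[in LHS](prednK N_gt0) intS.
Qed.

Variable f : G -> algC.
Hypothesis corr_f : forall k, gcorr f k = (if k == 1%g then N%:R else 0) - m%:R.

(** The group matrix of f, arranged to carry the conjugates of x to the values Psi(g x)
    ([period_mx_mul]). *)
Definition period_mx : 'M[algC]_l := \matrix_(i, k) f (enum_val k * (enum_val i)^-1)%g.

Lemma period_mx_gram : period_mx *m period_mx^T = N%:R%:M - m%:R *: const_mx 1.
Proof.
apply/matrixP => i j; rewrite !mxE mulr1.
have -> : N%:R *+ (i == j) = (if (enum_val i * (enum_val j)^-1)%g == 1%g then N%:R else 0) :> algC.
  by rewrite -eq_mulgV1 (inj_eq enum_val_inj); case: eqP.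
rewrite -corr_f /gcorr (reindex_inj (mulIg (enum_val i)^-1%g)) /= -sum_enum_val.
by apply: eq_bigr => k _; rewrite !mxE mulgA mulgKV.
Qed.

(** With E the all-ones matrix, (1 + m E)(N - m E) = N because E^2 = l E and N = 1 + l m. *)
Lemma det_period_mx : \det (1%:M + m%:R *: const_mx 1 : 'M[algC]_l) * \det period_mx ^+ 2 = N%:R ^+ l.
Proof.
rewrite expr2 -{2}(det_tr period_mx) -(det_mulmx period_mx) period_mx_gram -det_mulmx.
transitivity (\det (N%:R%:M : 'M[algC]_l)); last by rewrite det_scalar.
congr (\det _); have EE : (const_mx 1 : 'M[algC]_l) *m (const_mx 1 : 'M[algC]_l) = l%:R *: const_mx 1.
  apply/matrixP => i j; rewrite !mxE (eq_bigr (fun=> 1)) => [|k _]; last by rewrite !mxE mulr1.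
  by rewrite sumr_const card_ord mulr1.
rewrite mulmxDl mul1mx -scalemxAl mulmxBr -scalemxAr EE mul_mx_scalar NmE.
move: (const_mx 1) => E; apply/matrixP => i j; rewrite !mxE.
move: (E i j) (m%:R : algC) (l%:R : algC) => e a b.
by case: (i == j); rewrite ?mulr1n ?mulr0n; ring.
Qed.

(** The Gram matrix of tr(x y) + m tr(x) tr(y) is W^T (1 + m E) W, with W the conjugate matrix and E
    all ones, and it is divisible by N entrywise. Taking determinants and eliminating det(1 + m E)
    by [det_period_mx] leaves the integer k. This is the comparison that makes Minkowski's theorem
    applicable. *)
Lemma det_period_le (b : 'I_l -> L) : integral_family b -> \det (conj_mx b) != 0 ->
  exists2 k : int, k != 0 & k%:~R * \det period_mx ^+ 2 = \det (gram_mx b).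
Proof.
move=> Ab det_b.
have /choice[h hP] : forall ij : 'I_l * 'I_l, exists a : int,
    iota (gtr (b ij.1 * b ij.2)) + m%:R * (iota (gtr (b ij.1)) * iota (gtr (b ij.2))) = N%:R * a%:~R.
  by move=> ij; apply: period_trace_divisible.
pose B : 'M[int]_l := \matrix_(i, j) h (i, j).
have N0 : (N%:R : algC) != 0 by rewrite pnatr_eq0 -lt0n.
have DB : N%:R *: map_mx intr B = (conj_mx b)^T *m (1%:M + m%:R *: const_mx 1) *m conj_mx b.
  have -> : (conj_mx b)^T *m (1%:M + m%:R *: const_mx 1) *m conj_mx b =
      gram_mx b + m%:R *: ((conj_mx b)^T *m const_mx 1 *m conj_mx b).
    by rewrite mulmxDr mulmx1 mulmxDl -gram_mxE -scalemxAr -scalemxAl.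
  apply/matrixP => i j; rewrite [LHS]mxE [(map_mx _ _) _ _]mxE [B _ _]mxE -(hP (i, j)) /=.
  rewrite [RHS]mxE [gram_mx _ _ _]mxE; congr (_ + _); rewrite [RHS]mxE; congr (_ * _).
  rewrite mxE.
  have trE k : iota (gtr (b k)) = \sum_s conj_mx b s k.
    by rewrite /gtr -sum_enum_val rmorph_sum; apply: eq_bigr => s _; rewrite mxE.
  rewrite !trE mulr_sumr; apply: eq_bigr => t _; congr (_ * _).
  by rewrite mxE; apply: eq_bigr => s _; rewrite !mxE mulr1.
have detB : (\det B)%:~R * \det period_mx ^+ 2 = \det (gram_mx b).
  have := congr1 (fun X => \det X) DB; rewrite /= detZ det_map_mx !det_mulmx det_tr.
  move=> DdetB; apply: (mulfI (expf_neq0 l N0)); rewrite mulrA DdetB det_gram.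
  by rewrite -det_period_mx; ring.
exists (\det B) => //.
apply: contra_eq_neq detB => ->; rewrite mul0r eq_sym det_gram expf_neq0 //.
Qed.

Hypothesis l_odd : odd l.
Hypothesis f_Aint : forall g, f g \in Aint.
Hypothesis f_aut : forall nu : {rmorphism algC -> algC}, exists a, forall h, nu (f h) = f (a * h)%g.
Hypothesis f_conj : forall g, (f g)^* = f g.
Hypothesis f_loc : forall x, trace_dual x -> forall p, p \in ps -> ploc p (gform f x).
Hypothesis unramified : forall p, prime p -> p \notin ps -> ~ inertial L p.

(** At a prime outside [ps] the dual lattice is already p-local by [noninertial_trace_dual]; the
    other primes are covered by the construction of f. *)
Lemma gform_Aint x : trace_dual x -> gform f x \in Aint.
Proof.
move=> dual_x; apply: ploc_all_Aint => p p_pr.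
have [psp|/(unramified p_pr) nin] := boolP (p \in ps); first exact: f_loc.
have Rx : ploc p (iota x).
  apply: noninertial_trace_dual => // y [k pk Aky].
  exists k => //; apply: Aint_Cint.
  have Akyi : iota (k%:R * y) \in Aint by rewrite rmorphM rmorph_nat.
  have Qk : iota (k%:R : L) \in Crat by rewrite rmorph_nat rpred_nat.
  have -> : k%:R * iota (gtr (x * y)) = iota (gtr (x * (k%:R * y))).
    by rewrite (mulrCA x) (gtrZ _ Qk) rmorphM rmorph_nat.
  exact: dual_x.
apply: ploc_sum => // g _; apply: plocM => //; first exact: ploc_act.
exact: ploc_Aint.
Qed.

(** nu acts on L as some k in G and on f as a shift by some a; reindexing the sum gives t = k
    a^(-1). *)
Lemma gform_aut (nu : {rmorphism algC -> algC}) : exists t,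
  forall x, nu (gform f x) = gform f (act t x).
Proof.
have [k kP] := @gf_restrict L nu.
have [a aP] := f_aut nu; exists (k * a^-1)%g => x.
rewrite rmorph_sum /gform [RHS](reindex_inj (mulgI a)) /=; apply: eq_bigr => h _.
rewrite rmorphM /= kP aP -!gf_actM; congr (iota (act _ x) * _).
by rewrite [(k * a^-1)%g]gmulC [(a * h)%g]gmulC -mulgA mulKVg gmulC.
Qed.

(** Complex conjugation restricts to an element of G of square 1, which is trivial in a group of odd
    order. *)
Lemma emb_conj x : (iota x)^* = iota x.
Proof.
have [g gP] := @gf_restrict L (Num.conj_op : {rmorphism algC -> algC}).
have gg : (g * g)%g = 1%g.
  apply/eqP; apply: contrapT => /negP/gf_faithful[y /eqP]; apply; apply: (@emb_inj L).
  by rewrite gf_actM -!gP; apply: conjCK.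
suff g1 : g = 1%g by have := gP x; rewrite g1 act1.
have : (g ^+ l)%g = 1%g by apply/eqP; rewrite -order_dvdn -cardsT order_dvdG ?inE.
by rewrite -(odd_double_half l) l_odd -mul2n expgD expg1 expgM expgS expg1 gg expg1n mulg1.
Qed.

Lemma gform_real x : gform f x \is Num.real.
Proof.
apply/CrealP; rewrite rmorph_sum; apply: eq_bigr => g _.
by rewrite rmorphM /= f_conj emb_conj.
Qed.

Lemma period_mx_mul x :
  period_mx *m (\col_k iota (act (enum_val k) x)) = \col_i gform f (act (enum_val i) x).
Proof.
apply/colP => i; rewrite !mxE /gform.
rewrite [RHS](reindex_inj (mulIg (enum_val i)^-1%g)) /= -sum_enum_val.
apply: eq_bigr => k _; rewrite !mxE mulrC; congr (iota _ * _).
by rewrite -gf_actM mulgKV.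
Qed.

Variable b : 'I_l -> L.
Hypotheses (b_Aint : integral_family b) (det_b : \det (conj_mx b) != 0).
Hypothesis b_basis : forall y : L, iota y \in Aint ->
  exists c : 'I_l -> int, forall g, iota (act g y) = \sum_j (c j)%:~R * iota (act g (b j)).

Let det_G : \det (gram_mx b) != 0.
Proof. by rewrite det_gram expf_neq0. Qed.

Lemma rat_gram : exists2 M : 'M[rat]_l, gram_mx b = map_mx ratr M & M \in unitmx.
Proof.
have [M DM] := gram_int b_Aint.
have DG : gram_mx b = map_mx ratr (map_mx intr M : 'M[rat]_l).
  by rewrite DM -map_mx_comp; apply: eq_map_mx => a /=; rewrite ratr_int.
exists (map_mx intr M) => //.
by rewrite -(map_unitmx (ratr : {rmorphism rat -> algC})) -DG unitmxE unitfE.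
Qed.

Lemma exists_with_traces (q : 'cV[rat]_l) : exists x : L,
  (\col_k iota (act (enum_val k) x)) = conj_mx b *m (invmx (gram_mx b) *m map_mx ratr q).
Proof.
have [M DG uM] := rat_gram; pose d := invmx M *m q.
exists (\sum_k ratr (d k 0) * b k).
have -> : invmx (gram_mx b) *m map_mx ratr q = map_mx ratr d by rewrite DG map_mxM map_invmx.
apply/colP => i; rewrite !mxE !rmorph_sum; apply: eq_bigr => k _.
by rewrite (rmorphM (act _)) (rmorphM iota) !fmorph_rat mulrC !mxE.
Qed.

Lemma det_period_neq0 : \det period_mx != 0.
Proof.
have [k _ Dk] := det_period_le b_Aint det_b.
by apply: contra_neq det_G => d0; rewrite -Dk d0 expr0n mulr0.
Qed.

Lemma gform_vanish x : (forall g, gform f (act g x) = 0) -> x = 0.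
Proof.
move=> f0; have uP : period_mx \in unitmx by rewrite unitmxE unitfE det_period_neq0.
have : (\col_(k < l) iota (act (enum_val k) x)) = 0.
  apply: (can_inj (mulKmx uP)); rewrite period_mx_mul mulmx0.
  by apply/colP => i; rewrite !mxE.
move=> /colP/(_ (enum_rank 1%g)); rewrite !mxE enum_rankK act1 => /eqP.
by rewrite fmorph_eq0 => /eqP.
Qed.

Lemma trace_vector x : (conj_mx b)^T *m (\col_k iota (act (enum_val k) x)) = \col_j iota (gtr (x * b j)).
Proof.
apply/colP => j; rewrite !mxE /gtr -sum_enum_val rmorph_sum.
by apply: eq_bigr => k _; rewrite !mxE !rmorphM mulrC.
Qed.

(** The integers c_j = tr(x b_j) are coordinates on the dual lattice; x is recovered from them by
    the inverse Gram matrix. *)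
Lemma exists_dual (c : 'cV[int]_l) : exists x : L, [/\ trace_dual x, (x = 0 -> c = 0) &
  (\col_k iota (act (enum_val k) x)) = conj_mx b *m (invmx (gram_mx b) *m map_mx intr c)].
Proof.
have [x Dx] := exists_with_traces (map_mx intr c).
have {}Dx : (\col_k iota (act (enum_val k) x)) = conj_mx b *m (invmx (gram_mx b) *m map_mx intr c).
  rewrite Dx -map_mx_comp; congr (_ *m (_ *m _)).
  by apply: eq_map_mx => a /=; rewrite ratr_int.
have uG : gram_mx b \in unitmx by rewrite unitmxE unitfE.
have := trace_vector x; rewrite Dx mulmxA -gram_mxE mulKVmx // => Dc.
have {}Dc j : iota (gtr (x * b j)) = (c j 0)%:~R.
  by have /colP/(_ j) := Dc; rewrite !mxE.
exists x; split=> // [y Ay|x0].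
  have [d /(_ 1%g)] := b_basis Ay; rewrite act1 => Dy.
  have -> : y = \sum_j (d j)%:~R * b j.
    apply: (@emb_inj L); rewrite Dy rmorph_sum; apply: eq_bigr => j _.
    by rewrite rmorphM rmorph_int act1.
  rewrite mulr_sumr.
  have -> : gtr (\sum_j x * ((d j)%:~R * b j)) = \sum_j (d j)%:~R * gtr (x * b j).
    rewrite /gtr (eq_bigr _ (fun g _ => rmorph_sum (act g) _ _ _)) exchange_big.
    apply: eq_bigr => j _; rewrite mulr_sumr; apply: eq_bigr => g _.
    by rewrite !rmorphM rmorph_int mulrCA.
  rewrite rmorph_sum rpred_sum // => j _.
  by rewrite rmorphM rmorph_int Dc rpredM ?intr_int.
apply/colP => j; rewrite mxE; apply: (@intr_inj algC).
by rewrite -Dc x0 mul0r /gtr big1 ?rmorph0 // => g _; rewrite rmorph0.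
Qed.

(** The l forms x |-> Psi(g x) in the coordinates of [exists_dual]. As the Gram determinant is k
    times the squared period determinant, det(A)^2 = 1 / k with k a nonzero integer. *)
Let A := period_mx *m (conj_mx b *m invmx (gram_mx b)).

Let A_real i j : A i j \is Num.real.
Proof.
have [x [_ _ Dx]] := exists_dual (delta_mx j 0).
have -> : A i j = gform f (act (enum_val i) x); last exact: gform_real.
have := period_mx_mul x; rewrite Dx (mulmxA (conj_mx b)) mulmxA => /colP/(_ i).
by rewrite [RHS]mxE => <-; rewrite map_delta_mx -colE [RHS]mxE.
Qed.

Let det_A : \det A != 0 /\ `|\det A| <= 1.
Proof.
have [k k0 Dk] := det_period_le b_Aint det_b.
have A2 : k%:~R * \det A ^+ 2 = 1.
  have -> : \det A = \det period_mx * (\det (conj_mx b) * (\det (gram_mx b))^-1).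
    by rewrite !det_mulmx det_inv.
  rewrite exprMn mulrA Dk exprMn -det_gram mulrA -expr2 -exprMn divff ?expr1n //.
split; first by apply: contra_eq_neq A2 => ->; rewrite expr0n mulr0 eq_sym oner_eq0.
rewrite -(@expr_le1 _ 2) ?normr_ge0 //.
have := congr1 Num.norm A2; rewrite normrM normr1 normrX => <-.
rewrite -[X in X <= _]mul1r ler_wpM2r ?exprn_ge0 ?normr_ge0 //.
by rewrite -intr_norm -[1]/(1%:~R) ler_int -gtz0_ge1 normr_gt0.
Qed.

Lemma exists_small (s : 'I_l -> algC) : (forall i, s i \is Num.real) -> \prod_i s i = 1 ->
  exists x : L, [/\ trace_dual x, x != 0 & forall i, `|s i * gform f (act (enum_val i) x)| <= 1].
Proof.
move=> s_real s1.
have B_real i j : s i * A i j \is Num.real by rewrite realM.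
pose B : 'M[algR]_l := \matrix_(i, j) in_algR (B_real i j).
have DB : map_mx algRval B = diag_mx (\row_i s i) *m A.
  apply/matrixP => i j; rewrite mul_diag_mx [LHS]mxE [B i j]mxE [RHS]mxE /=.
  by rewrite [(\row__ _) _ _]mxE.
have detB : algRval (\det B) = \det A.
  rewrite -det_map_mx DB det_mulmx det_diag (eq_bigr s) ?s1 ?mul1r // => i _.
  by rewrite mxE.
have [A0 A1] := det_A.
have B0 : \det B != 0 by apply: contra_neq A0 => B0; rewrite -detB B0.
have B1 : `|\det B| <= 1 by rewrite -[_ <= _]/(`|algRval (\det B)| <= 1) detB.
have l_gt0 : (0 < l)%N by apply/prime_gt0/gf_prime.
have [c c0 cP] := minkowski_linear_forms l_gt0 B0 B1.
have [x [dual_x x0 Dx]] := exists_dual c; exists x; split=> // [|i].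
  by apply: contra_neq c0 => /x0.
have := cP i; rewrite -[_ <= _]/(`|algRval ((B *m map_mx intr c) i 0)| <= 1).
suff -> : algRval ((B *m map_mx intr c) i 0) = s i * gform f (act (enum_val i) x) by [].
have -> : algRval ((B *m map_mx intr c) i 0) = (map_mx algRval (B *m map_mx intr c)) i 0.
  by rewrite [RHS]mxE.
rewrite map_mxM DB -map_mx_comp.
have -> : map_mx (algRval \o intr) c = map_mx intr c.
  by apply: eq_map_mx => a /=; rewrite rmorph_int.
rewrite -mulmxA mul_diag_mx [LHS]mxE [(\row__ _) _ _]mxE; congr (_ * _).
have := period_mx_mul x; rewrite Dx => /colP/(_ i); rewrite [RHS]mxE => <-.
by rewrite /A !mulmxA.
Qed.

Lemma gform_zero : exists2 y, y != 0 & gform f y = 0.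
Proof.
have [g1 g1_neq1] := gnontrivial L.
(* The weights have product 1, so they change neither the determinant nor prod_g Psi(g x). *)
pose s (g : G) : algC := if g == 1%g then 2 else if g == g1 then 2^-1 else 1.
have s_real g : s g \is Num.real by rewrite /s; do 2?case: ifP => _; rewrite ?realV ?realn.
have s1 : \prod_g s g = 1.
  rewrite (bigD1 1%g) //= (bigD1 g1) //= big1 => [|g /andP[/negPf g_1 /negPf g_g1]].
    by rewrite /s eqxx (negPf g1_neq1) eqxx mulr1 divff ?pnatr_eq0.
  by rewrite /s g_1 g_g1.
have s1e : \prod_(i < l) s (enum_val i) = 1.
  rewrite -[RHS]s1 [RHS](reindex (enum_val : 'I_l -> G)) //=.
  by exists enum_rank => g _; rewrite ?enum_valK ?enum_rankK.
have [x [dual_x x0 Px]] := @exists_small (fun i => s (enum_val i)) (fun i => s_real _) s1e.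
have {}Px g : `|s g * gform f (act g x)| <= 1 by have := Px (enum_rank g); rewrite enum_rankK.
pose nu := \prod_g gform f (act g x).
have nu_prod : \prod_g (s g * gform f (act g x)) = nu.
  by rewrite big_split /= s1 mul1r.
have nu_Aint : nu \in Aint.
  by apply: rpred_prod => g _; apply/gform_Aint/trace_dual_act.
have nu_rat : nu \in Crat.
  apply: aut_fixed_rat => tau; have [t tP] := gform_aut tau.
  rewrite rmorph_prod [RHS](reindex_inj (mulgI t)) /=; apply: eq_bigr => g _.
  by rewrite tP gf_actM.
have [nu0|nu_neq0] := eqVneq nu 0.
  have /prodf_eq0[g _ /eqP g0] : nu == 0 by apply/eqP.
  by exists (act g x); rewrite ?fmorph_eq0.
have nu_int := Cint_rat_Aint nu_rat nu_Aint.
have eq1 : `|s 1%g * gform f (act 1%g x)| = 1.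
  apply/eqP; rewrite eq_le Px /=; apply: contraT => lt1.
  have : `|nu| < 1.
    rewrite -nu_prod (bigD1 1%g) //= normrM normr_prod.
    apply: le_lt_trans (ler_piMr _ _) _; rewrite ?normr_ge0 //.
      by apply: prodr_ile1 => g _; rewrite normr_ge0 Px.
    by rewrite real_ltNge ?normr_real ?real1.
  by move=> /(le_lt_trans (norm_intr_ge1 nu_int nu_neq0)); rewrite ltxx.
rewrite /s eqxx act1 in eq1.
(* Passing to the square avoids the sign: Psi(x) is real with |2 Psi(x)| = 1, so its square is
   1/4. *)
have : (2^-1 : algC) ^+ 2 \in Num.int.
  apply: Cint_rat_Aint; first by rewrite rpredX ?rpredV ?rpred_nat.
  have -> : (2^-1 : algC) ^+ 2 = gform f x ^+ 2.
    have : (2 * gform f x) ^+ 2 = 1.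
      by rewrite -real_normK ?eq1 ?expr1n // realM ?realn ?gform_real.
    rewrite exprMn => D; apply: (mulfI (_ : (2:algC) ^+ 2 != 0)).
      by rewrite expf_neq0 ?pnatr_eq0.
    by rewrite D -exprMn divff ?expr1n ?pnatr_eq0.
  by rewrite rpredX ?gform_Aint.
move=> /norm_intr_ge1 /(_ _); rewrite expf_eq0 invr_eq0 pnatr_eq0 /= => /(_ isT).
rewrite normrX normfV normr_nat exprVn invf_ge1 ?exprn_gt0 // -natrX lern1.
by [].
Qed.

Lemma gform_rat z : gform f z \in Crat.
Proof.
have [y y0 fy0] := gform_zero.
apply: aut_fixed_rat => tau; have [t tP] := gform_aut tau.
suff t1 : t = 1%g by rewrite tP t1 act1.
apply: contraTeq y0 => t1; rewrite negbK; apply/eqP/gform_vanish => g.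
have [k ->] := prime_group_cycle g (gf_prime L) t1.
elim: k => [|k IHk]; first by rewrite expg0 act1.
by rewrite expgS gf_actM -tP IHk rmorph0.
Qed.

(** The rational numbers Psi(b_j) are the traces tr(e b_j) of some e in L. The conjugates of e and
    the values of f then solve the same nonsingular linear system. *)
Lemma exists_conjugate_period : exists e : L, forall g, iota (act g e) = f g.
Proof.
have /choice[q qP] : forall j, exists a, gform f (b j) = ratr a by move=> j; apply/CratP/gform_rat.
have [e De] := exists_with_traces (\col_j q j).
exists e => g; have /colP/(_ (enum_rank g)) := De; rewrite mxE enum_rankK => ->.
have uW : (conj_mx b)^T \in unitmx by rewrite unitmx_tr unitmxE unitfE.
have uG : gram_mx b \in unitmx by rewrite unitmxE unitfE.
have -> : map_mx ratr (\col_j q j) = (conj_mx b)^T *m (\col_k f (enum_val k)).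
  apply/colP => j; rewrite !mxE -qP /gform -sum_enum_val.
  by apply: eq_bigr => k _; rewrite !mxE.
have -> : conj_mx b *m (invmx (gram_mx b) *m ((conj_mx b)^T *m (\col_k f (enum_val k)))) = \col_k f (enum_val k).
  apply: (can_inj (mulKmx uW)); rewrite mulmxA -gram_mxE mulKVmx //.
by rewrite mxE enum_rankK.
Qed.

End MainConstruction.

(** * Normal generators with prescribed traces, for odd and even degree *)

Section TameGenerator.
Variable L : galois_field.
Local Notation G := (gf_group L).
Local Notation act := (@gf_act L).
Local Notation iota := (@gf_emb L).
Local Notation l := #|G|.

(** Otherwise the inverse Gram matrix is p-local. A radical element x has all tr(x b_j) divisible by
    p, so x / p would be local, against [inertial_nonreduced]. *)
Lemma inertial_dvd_gram (b : 'I_l -> L) (M : 'M[int]_l) p : integral_family b ->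
  gram_mx b = map_mx intr M -> \det M != 0 -> prime p -> inertial L p -> (p %| `|\det M|)%N.
Proof.
move=> Ab DM det_M p_pr p_in; apply: contrapT => /negP p_M.
have [x Jx []] := inertial_nonreduced p_pr p_in.
have det_G : \det (gram_mx b) != 0 by rewrite DM det_map_mx intr_eq0.
have uG : gram_mx b \in unitmx by rewrite unitmxE unitfE.
have det_W : \det (conj_mx b) != 0 by move: det_G; rewrite det_gram expf_eq0.
have loc_inv i j : ploc p ((invmx (gram_mx b)) i j).
  rewrite /invmx uG mxE; apply: plocM => //.
    rewrite DM det_map_mx; exists `|\det M|%N => //.
    by rewrite natr_absz normrEsg rmorphM -mulrA divff ?intr_eq0 // mulr1 Aint_int.
  by rewrite DM -map_mx_adj mxE; apply: ploc_int.
have loc_tr j : ploc p (iota (gtr (x * b j)) / p%:R).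
  apply: pnil_rat => //; first exact: gtr_rat.
  by apply: pnil_gtr => //; rewrite rmorphM; apply: pnilMr => //; apply: ploc_Aint.
have Dx : (\col_k iota (act (enum_val k) x)) =
    conj_mx b *m (invmx (gram_mx b) *m \col_j iota (gtr (x * b j))).
  have uW : (conj_mx b)^T \in unitmx by rewrite unitmx_tr unitmxE unitfE.
  apply: (can_inj (mulKmx uW)).
  by rewrite mulmxA -gram_mxE mulKVmx // trace_vector.
have /colP/(_ (enum_rank 1%g)) := Dx; rewrite mxE enum_rankK act1 rmorphM fmorphV rmorph_nat => ->.
rewrite mxE mulr_suml; apply: ploc_sum => // i _; rewrite -mulrA; apply: plocM => //.
  by rewrite mxE enum_rankK; apply/ploc_act/ploc_Aint.
rewrite mxE mulr_suml; apply: ploc_sum => // j _; rewrite -mulrA; apply: plocM => //.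
by rewrite mxE.
Qed.

Lemma inertial_primes : exists2 ps : seq nat, uniq ps & forall p, (p \in ps) <-> prime p /\ inertial L p.
Proof.
have [b [Ab det_b _]] := integral_basis_exists L.
have [M DM] := gram_int Ab.
have det_M : \det M != 0.
  by rewrite -(intr_eq0 algC) -det_map_mx -DM det_gram expf_neq0.
exists [seq p <- primes `|\det M| | `[< inertial L p >]] => [|p].
  by rewrite filter_uniq // primes_uniq.
rewrite mem_filter; split=> [/andP[/asboolP p_in]|[p_pr p_in]].
  by rewrite mem_primes => /andP[].
apply/andP; split; first exact/asboolP.
by rewrite mem_primes p_pr absz_gt0 det_M (inertial_dvd_gram Ab DM).
Qed.

(* The signed number [N] will turn out to be the radical of [L]. *)
Definition tame_generator (N m : int) (e : L) : Prop :=
  [/\ N = 1 + l%:Z * m, 0 < N ^+ l,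
      forall p, prime p -> ~~ (p ^ 2 %| `|N|)%N,
      forall p, prime p -> (p %| `|N|)%N <-> inertial L p
    & iota e \in Aint /\
      forall g, iota (gtr (e * act g e)) = (if g == 1%g then N%:~R else 0) - m%:~R].

Lemma prime_dvd_prod (ps : seq nat) p : prime p -> (forall q, q \in ps -> prime q) ->
  (p %| \prod_(q <- ps) q)%N = (p \in ps).
Proof.
move=> p_pr ps_pr; rewrite big_seq Euclid_dvd_prod // big_has_cond.
apply/hasP/idP => [[q psq /andP[_]]|psp]; last by exists p => //; apply/andP.
by rewrite (dvdn_prime2 p_pr (ps_pr q psq)) => /eqP->.
Qed.

Lemma squarefree_prod (ps : seq nat) p : prime p -> uniq ps -> (forall q, q \in ps -> prime q) ->
  ~~ (p ^ 2 %| \prod_(q <- ps) q)%N.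
Proof.
move=> p_pr uniq_ps ps_pr; apply/negP => p2.
have psp : p \in ps.
  by rewrite -prime_dvd_prod //; apply: dvdn_trans p2; apply: dvdn_exp.
move: p2; rewrite (big_rem p psp) /= expnS expn1 dvdn_pmul2l ?(prime_gt0 p_pr) //.
rewrite prime_dvd_prod ?mem_rem_uniq ?inE ?eqxx // => q.
by rewrite mem_rem_uniq // inE => /andP[_ /ps_pr].
Qed.

Lemma exists_odd_tame_generator : odd l -> ~ inertial L l ->
  exists N m e, tame_generator N m e.
Proof.
move=> l_odd tame; have [ps uniq_ps psE] := inertial_primes.
have ps_pr p : p \in ps -> prime p by move=> /psE[].
have psP p : p \in ps -> [/\ prime p, inertial L p & ~~ (p %| l)%N].
  move=> /psE[p_pr p_in]; split=> //; apply/negP; rewrite dvdn_prime2 //; last exact: gf_prime.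
  by move=> /eqP pl; apply: tame; rewrite -pl.
have [N_gt0 dvdN [f [f_Aint corr_f f_aut f_conj f_loc]]] := exists_period l_odd psP.
set N := (\prod_(p <- ps) p)%N in N_gt0 dvdN corr_f *.
have unram p : prime p -> p \notin ps -> ~ inertial L p.
  by move=> p_pr p_ps p_in; case/negP: p_ps; apply/psE.
have [b [b_Aint det_b b_basis]] := integral_basis_exists L.
have [e De] := exists_conjugate_period uniq_ps psP dvdN N_gt0 corr_f l_odd f_Aint f_aut f_conj
  f_loc unram b_Aint det_b b_basis.
exists N%:Z, (N.-1 %/ l)%N%:Z, e; split.
- by rewrite -PoszM mulnC divnK // -[in LHS](prednK N_gt0) intS.
- by rewrite exprn_gt0.
- by move=> p p_pr; apply: squarefree_prod.
- by move=> p p_pr; rewrite /= prime_dvd_prod //; split=> [/psE[]|p_in]; last apply/psE.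
split=> [|g]; first by have := De 1%g; rewrite act1 => ->.
rewrite -corr_f /gcorr rmorph_sum; apply: eq_bigr => h _.
by rewrite !rmorphM -gf_actM /= !De.
Qed.

Lemma squarefree_decomposition (n : nat) : (0 < n)%N ->
  exists s d : nat, n = (s ^ 2 * d)%N /\ forall p, prime p -> ~~ (p ^ 2 %| d)%N.
Proof.
elim/ltn_ind: n => n IHn n_gt0.
have [[p p_pr p2]|no_p] := pselect (exists2 p, prime p & (p ^ 2 %| n)%N); last first.
  exists 1%N, n; split=> [|p p_pr]; first by rewrite mul1n.
  by apply/negP => p2; apply: no_p; exists p.
have [k Dk] := dvdnP p2; have k_gt0 : (0 < k)%N by move: n_gt0; rewrite Dk muln_gt0 => /andP[].
have k_lt : (k < n)%N by rewrite Dk ltn_Pmulr // -{1}(exp1n 2) ltn_exp2r // prime_gt1.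
have [s [d [Ds sqf]]] := IHn k k_lt k_gt0.
by exists (p * s)%N, d; split=> //; rewrite Dk Ds expnMn mulnC mulnA.
Qed.

(** theta is x - g(x), for an x moved by g, scaled to an algebraic integer and divided by the root
    of the square part of its square. *)
Lemma exists_square_root : l = 2%N -> exists (g : G) (theta : L) (d : int),
  [/\ g != 1%g, act g theta = - theta, theta ^+ 2 = d%:~R, d != 0
    & forall p, prime p -> ~~ (p ^ 2 %| `|d|)%N].
Proof.
move=> l2; have [g g1] := gnontrivial L; have [x gx] := gf_faithful g1.
have gg : (g * g)%g = 1%g.
  have : (g ^+ l)%g = 1%g by apply/eqP; rewrite -order_dvdn -cardsT order_dvdG ?inE.
  by rewrite l2 expgS expg1.
pose y := x - act g x; have gy : act g y = - y by rewrite rmorphB -gf_actM gg act1 opprB.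
have y0 : y != 0 by rewrite subr_eq0 eq_sym.
have [m m_gt0 Amy] := Aint_scale (iota y).
pose z := m%:R * y; have gz : act g z = - z by rewrite rmorphM rmorph_nat gy mulrN.
have z0 : iota z != 0.
  by rewrite fmorph_eq0 mulf_neq0 // -(fmorph_eq0 iota) rmorph_nat pnatr_eq0 -lt0n.
have Az : iota z \in Aint by rewrite rmorphM rmorph_nat.
have Qz : iota (z ^+ 2) \in Crat.
  apply: gf_fixed => h; have [->|h1] := eqVneq h 1%g; first by rewrite act1.
  have [k ->] := prime_group_cycle h (gf_prime L) g1; elim: k => [|k IHk]; first by rewrite expg0 act1.
  by rewrite expgS gf_actM IHk rmorphXn gz sqrrN.
have /intrP[n Dn] : iota (z ^+ 2) \in Num.int by rewrite Cint_rat_Aint // rmorphXn rpredX.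
have n0 : n != 0 by apply: contra_neq z0 => n0; apply/eqP; rewrite -[_ == 0]/(_ == _) -sqrf_eq0 -rmorphXn Dn n0.
have [s [d [Dnd sqf]]] : exists s d : nat, `|n|%N = (s ^ 2 * d)%N /\ forall p, prime p -> ~~ (p ^ 2 %| d)%N.
  by apply: squarefree_decomposition; rewrite absz_gt0.
have s0 : (s%:R : L) != 0.
  rewrite -(fmorph_eq0 iota) rmorph_nat pnatr_eq0; apply: contra_neq n0 => s0.
  by apply/eqP; rewrite -absz_eq0 Dnd s0.
exists g, (z / s%:R), (sgz n * d%:Z); split=> //.
- by rewrite fmorph_div rmorph_nat gz mulNr.
- rewrite expr_div_n; apply: (canLR (mulfK (expf_neq0 2 s0))); apply: (@emb_inj L).
  rewrite Dn (rmorphM iota) (rmorph_int iota) (rmorphXn iota) rmorph_nat -[s%:R]/(s%:Z%:~R).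
  rewrite -rmorphXn -rmorphM [n in LHS]intEsg Dnd -[(s ^ 2)%N]/(s * s)%N !PoszM.
  by congr (_ %:~R); ring.
- rewrite mulf_neq0 ?sgz_eq0 //; apply: contra_neq n0 => d0; apply/eqP; rewrite -absz_eq0 Dnd.
  by case: d0 => ->; rewrite muln0.
- by move=> p /sqf; have -> : `|(sgz n * d%:Z)%R|%N = d by rewrite abszM; case: sgzP n0; rewrite ?mul1n.
Qed.

(** theta^2 / p is integral, so theta is in the radical; were p not inertial, theta / p would be
    local and p^2 would divide d. *)
Lemma square_root_inertial (theta : L) (d : int) p : prime p -> theta ^+ 2 = d%:~R ->
  ~~ (p ^ 2 %| `|d|)%N -> (p %| `|d|)%N -> inertial L p.
Proof.
move=> p_pr Dd p2 pd; apply: contrapT => not_in.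
have /dvdzP[k Dk] : (p%:Z %| d)%Z by [].
have p0 : p%:R != 0 :> algC by rewrite pnatr_eq0 -lt0n prime_gt0.
have iD : iota theta ^+ 2 = k%:~R * p%:R by rewrite -rmorphXn Dd Dk rmorph_int rmorphM.
have Jt : pnil p (iota theta) by exists 2%N; rewrite iD mulfK //; apply: ploc_int.
have := plocX p_pr 2 (noninertial_pnil p_pr not_in Jt).
rewrite fmorph_div rmorph_nat expr_div_n iD expr2 invfM mulrACA divff // mulr1.
move=> /(ploc_ratP p_pr)/dvdzP[j Dj]; case/negP: p2.
by rewrite Dk Dj -mulrA abszM -expr2 abszX dvdn_mull.
Qed.

(** Tameness at 2 is used twice. It makes d odd; then (1 + t)^2 is divisible by 2, so 1 + t is in
    the radical at 2, which is generated by 2, and e = (1 + t) / 2 is integral. *)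
Lemma exists_quadratic_tame_generator : l = 2%N -> ~ inertial L 2 ->
  exists N m e, tame_generator N m e.
Proof.
move=> l2 tame; have [g [t [d [g1 gt Dd d0 sqf]]]] := exists_square_root l2.
have pd_in p : prime p -> (p %| `|d|)%N -> inertial L p.
  by move=> p_pr; apply: square_root_inertial Dd _ => //; apply: sqf.
have d_odd : ~~ (2 %| `|d|)%N by apply/negP => /(pd_in 2%N isT)/tame.
have T2 : iota t ^+ 2 = d%:~R by rewrite -rmorphXn Dd rmorph_int.
have At : iota t \in Aint by apply: (@Aint_root _ 2) => //; rewrite T2 Aint_int.
pose e : L := (1 + t) / 2.
have De : iota e = (1 + iota t) / 2 by rewrite fmorph_div rmorphD rmorph1 rmorph_nat.
have Dge : iota (act g e) = (1 - iota t) / 2.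
  by rewrite /e (fmorph_div (act g)) rmorphD rmorph1 rmorph_nat gt fmorph_div rmorphB rmorph1 rmorph_nat.
have G2 h : h != 1%g -> h = g.
  move=> h1; apply/eqP; apply: contraT => hg.
  have : (#|[set 1%g; g; h]%SET| <= l)%N by rewrite max_card.
  have [g1' h1' hg'] : [/\ (1%g == g) = false, (1%g == h) = false & (g == h) = false].
    by rewrite !(eq_sym _ h) (eq_sym _ g) (negPf g1) (negPf h1) (negPf hg).
  by rewrite l2 -setUA !cardsU1 !inE cards1 g1' h1' hg'.
have GE (F : G -> L) : \sum_h F h = F 1%g + F g.
  rewrite (bigD1 1%g) //= (bigD1 g) //= big1 ?addr0 // => h /andP[/G2->].
  by rewrite eqxx.
have Ae : iota e \in Aint.
  apply: ploc_all_Aint => p p_pr; have [->|p_neq2] := eqVneq p 2%N; last first.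
    rewrite De; apply: plocM => //; first by apply/ploc_Aint/rpredD; rewrite ?Aint1.
    by apply: ploc_invn; rewrite dvdn_prime2.
  have J1t : pnil 2 (iota (1 + t)).
    exists 2%N; have [k Dk] : exists k : int, d = 2 * k + 1.
      by exists ((d - 1) %/ 2)%Z; move: d_odd; lia.
    have -> : iota (1 + t) ^+ 2 / 2 = k%:~R + 1 + iota t.
      have Tk : iota t ^+ 2 = 2 * k%:~R + 1 by rewrite T2 Dk rmorphD rmorphM.
      by rewrite rmorphD rmorph1 sqrrD Tk; field.
    by apply: ploc_Aint => //; rewrite rpredD // rpredD ?Aint_int ?Aint1.
  have := @noninertial_pnil L 2 isT _ tame J1t.
  by [].
have Age : iota (act g e) \in Aint by apply: Aint_act.
have /intrP[k Dk] : iota e * iota (act g e) \in Num.int.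
  apply: Cint_rat_Aint; last exact: rpredM.
  have -> : iota e * iota (act g e) = (1 - d%:~R) / 2 ^+ 2.
    by rewrite De Dge -T2; field.
  by rewrite rpred_div ?rpredX ?rpred_nat // rpredB ?rpred1 ?rpred_int.
have Dk4 : d = 1 - 4 * k.
  apply: (@intr_inj algC); rewrite rmorphB rmorphM /= -Dk De Dge -T2.
  by field.
(* k is the norm of e and d = 1 - 4 k, so m = (d - 1) / 2; d may be negative. *)
exists d, (- 2 * k), e; split=> //.
- by rewrite l2 {1}Dk4; lia.
- by rewrite l2 lt_def expf_eq0 d0 sqr_ge0.
- move=> p p_pr; split; first exact: pd_in.
  move=> p_in; have At1 := ploc_Aint p_pr At.
  have := p_in g t At1; rewrite gt => J2t.
  have : (p%:Z %| 4 * d)%Z.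
    apply: (pnil_int p_pr); have -> : (4 * d)%:~R = iota (- t - t) * iota (- t - t).
      by rewrite rmorphB rmorphN rmorphM /= -T2; ring.
    by apply: pnilM => //; apply: pnil_ploc.
  rewrite dvdzE abszM Euclid_dvdM // => /orP[|//] /=.
  rewrite -[X in (p %| X)%N]/(2 ^ 2)%N Euclid_dvdX // dvdn_prime2 // => /andP[/eqP p2 _].
  by case: tame; rewrite -p2.
have K4 : (k%:~R : algC) = (1 - iota t ^+ 2) / 2 ^+ 2 by rewrite -Dk De Dge; field.
split=> // h; have [->|h1] := eqVneq h 1%g.
  rewrite act1 /gtr GE act1 (rmorphM (act g) e e) rmorphD (rmorphM iota e e).
  rewrite (rmorphM iota (act g e) (act g e)) Dge De -T2 rmorphM /= K4.
  by rewrite -[(-2)%:~R]/(- 2 : algC); field.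
rewrite (G2 h h1) sub0r /gtr GE act1 (rmorphM (act g) e) -gf_actM.
have -> : (g * g)%g = 1%g.
  by apply: contrapT => /eqP/G2/eqP; rewrite -{3}[g]mulg1 (inj_eq (mulgI g)) (negPf g1).
rewrite act1 rmorphD (rmorphM iota e) (rmorphM iota (act g e)) intrM Dge De K4 -[(-2)%:~R]/(- 2 : algC).
by field.
Qed.

End TameGenerator.

(* The coordinates of [v], shifted by one and padded with zeros. *)
Definition padded n (v : 'rV[int]_n) (k : nat) : int := \sum_(j < n | j.+1 == k) v 0 j.

Lemma padded_ord n (v : 'rV[int]_n) (i : 'I_n) : padded v i.+1 = v 0 i.
Proof. by rewrite /padded (big_pred1 i). Qed.

Lemma padded0 n (v : 'rV[int]_n) : padded v 0 = 0.
Proof. by rewrite /padded big_pred0. Qed.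

Lemma padded_max n (v : 'rV[int]_n) : padded v n.+1 = 0.
Proof. by rewrite /padded big_pred0 // => j; rewrite eqSS ltn_eqF. Qed.

Lemma paddedD n (v w : 'rV[int]_n) k : padded (v + w) k = padded v k + padded w k.
Proof. by rewrite -big_split; apply: eq_bigr => j _; rewrite mxE. Qed.

Lemma sum_neighbours n (v : 'rV[int]_n) (i : 'I_n) :
  \sum_(j < n | `|(i : nat)%:Z - (j : nat)%:Z| == 1) v 0 j = padded v i.+2 + padded v i.
Proof.
rewrite (bigID (fun j : 'I_n => j == i.+1 :> nat)) /= /padded; congr (_ + _).
  by apply: eq_bigl => j; lia.
by apply: eq_bigl => j; lia.
Qed.

(** Summation by parts. The last two terms are the contribution of the right end; they make the
    induction work and vanish once V n.+1 = 0. *)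
Lemma sum_sqr_differences (V : nat -> int) n : V 0%N = 0 ->
  \sum_(i < n.+1) (V i.+1 - V i) ^+ 2 =
  \sum_(i < n) (2 * V i.+1 ^+ 2 - V i.+1 * (V i.+2 + V i)) + V n.+1 ^+ 2 - V n.+1 * V n.
Proof.
move=> V0; elim: n => [|n IHn]; first by rewrite big_ord1 big_ord0 V0; ring.
by rewrite big_ord_recr IHn [in RHS]big_ord_recr /=; ring.
Qed.

(** The model of A_n as the vectors of sum 0 in Z^(n+1): with a zero at each end, the consecutive
    differences of v form such a vector. *)
Lemma An_formE n (v : 'rV[int]_n) :
  An_form v = \sum_(i < n.+1) (padded v i.+1 - padded v i) ^+ 2.
Proof.
rewrite sum_sqr_differences ?padded0 // padded_max mul0r expr0n /= addr0 subr0.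
rewrite /An_form -sumrB; apply: eq_bigr => i _.
by rewrite -mulr_sumr sum_neighbours padded_ord.
Qed.

(** * The ring of integers and its trace form in the normal basis *)

Section Coordinates.
Variable L : galois_field.
Local Notation G := (gf_group L).
Local Notation act := (@gf_act L).
Local Notation iota := (@gf_emb L).
Local Notation l := #|G|.
Variables (N m : int) (e : L).
Hypothesis Ge : tame_generator N m e.

Let DN : N = 1 + l%:Z * m. Proof. by have [] := Ge. Qed.
Let N0 : N != 0.
Proof.
have [_ N_gt0 _ _ _] := Ge; apply: contraTneq N_gt0 => ->.
by rewrite expr0n; have := prime_gt0 (gf_prime L); case: l.
Qed.
Let Ae : iota e \in Aint. Proof. by have [_ _ _ _ []] := Ge. Qed.

Let DNC : N%:~R = 1 + l%:R * m%:~R :> algC.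
Proof. by rewrite DN rmorphD rmorphM. Qed.

Lemma gtr_generator g h :
  iota (gtr (act g e * act h e)) = (if g == h then N%:~R else 0) - m%:~R.
Proof.
have [_ _ _ _ [_ /(_ (g^-1 * h)%g)]] := Ge.
rewrite -eq_mulVg1 => <-; congr (iota _); rewrite -[LHS](gtr_actl g^-1%g) rmorphM.
by rewrite actK -gf_actM.
Qed.

(** tr(e)^2 is the sum of all tr(e g(e)), which is N - l m. *)
Lemma gtr_generator_sqr : iota (gtr e) ^+ 2 = 1.
Proof.
have -> : iota (gtr e) ^+ 2 = \sum_g iota (gtr (e * act g e)).
  rewrite expr2 -rmorphM -rmorph_sum; congr (iota _).
  rewrite {1}/gtr mulr_suml [in RHS]/gtr [RHS]exchange_big /=; apply: eq_bigr => g _.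
  rewrite [RHS](eq_bigr (fun h => act g e * act g (act h e))) => [|h _]; last by rewrite rmorphM.
  by rewrite -[RHS]mulr_sumr -rmorph_sum -/(gtr e) gtr_act.
rewrite (eq_bigr (fun g => (if g == 1%g then N%:~R else 0) - m%:~R)) => [|g _]; last first.
  by rewrite -{1}[e]act1 gtr_generator eq_sym.
rewrite sumrB -big_mkcond big_pred1_eq.
have -> : \sum_(g : G) (m%:~R : algC) = l%:R * m%:~R by rewrite sumr_const mulr_natl.
by rewrite DNC addrK.
Qed.

Lemma gtr_sum (I : finType) (F : I -> L) : gtr (\sum_i F i) = \sum_i gtr (F i).
Proof. by rewrite /gtr [RHS]exchange_big; apply: eq_bigr => h _; rewrite rmorph_sum. Qed.

Let Qint (a : int) : iota a%:~R \in Crat.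
Proof. by rewrite rmorph_int rpred_int. Qed.

Definition lincomb (c : G -> int) : L := \sum_g (c g)%:~R * act g e.

Lemma gtr_lincomb c : iota (gtr (lincomb c)) = (\sum_g c g)%:~R * iota (gtr e).
Proof.
have -> : (\sum_g c g)%:~R = \sum_g (c g)%:~R :> algC by rewrite rmorph_sum.
rewrite gtr_sum rmorph_sum mulr_suml; apply: eq_bigr => g _.
by rewrite (gtrZ _ (Qint _)) gtr_actl rmorphM rmorph_int.
Qed.

Lemma gtr_lincombM c d : iota (gtr (lincomb c * lincomb d)) =
  (N * (\sum_g c g * d g) - m * ((\sum_g c g) * (\sum_g d g)))%:~R.
Proof.
have E g h : iota (gtr ((c g)%:~R * act g e * ((d h)%:~R * act h e))) =
    (c g)%:~R * (d h)%:~R * ((if g == h then N%:~R else 0) - m%:~R).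
  have -> : (c g)%:~R * act g e * ((d h)%:~R * act h e) = (c g * d h)%:~R * (act g e * act h e) :> L.
    by rewrite intrM mulrACA.
  by rewrite (gtrZ _ (Qint _)) (rmorphM iota) rmorph_int intrM gtr_generator.
transitivity (\sum_g \sum_h (c g)%:~R * (d h)%:~R * ((if g == h then N%:~R else 0) - m%:~R) : algC).
  rewrite {1}/lincomb mulr_suml gtr_sum rmorph_sum; apply: eq_bigr => g _.
  by rewrite /lincomb mulr_sumr gtr_sum rmorph_sum; apply: eq_bigr => h _; apply: E.
rewrite (eq_bigr (fun g => N%:~R * (c g * d g)%:~R - m%:~R * ((c g)%:~R * \sum_h (d h)%:~R))) => [|g _].
  by rewrite sumrB -!mulr_sumr -mulr_suml rmorphB !rmorphM /= !rmorph_sum.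
rewrite (eq_bigr (fun h => (if h == g then N%:~R * (c g * d g)%:~R else 0) - m%:~R * ((c g)%:~R * (d h)%:~R))) => [|h _].
  by rewrite sumrB -big_mkcond big_pred1_eq -!mulr_sumr.
by rewrite /= (eq_sym h g); case: eqP => [<-|_]; rewrite ?intrM; ring.
Qed.

Lemma lincombD c d : lincomb (fun g => c g + d g) = lincomb c + lincomb d.
Proof. by rewrite -big_split; apply: eq_bigr => g _; rewrite rmorphD mulrDl. Qed.

Lemma lincomb_Aint c : iota (lincomb c) \in Aint.
Proof.
rewrite rmorph_sum rpred_sum // => g _; rewrite rmorphM rmorph_int rpredM ?Aint_int //.
exact: Aint_act.
Qed.

Lemma gtr_lincomb_generator c h :
  iota (gtr (lincomb c * act h e)) = (N * c h - m * \sum_g c g)%:~R.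
Proof.
pose dl g : int := if g == h then 1 else 0.
have -> : act h e = lincomb dl.
  rewrite /lincomb (bigD1 h) //= {1}/dl eqxx mulr1z mul1r big1 ?addr0 // => g /negPf gh.
  by rewrite /dl gh mulr0z mul0r.
rewrite gtr_lincombM.
have -> : \sum_g c g * dl g = c h.
  by rewrite (bigD1 h) //= {1}/dl eqxx mulr1 big1 ?addr0 // => g /negPf gh; rewrite /dl gh mulr0.
have -> : \sum_g dl g = 1.
  by rewrite (bigD1 h) //= {1}/dl eqxx big1 ?addr0 // => g /negPf gh; rewrite /dl gh.
by rewrite mulr1.
Qed.

(** Pairing the difference b with each h(e) gives N b_h = m S, where S is the sum of b. Summing, N S
    = l m S, so S = 0 because N - l m = 1; then b = 0. *)
Lemma lincomb_inj c d : lincomb c = lincomb d -> c =1 d.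
Proof.
move=> Dcd; pose b g := c g - d g; pose S := \sum_g b g.
have b_eq h : N * b h = m * S.
  have := gtr_lincomb_generator c h; rewrite Dcd gtr_lincomb_generator => /intr_inj E.
  apply/eqP; rewrite -subr_eq0 /S sumrB /b.
  have -> : N * (c h - d h) - m * (\sum_g c g - \sum_g d g) =
    (N * c h - m * \sum_g c g) - (N * d h - m * \sum_g d g) by ring.
  by rewrite E subrr.
have S0 : S = 0.
  have E : N * S = l%:Z * (m * S).
    rewrite {1}/S mulr_sumr (eq_bigr (fun=> m * S)) => [|h _]; last exact: b_eq.
    by rewrite sumr_const -[l%:Z]natz mulr_natl.
  have H : N * S - l%:Z * (m * S) = S by rewrite DN; ring.
  by rewrite -[LHS]H E subrr.
move=> h; have /eqP : N * b h = 0 by rewrite b_eq S0 mulr0.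
by rewrite mulf_eq0 (negPf N0) subr_eq0 => /eqP.
Qed.

(** The Gram matrix is N times a rank-one perturbation of the identity, of determinant 1 - l m / N =
    1 / N. *)
Lemma det_gram_generator n (s : 'I_n -> G) : injective s -> n = l ->
  \det (\matrix_(i < n, j < n) iota (gtr (act (s i) e * act (s j) e))) = (N ^+ n.-1)%:~R.
Proof.
move=> s_inj nl; have n_gt0 : (0 < n)%N by rewrite nl; apply/prime_gt0/gf_prime.
have N0C : N%:~R != 0 :> algC by rewrite intr_eq0.
have -> : \matrix_(i < n, j < n) iota (gtr (act (s i) e * act (s j) e)) =
    N%:~R *: (1%:M + (const_mx (- (m%:~R / N%:~R)) : 'cV_n) *m (const_mx 1 : 'rV_n)).
  apply/matrixP => i j; rewrite !mxE gtr_generator (inj_eq s_inj) big_ord1 !mxE mulr1.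
  by case: eqP => _; rewrite ?mulr1n ?mulr0n; field.
rewrite detZ det_rank1 mxE (eq_bigr (fun=> - (m%:~R / N%:~R))) => [|k _]; last by rewrite !mxE mul1r.
rewrite sumr_const card_ord.
have -> : N%:~R ^+ n = N%:~R ^+ n.-1 * N%:~R :> algC by rewrite -exprSr prednK.
rewrite -mulrA rmorphXn /= -[RHS]mulr1; congr (_ * _).
have -> : N%:~R * (1 + - (m%:~R / N%:~R) *+ n) = N%:~R - n%:R * m%:~R :> algC.
  by rewrite -[_ *+ n]mulr_natl; field.
by rewrite DNC nl addrK.
Qed.

Lemma squarefree_prod_primes (n : nat) : (forall p, prime p -> ~~ (p ^ 2 %| n)%N) ->
  n = (\prod_(p <- primes n) p)%N.
Proof.
move=> sqf; have n_gt0 : (0 < n)%N by case: n sqf => // /(_ 2%N isT).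
rewrite {1}(prod_prime_decomp n_gt0) prime_decompE big_map /= big_seq [RHS]big_seq.
apply: eq_bigr => p pn; have p_pr : prime p by move: pn; rewrite mem_primes => /andP[].
have -> : logn p n = 1%N.
  apply/eqP; rewrite eqn_leq logn_gt0 pn andbT leqNgt -pfactor_dvdn //.
  exact: sqf.
by rewrite expn1.
Qed.

(** Let c_k be the rational coordinates of x and S their sum. Then tr(x g_k(e)) = N c_k - m S and
    tr(x) = S tr(e); since tr(e)^2 = 1, tr(x g_k(e)) + m tr(x) tr(g_k(e)) is N c_k. By
    [trace_form_divisible] it is also N times an integer. *)
Lemma lincomb_surj x : iota x \in Aint -> exists c, x = lincomb c.
Proof.
move=> Ax; pose gen (j : 'I_l) := act (enum_val j) e.
have det_W : \det (conj_mx gen) != 0.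
  have : \det (gram_mx gen) != 0.
    by rewrite /gram_mx (det_gram_generator (@enum_val_inj G G)) // intr_eq0 expf_neq0.
  by rewrite det_gram expf_eq0.
have [c /(_ 1%g)] := rational_coordinates x det_W; rewrite act1 => Dx.
have {}Dx : x = \sum_j ratr (c j) * gen j.
  apply: (@emb_inj L); rewrite Dx rmorph_sum; apply: eq_bigr => j _.
  by rewrite act1 (rmorphM iota) fmorph_rat.
pose S : algC := \sum_j ratr (c j).
have Qc j : iota (ratr (c j)) \in Crat by rewrite fmorph_rat; apply/CratP; exists (c j).
have T2 : iota (gtr x) = S * iota (gtr e).
  rewrite Dx gtr_sum rmorph_sum mulr_suml; apply: eq_bigr => j _.
  by rewrite (gtrZ _ (Qc j)) gtr_actl (rmorphM iota) fmorph_rat.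
have T1 k : iota (gtr (x * gen k)) = N%:~R * ratr (c k) - m%:~R * S.
  rewrite Dx mulr_suml gtr_sum rmorph_sum.
  rewrite (eq_bigr (fun j => (if j == k then N%:~R * ratr (c k) else 0) - m%:~R * ratr (c j))) => [|j _].
    by rewrite sumrB -big_mkcond big_pred1_eq -mulr_sumr.
  rewrite -mulrA (gtrZ _ (Qc j)) (rmorphM iota) fmorph_rat gtr_generator (inj_eq enum_val_inj).
  by case: eqP => [->|_]; ring.
have [_ _ sqf ramE _] := Ge.
have /choice[a aP] : forall k, exists a : int, ratr (c k) = a%:~R :> algC.
  move=> k; have psP p : p \in primes `|N| -> prime p /\ inertial L p.
    by rewrite mem_primes => /and3P[p_pr _ pN]; split=> //; apply/ramE.
  have Agk : iota (gen k) \in Aint by apply: Aint_act.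
  have [a] := trace_form_divisible (primes_uniq _) psP (squarefree_prod_primes sqf) DN Ax Agk.
  rewrite T1 T2 gtr_actl => Da; exists a.
  have N0C : N%:~R != 0 :> algC by rewrite intr_eq0.
  apply: (mulfI N0C); rewrite -Da.
  have -> : S * iota (gtr e) * iota (gtr e) = S by rewrite -mulrA -expr2 gtr_generator_sqr mulr1.
  by rewrite subrK.
exists (fun g => a (enum_rank g)); rewrite Dx /lincomb -sum_enum_val; apply: eq_bigr => j _.
rewrite enum_valK; congr (_ * _); apply: (@emb_inj L).
by rewrite fmorph_rat rmorph_int aP.
Qed.

Lemma tame_basis n : n = l -> exists y : 'I_n -> L,
  (forall x, iota x \in Aint <-> exists c : 'I_n -> int, x = \sum_i y i *~ c i) /\
  \det (\matrix_(i, j) iota (gtr (y i * y j))) = (N ^+ n.-1)%:~R.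
Proof.
move=> nl; pose s (i : 'I_n) : G := enum_val (cast_ord nl i).
pose r (g : G) : 'I_n := cast_ord (esym nl) (enum_rank g).
have rs : cancel s r by move=> i; rewrite /r /s enum_valK cast_ordK.
have sr : cancel r s by move=> g; rewrite /r /s cast_ordKV enum_rankK.
have sum_s (c : G -> int) : lincomb c = \sum_i act (s i) e *~ c (s i).
  rewrite /lincomb (reindex s); last by exists r => ? _; [apply: rs | apply: sr].
  by apply: eq_bigr => i _; rewrite mulrzl.
exists (fun i => act (s i) e); split; last first.
  by apply: det_gram_generator => //; apply: can_inj rs.
move=> x; split=> [/lincomb_surj[c ->]|[c ->]]; first by exists (fun i => c (s i)).
have -> : \sum_i act (s i) e *~ c i = lincomb (fun g => c (r g)); last exact: lincomb_Aint.
by rewrite sum_s; apply: eq_bigr => i _; rewrite rs.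
Qed.

(** Trace zero means coefficient sum zero, as tr(e) <> 0. Ordering G by [enum_rank], such
    coefficient vectors are the differences of a vector of l - 1 free entries padded with zeros. *)
Lemma tame_lattice : exists phi : 'rV[int]_l.-1 -> L,
  [/\ forall v w, phi (v + w) = phi v + phi w,
      injective phi,
      forall v, iota (phi v) \in Aint /\ gtr (phi v) = 0,
      forall x, iota x \in Aint -> gtr x = 0 -> exists v, x = phi v
    & forall v, iota (gtr (phi v * phi v)) = (N * An_form v)%:~R].
Proof.
have l_gt0 : (0 < l)%N by apply/prime_gt0/gf_prime.
pose cf (v : 'rV[int]_l.-1) (g : G) := padded v (enum_rank g).+1 - padded v (enum_rank g).
have sum_rank (F : nat -> int) : \sum_(g : G) F (enum_rank g) = \sum_(i < l) F i.
  by rewrite -sum_enum_val; apply: eq_bigr => i _; rewrite enum_valK.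
have padl v : @padded l.-1 v l = 0 by have := padded_max v; rewrite prednK.
have cf0 v : \sum_g cf v g = 0.
  rewrite (sum_rank (fun k => padded v k.+1 - padded v k)) -(big_mkord xpredT (fun k => padded v k.+1 - padded v k)).
  by rewrite telescope_sumr // padl padded0 subrr.
have t0 : iota (gtr e) != 0.
  by have := oner_neq0 algC; rewrite -gtr_generator_sqr expf_eq0.
exists (fun v => lincomb (cf v)); split.
- move=> v w; rewrite -lincombD; apply: eq_bigr => g _; congr (_%:~R * _).
  by rewrite /cf !paddedD; ring.
- move=> v w /lincomb_inj Dc.
  have pE k : (k <= l)%N -> padded v k = padded w k.
    elim: k => [|k IHk] k_l; first by rewrite !padded0.
    have := Dc (enum_val (Ordinal k_l)); rewrite /cf enum_valK /= (IHk (ltnW k_l)).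
    exact: addIr.
  apply/rowP => j; rewrite -!padded_ord; apply: pE.
  exact: leq_trans (ltn_ord j) (leq_pred l).
- move=> v; split; first exact: lincomb_Aint.
  by apply: (@emb_inj L); rewrite gtr_lincomb cf0 !rmorph0 mul0r.
- move=> _ /lincomb_surj[c ->] /(congr1 iota); rewrite gtr_lincomb rmorph0 => /eqP.
  rewrite mulf_eq0 (negPf t0) orbF intr_eq0 => /eqP c0.
  (* Partial sums invert the differences in [cf]; the total C l = 0 matches the padding on the
     right. *)
  pose C k := \sum_(i < l | (i < k)%N) c (enum_val i).
  have C_l : C l = 0.
    by rewrite -[RHS]c0 -[RHS]sum_enum_val; apply: eq_bigl => i; rewrite ltn_ord.
  have CS (i : 'I_l) : C i.+1 = c (enum_val i) + C i.
    rewrite /C (bigD1 i) //=; congr (_ + _); apply: eq_bigl => j.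
    by rewrite ltnS [RHS]ltn_neqAle andbC -val_eqE.
  pose v : 'rV[int]_l.-1 := \row_j C j.+1.
  have vC k : (k <= l)%N -> padded v k = C k.
    case: k => [|k]; first by rewrite padded0 /C big_pred0.
    rewrite leq_eqVlt => /orP[/eqP->|k_l]; first by rewrite padl C_l.
    have k_l1 : (k < l.-1)%N by rewrite -ltnS prednK.
    by have := padded_ord v (Ordinal k_l1); rewrite /= => ->; rewrite /v mxE.
  exists v; apply: eq_bigr => g _; congr (_%:~R * _).
  have g_l := ltn_ord (enum_rank g).
  by rewrite /cf vC // vC ?(ltnW g_l) // CS enum_rankK addrK.
move=> v; rewrite gtr_lincombM cf0 mul0r mulr0 subr0; congr (_ * _)%:~R.
transitivity (\sum_(i < l) (padded v i.+1 - padded v i) ^+ 2).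
  by rewrite -(sum_rank (fun k => (padded v k.+1 - padded v k) ^+ 2)); apply: eq_bigr => g _; rewrite expr2.
rewrite An_formE -(big_mkord xpredT (fun k => (padded v k.+1 - padded v k) ^+ 2)).
by rewrite -[RHS](big_mkord xpredT (fun k => (padded v k.+1 - padded v k) ^+ 2)) prednK.
Qed.

(** This relates the discriminant of an arbitrary integral basis to that of the normal one. *)
Lemma gram_change n (x y : 'I_n -> L) (M : 'M[int]_n) : (forall i, x i = \sum_j y j *~ M i j) ->
  \det (\matrix_(i, j) iota (gtr (x i * x j))) =
  (\det M)%:~R ^+ 2 * \det (\matrix_(i, j) iota (gtr (y i * y j))).
Proof.
move=> Dx; pose P (z : 'I_n -> L) : 'M[algC]_(l, n) := \matrix_(k, i) iota (act (enum_val k) (z i)).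
have tP (z : 'I_n -> L) : \matrix_(i, j) iota (gtr (z i * z j)) = (P z)^T *m P z.
  apply/matrixP => i j; rewrite !mxE /gtr -sum_enum_val rmorph_sum.
  by apply: eq_bigr => k _; rewrite !mxE !rmorphM.
have PE : P x = P y *m (map_mx intr M)^T.
  apply/matrixP => k i; rewrite !mxE Dx !rmorph_sum; apply: eq_bigr => j _.
  by rewrite !mxE -mulrzr !rmorphM !rmorph_int.
rewrite !tP PE trmx_mul trmxK !mulmxA -[_ *m P y]mulmxA !det_mulmx det_tr det_map_mx.
by ring.
Qed.

End Coordinates.

(* Ramification through ideals versus the inertial condition *)
From mathcomp Require Import classical_sets functions.
Local Open Scope classical_set_scope.

Fact bezout_expand (A : comNzRingType) (a b x u t r q s : A) :
  (a * (u * (t * r)) + b * (q * q * s)) * x = u * t * (a * x * r) + q * q * (b * x * s).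
Proof. by ring. Qed.

Fact divide_generator (F : fieldType) (a b c t r q : F) : t != 0 -> r != 0 -> q != 0 ->
  a * b * c / q = a / t * (b / t) * (c / r) * (t * t * r / q).
Proof. by move=> t0 r0 q0; field; rewrite t0 r0 q0. Qed.

Lemma ring_of_integersP (L : fieldExtType rat) (emb : {rmorphism L -> algC}) x :
  ring_of_integers x <-> emb x \in Aint.
Proof.
split=> [[q mon_q qx0] | Ax].
  apply: (@root_monic_Aint (map_poly intr q)).
  - have := rmorph_root emb qx0; rewrite -map_poly_comp.
    by congr root; apply: eq_map_poly => a /=; rewrite rmorph_int.
  - exact: monic_map.
  - by apply/polyOverP => i; rewrite coef_map /= intr_int.
have /floorpP[q Dq] := Ax; exists q.
  have := minCpoly_monic (emb x); rewrite Dq !monicE lead_coef_map_inj //; last exact: intr_inj.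
  by rewrite -[1]/(1%:~R) eqr_int.
rewrite -(fmorph_root emb) -map_poly_comp; have := root_minCpoly (emb x); rewrite Dq.
by congr root; apply: eq_map_poly => a /=; rewrite rmorph_int.
Qed.

Section Ramified.
Variable L : splittingFieldType rat.
Hypothesis galois_L : galois 1%VS {:L}.
Local Notation G := (gal_of {:L}).
Hypothesis G_prime : prime #|{: G}|.
Variable iota : {rmorphism L -> algC}.
Local Notation l := #|{: G}|.
Local Notation K := (galois_field_of galois_L G_prime iota).
Variable p : nat.
Hypothesis p_pr : prime p.
Local Notation R x := (ploc p (iota x)).
Local Notation J x := (pnil p (iota x)).
Local Notation OL x := (iota x \in Aint).

Let p_neq0 : (p%:R : algC) != 0.
Proof. by rewrite pnatr_eq0 -lt0n prime_gt0. Qed.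
Let pL_neq0 : (p%:R : L) != 0.
Proof. by rewrite -(fmorph_eq0 iota) rmorph_nat. Qed.

(** Let (p) = P^2 I. If P I were contained in (p), p would lie in p P and 1 in P; so some x = d b
    with d in P, b in I is not divisible by p. But x^2 is in P^2 I = (p), so x is in the radical,
    which p would generate were p not inertial. *)
Lemma ramified_inertial : ramified L p -> inertial K p.
Proof.
case=> P [I [[[PO P0 PD PM] nP1 _] [IO I0 ID IM] Dp]].
have {}Dp z : (exists2 x, ring_of_integers x & p%:R * x = z) <->
    ideal_mul (ideal_mul P P) I z by rewrite -Dp.
have Dp1 : ideal_mul (ideal_mul P P) I p%:R.
  by apply/Dp; exists 1; [apply/(ring_of_integersP iota); rewrite rmorph1 Aint1 | rewrite mulr1].
have [d [b [Pd Ib npdb]]] : exists d b, [/\ P d, I b & ~ exists2 r, ring_of_integers r & p%:R * r = d * b].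
  apply: contrapT => no_db; apply: nP1.
  have {}no_db d b : P d -> I b -> exists2 r, ring_of_integers r & p%:R * r = d * b.
    by move=> Pd Ib; apply: contrapT => nr; apply: no_db; exists d, b.
  pose pP z := exists2 y, P y & z = p%:R * y.
  have pP0 : pP 0 by exists 0 => //; rewrite mulr0.
  have pPD y z : pP y -> pP z -> pP (y + z).
    by move=> [u Pu ->] [v Pv ->]; exists (u + v); [apply: PD | rewrite mulrDr].
  suff [y Py /eqP] : pP p%:R.
    by rewrite -subr_eq0 -[X in X - _]mulr1 -mulrBr mulf_eq0 (negPf pL_neq0) subr_eq0 => /eqP->.
  have [s sP ->] := Dp1; rewrite big_seq; apply: big_ind => // u /sP[[t tP ->] Iu].
  rewrite mulr_suml big_seq; apply: big_ind => // v /tP[Pv1 Pv2].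
  have [r Or Dr] := no_db _ _ Pv2 Iu.
  by exists (r * v.1); [apply: PM | rewrite mulrA Dr -mulrA mulrC [v.2 * _]mulrC -mulrA].
pose x := d * b.
have [r /(ring_of_integersP iota) Or Dr] : exists2 r, ring_of_integers r & p%:R * r = x * x.
  apply/Dp; exists [:: (d * d, b * b)]; last by rewrite big_seq1 /= mulrACA.
  move=> u; rewrite inE => /eqP-> /=; split; last by apply: IM => //; apply: IO.
  by exists [:: (d, d)] => [v|]; rewrite ?big_seq1 // inE => /eqP->.
have Ox : OL x.
  by rewrite rmorphM rpredM //; apply/ring_of_integersP; [apply: PO | apply: IO].
have Jx : J x.
  exists 2; rewrite expr2 -rmorphM -Dr rmorphM rmorph_nat mulrAC.
  by rewrite mulfV // mul1r; apply: ploc_Aint.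
apply: contrapT => nin; apply: npdb; exists (x / p%:R); last by rewrite mulrC divfK.
apply/(ring_of_integersP iota); rewrite fmorph_div rmorph_nat; apply: ploc_pdiv_Aint => //.
by have := noninertial_pnil p_pr nin Jx; rewrite fmorph_div rmorph_nat.
Qed.

(** P is the set of integers in the radical, and I that of integers divisible by pi^(l-2) locally,
    so P^2 I has valuation at least l. For the reverse inclusion, m pi is integral for some m prime
    to p, and its norm is p times an integer prime to p; two of its conjugates supply P^2, and the
    product of the other l - 2 is in I. *)
Lemma inertial_ramified : inertial K p -> ramified L p.
Proof.
move=> inert; have [pi [pi0 Jpi piP]] : exists pi : L, [/\ pi != 0, J pi & forall x : L, J x -> R (x / pi)].
  exact: (inertial_generator p_pr inert).
have l_gt1 : (1 < l)%N by apply: prime_gt1.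
have Upi : @punit K p (pi ^+ l / p%:R) := generator_card p_pr inert pi0 Jpi piP.
have Rpi : R pi by apply: pnil_ploc.
have [m pm Ompi] := Rpi; pose pi' : L := m%:R * pi.
have Opi' : OL pi' by rewrite rmorphM rmorph_nat.
have Ract (g : G) z : R z -> R (gal_act g z) by apply: (@ploc_act K).
have Jact (g : G) z : J z -> J (gal_act g z) by apply: (@pnil_act K).
have Oact (g : G) z : OL z -> OL (gal_act g z).
  by have [nu <-] := gal_act_extend iota g; rewrite Aint_aut.
have Jpi' : J pi' by apply: (@pnil_embM K) => //; rewrite rmorph_nat; apply: ploc_nat.
pose P : L -> Prop := fun x => OL x /\ J x.
pose I : L -> Prop := fun x => OL x /\ R (x / pi ^+ (l - 2)).
have idP : is_ideal P.
  split=> [x [Ox _]||x y [Ox Jx] [Oy Jy]|a x /(ring_of_integersP iota) Oa [Ox Jx]].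
  - exact/(ring_of_integersP iota).
  - by split; rewrite rmorph0 ?Aint0 //; apply: pnil0.
  - by split; rewrite rmorphD ?rpredD //; apply: pnilD.
  - split; rewrite rmorphM ?rpredM //.
    by apply: pnilM => //; apply: ploc_Aint.
have idI : is_ideal I.
  split=> [x [Ox _]||x y [Ox Jx] [Oy Jy]|a x /(ring_of_integersP iota) Oa [Ox Jx]].
  - exact/(ring_of_integersP iota).
  - by split; rewrite ?mul0r rmorph0 ?Aint0 //; apply: ploc0.
  - by split; rewrite ?mulrDl rmorphD ?rpredD //; apply: plocD.
  - split; first by rewrite rmorphM ?rpredM.
    by rewrite -mulrA rmorphM; apply: plocM => //; apply: ploc_Aint.
exists P, I; split=> //.
  split=> //; first by case=> _; rewrite rmorph1; apply: not_pnil1.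
  move=> x y /(ring_of_integersP iota) Ox /(ring_of_integersP iota) Oy [_ Jxy].
  have [Jx|nJx] := pselect (J x); [by left | right; split=> //].
  have x0 : x != 0 by apply: contra_notN nJx => /eqP->; rewrite rmorph0; apply: pnil0.
  rewrite -(mulKf x0 y); apply: (@pnil_embM K) => //.
  by apply: (inertial_inv p_pr inert) => //; apply: ploc_Aint.
rewrite predeqE => z; split.
  move=> [x /(ring_of_integersP iota) Ox <-].
  have [g1 g1_neq1] : exists g : G, g != 1%g := gnontrivial K.
  pose rest : L := \prod_(g : G | (g != 1%g) && (g != g1)) gal_act g pi'.
  have DN : @gnorm K pi' = pi' * (gal_act g1 pi' * rest).
    by rewrite (@gnormE K) (bigD1 g1).
  have Irest : I rest.
    split; first by rewrite rmorph_prod rpred_prod // => g _; apply: Oact.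
    have card2 : (l - 2)%N = #|[pred g : G | (g != 1%g) && (g != g1)]|.
      have <- := cardC (pred2 1%g g1); rewrite card2 eq_sym g1_neq1 addKn.
      by apply: eq_card => g; rewrite !inE negb_or.
    rewrite card2 -prodr_const -prodf_div rmorph_prod.
    by apply: ploc_prod => // g _; apply/piP/Jact.
  have UN' : @punit K p (@gnorm K pi' / p%:R).
    exact: (@generator_gnorm_scaled K p p_pr inert pi).
  have ON : OL (@gnorm K pi').
    by rewrite /gnorm rmorph_prod rpred_prod // => g _; apply: Oact.
  have /intrP[n Dn] : iota (@gnorm K pi') \in Num.int.
    by rewrite Cint_rat_Aint //; apply: (@gnorm_rat K).
  have /(ploc_ratP p_pr)/dvdzP[c Dc] : ploc p (n%:~R / p%:R).
    by rewrite -Dn; have [_ + _] := UN'; rewrite /= fmorph_div rmorph_nat.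
  have DNc : @gnorm K pi' / p%:R = c%:~R.
    apply: (fmorph_inj iota); rewrite fmorph_div rmorph_nat Dn Dc rmorph_int.
    by rewrite rmorphM /= mulfK.
  have pc : ~~ (p %| `|c|)%N.
    apply/negP => /dvdnP[d Dd]; apply: (punit_npnil p_pr UN'); rewrite DNc /= rmorph_int.
    apply: pnil_pdiv; rewrite [c]intEsg Dd PoszM !rmorphM /= -!mulrA mulfV // mulr1.
    by apply: plocM => //; apply: ploc_int.
  (* Bezout for c and p^(l-1), multiplied by p, writes p as a multiple of the norm plus a multiple
     of p^l = p p p^(l-2); both terms are in P^2 I. *)
  have /coprimezP[[a b] /= Dab] : coprimez c (p%:Z ^+ l.-1).
    by rewrite coprimezE coprime_sym abszX coprimeXl // prime_coprime.
  have Dp : p%:R = a%:~R * @gnorm K pi' + b%:~R * p%:R ^+ l :> L.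
    rewrite -[X in a%:~R * X](divfK pL_neq0) DNc.
    have -> : p%:R ^+ l = p%:R ^+ l.-1 * p%:R :> L by rewrite -exprSr prednK // ltnW.
    rewrite !mulrA -mulrDl -[LHS]mul1r; congr (_ * _).
    have := congr1 (fun z : int => z%:~R : L) Dab.
    by rewrite rmorphD !rmorphM /= rmorphXn /= => ->.
  exists [:: (pi' * gal_act g1 pi', a%:~R * x * rest); (p%:R * p%:R, b%:~R * x * p%:R ^+ (l - 2))].
    have Pp : P p%:R.
      split; rewrite rmorph_nat ?rpred_nat //.
      by apply: pnil_pdiv; rewrite mulfV //; apply: ploc1.
    have OI (k : int) y : I y -> I (k%:~R * x * y).
      have [_ _ _] := idI; apply; apply/(ring_of_integersP iota).
      by rewrite rmorphM rmorph_int rpredM ?Aint_int.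
    move=> u; rewrite !inE => /orP[] /eqP-> /=; split.
    - by exists [:: (pi', gal_act g1 pi')] => [v|]; rewrite ?big_seq1 // inE => /eqP->; split; split=> //; [apply: Oact | apply: Jact].
    - exact: OI.
    - by exists [:: (p%:R, p%:R)] => [v|]; rewrite ?big_seq1 // inE => /eqP->.
    - apply: OI; split; first by rewrite rmorphXn rmorph_nat rpredX ?rpred_nat.
      by rewrite -expr_div_n rmorphXn; apply: plocX => //; apply: piP; case: Pp.
  rewrite big_cons big_seq1 /= [X in X * x]Dp DN.
  have -> : p%:R ^+ l = p%:R * p%:R * p%:R ^+ (l - 2) :> L.
    by rewrite -mulrA -!exprS -addn2 addnC subnKC.
  exact: bezout_expand.
move=> [s sP ->].
pose pO (z : L) := exists2 y : L, ring_of_integers y & p%:R * y = z.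
have pO0 : pO 0.
  by exists 0; rewrite ?mulr0 //; apply/(ring_of_integersP iota); rewrite rmorph0 Aint0.
have pOD y y' : pO y -> pO y' -> pO (y + y').
  move=> [u /(ring_of_integersP iota) Ou <-] [v /(ring_of_integersP iota) Ov <-].
  by exists (u + v); rewrite ?mulrDr //; apply/(ring_of_integersP iota); rewrite rmorphD rpredD.
suff : pO (\sum_(u <- s) u.1 * u.2) by [].
rewrite big_seq; apply: big_ind => // u /sP[[t tP ->] [Ou Ru]].
rewrite mulr_suml big_seq; apply: big_ind => // v /tP[[Ov1 Jv1] [Ov2 Jv2]].
exists (v.1 * v.2 * u.2 / p%:R); last by rewrite mulrC divfK.
apply/(ring_of_integersP iota); rewrite fmorph_div rmorph_nat; apply: ploc_pdiv_Aint => //.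
  by rewrite !rmorphM !rpredM.
rewrite -(rmorph_nat iota) -fmorph_div.
have -> : v.1 * v.2 * u.2 / p%:R = (v.1 / pi) * (v.2 / pi) * (u.2 / pi ^+ (l - 2)) * (pi ^+ l / p%:R).
  have -> : pi ^+ l = pi * pi * pi ^+ (l - 2) by rewrite -mulrA -!exprS -addn2 addnC subnKC.
  by apply: divide_generator; rewrite ?expf_neq0.
by case: Upi => _ RU _; rewrite !rmorphM -!rmorphM; do 3?[apply: (@ploc_embM K) => //]; apply: piP.
Qed.

End Ramified.

(** * The matrix trace as a sum of conjugates *)

Section Trace.
Variable L : splittingFieldType rat.
Hypothesis galois_L : galois 1%VS {:L}.
Local Notation G := (gal_of {:L}).

(** The matrix W of conjugates of a basis diagonalises multiplication by x, with eigenvalues g(x).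
    It has full rank by independence of automorphisms, and it is square because the degree is the
    order of the group. *)
Lemma trQ_gal x : (trQ x)%:A = \sum_(g : G) g x.
Proof.
pose e := vbasis {:L}; have e_basis : basis_of {:L} e := vbasisP _.
pose n := \dim {:L}; pose k := #|{: G}|.
pose W := \matrix_(j < n, i < k) (enum_val i : G) e`_j.
have W_full : row_full W.
  rewrite /row_full -mxrank_tr -/(row_free _) -kermx_eq0; apply/rowV0P => v /sub_kermxP vW.
  have c0 := @gal_lin_dep L (fun g => v 0 (enum_rank g)).
  apply/rowP => i; rewrite mxE -(enum_valK i); apply: c0 => j.
  have /rowP/(_ j) := vW; rewrite !mxE => vWj; rewrite -[RHS]vWj.
  rewrite (reindex (enum_val : 'I_k -> G)) /=; last first.
    by exists enum_rank => g _; rewrite ?enum_valK ?enum_rankK.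
  by apply: eq_bigr => g _; rewrite !mxE enum_valK.
have W_free : row_free W.
  by rewrite /row_free (eqP W_full) /k /n dim_gal.
pose M := passmx.mxof e e (amull x).
pose D := diag_mx (\row_(i < k) (enum_val i : G) x).
have MW : map_mx (in_alg L) M *m W = W *m D.
  apply/matrixP => j i; rewrite mul_mx_diag !mxE -rmorphM /=.
  have Dxe : x * e`_j = \sum_(m < n) M j m *: e`_m.
    have -> : x * e`_j = amull x e`_j by rewrite lfunE.
    rewrite -[LHS](passmx.rVofK e_basis) (@passmx.rVof_app _ _ _ e e e_basis) passmx.rVofE // -rowE.
    by apply: eq_bigr => m _; rewrite mxE.
  rewrite mulrC Dxe linear_sum; apply: eq_bigr => m _.
  by rewrite linearZ /= -mulr_algl [map_mx _ _ _ _]mxE [W _ _]mxE.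
transitivity (\tr (map_mx (in_alg L) M)).
  by rewrite /trQ /mxtrace scaler_suml; apply: eq_bigr => i _; rewrite [RHS]mxE.
rewrite -[map_mx _ _]mulmx1 -(mulmxVp W_free) mulmxA MW -mulmxA mxtrace_mulC.
rewrite -mulmxA mulVpmx // mulmx1 mxtrace_diag.
rewrite [RHS](reindex (enum_val : 'I_k -> G)) /=; last first.
  by exists enum_rank => g _; rewrite ?enum_valK ?enum_rankK.
by apply: eq_bigr => i _; rewrite mxE.
Qed.

End Trace.

Lemma is_rad_unique (L : fieldExtType rat) (r s : int) : is_rad L r -> is_rad L s -> r = s.
Proof.
move=> [sqr rr sr] [sqs rs ss].
have r0 : (0 < `|r|)%N by case: `|r|%N sqr => // /(_ 2%N isT).
have s0 : (0 < `|s|)%N by case: `|s|%N sqs => // /(_ 2%N isT).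
have pe : primes `|r| = primes `|s|.
  apply/eq_primes => p; rewrite !mem_primes r0 s0 /=; case: (boolP (prime p)) => //= p_pr.
  apply/idP/idP => H; [apply/(rs p p_pr)/(rr p p_pr) | apply/(rr p p_pr)/(rs p p_pr)]; exact: H.
have abs : `|r|%N = `|s|%N.
  by rewrite [LHS](squarefree_prod_primes sqr) [RHS](squarefree_prod_primes sqs) pe.
by rewrite [LHS]intEsg [RHS]intEsg sr ss abs.
Qed.

Lemma ratrC_inj : injective (ratr : rat -> algC).
Proof. exact: fmorph_inj. Qed.

(** * Discriminant sign, signed radical and the isometry *)

Section TameCyclicField.
Variable L : splittingFieldType rat.
Hypothesis galois_L : galois 1%VS {:L}.
Local Notation G := (gal_of {:L}).
Local Notation l := #|{: G}|.
Hypothesis l_prime : prime l.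
Variable iota : {rmorphism L -> algC}.
Local Notation K := (galois_field_of galois_L l_prime iota).

Lemma ratr_trQ x : ratr (trQ x) = iota (@gtr K x).
Proof.
rewrite -[LHS](fmorph_rat iota) -alg_num_field (trQ_gal galois_L).
exact: erefl.
Qed.

Variables (N m : int) (e : L).
Hypothesis Ge : @tame_generator K N m e.

Let N0 : N != 0.
Proof.
have [_ N_gt0 _ _ _] := Ge; apply: contraTneq N_gt0 => ->.
by rewrite expr0n; have := prime_gt0 l_prime; case: #|_|.
Qed.

Lemma integral_basis_mktuple (y : 'I_(\dim {:L}) -> L) :
  (forall x : L, iota x \in Aint <-> exists c : 'I_(\dim {:L}) -> int, x = \sum_i y i *~ c i) ->
  integral_basis (mktuple y).
Proof.
move=> yP; split.
  rewrite basisEdim size_tuple leqnn andbT; apply/subvP => x _.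
  have [k k0 Ak] := Aint_scale (iota x).
  have Akx : iota (k%:R * x) \in Aint by rewrite rmorphM rmorph_nat.
  have [c Dc] := proj1 (yP _) Akx.
  have -> : x = (k%:R : rat)^-1 *: (k%:R * x).
    by rewrite mulr_natl -scaler_nat scalerA mulVf ?scale1r // pnatr_eq0 -lt0n.
  rewrite Dc; apply: memvZ; apply: memv_suml => i _; rewrite -scaler_int; apply: memvZ.
  by rewrite -(tnth_mktuple y i); apply/memv_span/mem_tnth.
apply/seteqP; split=> x /=.
  move=> /(ring_of_integersP iota)/(proj1 (yP _))[c ->]; exists c.
  by apply: eq_bigr => i _; rewrite tnth_mktuple.
move=> [c ->]; apply/(ring_of_integersP iota); apply: (proj2 (yP _)); exists c.
by apply: eq_bigr => i _; rewrite tnth_mktuple.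
Qed.

(** Every integral basis has discriminant u^2 N^(l-1), with u <> 0 the determinant of the change
    from the normal basis, so the choice made by [xget] does not affect the sign. As N^l > 0, the
    sign of N^(l-1) is that of N. *)
Lemma discriminant_sign : sgz (discriminant L) = sgz N.
Proof.
have DE : \dim {:L} = #|gf_group K| := dim_gal galois_L.
have [y [yP det_y]] := tame_basis Ge DE.
have gramQ (b : (\dim {:L}).-tuple L) :
    ratr (\det (\matrix_(i < \dim {:L}, j < \dim {:L}) trace_bilin (tnth b i) (tnth b j))) =
    \det (\matrix_(i < \dim {:L}, j < \dim {:L}) (gf_emb K) (@gtr K (tnth b i * tnth b j))).
  rewrite -det_map_mx; congr (\det _); apply/matrixP => i j; rewrite !mxE.
  exact: ratr_trQ.
have sgn (b : (\dim {:L}).-tuple L) : integral_basis b ->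
    sgz (\det (\matrix_(i < \dim {:L}, j < \dim {:L}) trace_bilin (tnth b i) (tnth b j))) = sgz N.
  move=> [_ Ob].
  have Db i : exists c : 'I_(\dim {:L}) -> int, (tnth b i : K) = \sum_j y j *~ c j.
    apply: (proj1 (yP (tnth b i))); apply: (proj1 (ring_of_integersP iota _)).
    rewrite Ob /=; exists (fun j => if j == i then 1 else 0).
    by rewrite (bigD1 i) //= eqxx mulr1z big1 ?addr0 // => j /negPf->; rewrite mulr0z.
  have Dy i : exists c : 'I_(\dim {:L}) -> int, y i = \sum_j (tnth b j : K) *~ c j.
    have : ring_of_integers (y i : L).
      apply: (proj2 (ring_of_integersP iota _)); apply: (proj2 (yP (y i))).
      exists (fun j => if j == i then 1 else 0).
      by rewrite (bigD1 i) //= eqxx mulr1z big1 ?addr0 // => j /negPf->; rewrite mulr0z.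
    by rewrite Ob /= => -[c Dc]; exists c.
  have [U UP] := choice Db; have [V VP] := choice Dy.
  have E1 : _ = (\det (\matrix_(i, j) U i j))%:~R ^+ 2 * _ :=
    @gram_change K _ (tnth b) y (\matrix_(i, j) U i j)
      (fun i => etrans (UP i) (eq_bigr _ (fun j _ => congr1 (intmul (y j)) (esym (mxE _ _ i j))))).
  have E2 : _ = (\det (\matrix_(i, j) V i j))%:~R ^+ 2 * _ :=
    @gram_change K _ y (tnth b) (\matrix_(i, j) V i j)
      (fun i => etrans (VP i) (eq_bigr _ (fun j _ => congr1 (intmul (tnth b j : K)) (esym (mxE _ _ i j))))).
  set u := \det (\matrix_(i, j) U i j) in E1.
  have y0 : \det (\matrix_(i, j) gf_emb K (gtr (y i * y j))) != 0.
    by rewrite det_y intr_eq0 expf_neq0.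
  have u0 : u != 0.
    apply: contra_neq y0 => u0.
    by move: E1; rewrite u0 expr0n mul0r => E1; rewrite E2 E1 mulr0.
  have -> : \det (\matrix_(i < \dim {:L}, j < \dim {:L}) trace_bilin (tnth b i) (tnth b j)) =
      (u ^+ 2 * N ^+ (\dim {:L}).-1)%:~R :> rat.
    apply: ratrC_inj; rewrite gramQ E1 det_y ratr_int intrM; congr (_ * _).
    exact/esym/rmorphXn.
  have [_ N_gt0 _ _ _] := Ge.
  have D_gt0 : (0 < \dim {:L})%N by rewrite DE; apply: prime_gt0.
  have u2 : 0 < u ^+ 2 by rewrite lt_def expf_eq0 u0 sqr_ge0.
  move: N_gt0; rewrite -DE -[X in N ^+ X](prednK D_gt0) exprS.
  case: (ltrgtP N 0) => [N_lt0|N_gt0|N00]; last by case/eqP: N0.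
    rewrite nmulr_rgt0 // => NN.
    have z_lt0 : (u ^+ 2 * N ^+ (\dim {:L}).-1)%:~R < 0 :> rat by rewrite ltrz0 pmulr_rlt0.
    by rewrite (ltr0_sgz z_lt0) (ltr0_sgz N_lt0).
  rewrite pmulr_rgt0 // => NN.
  have z_gt0 : 0 < (u ^+ 2 * N ^+ (\dim {:L}).-1)%:~R :> rat by rewrite ltr0z pmulr_rgt0.
  by rewrite (gtr0_sgz z_gt0) (gtr0_sgz N_gt0).
have ex : exists d, [set d | exists2 b : (\dim {:L}).-tuple L, integral_basis b &
    d = \det (\matrix_(i < \dim {:L}, j < \dim {:L}) trace_bilin (tnth b i) (tnth b j))] d.
  by eexists; exists (mktuple y); first exact: integral_basis_mktuple.
have := xgetPex 0 ex; rewrite -/(discriminant L) => -[b Ib ->].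
exact: sgn.
Qed.

Lemma signed_radicalE : signed_radical L = N.
Proof.
have radN : is_rad L N.
  have [_ _ sqf ramE _] := Ge.
  split=> [//|p p_pr|]; last by rewrite discriminant_sign.
  split=> [pN|ram_p]; first exact: (inertial_ramified p_pr (proj1 (ramE p p_pr) pN)).
  apply: (proj2 (ramE p p_pr)); exact: (ramified_inertial p_pr ram_p).
exact: (is_rad_unique (@xgetPex _ 0 [set r | is_rad L r] (ex_intro _ N radN)) radN).
Qed.

Lemma tame_isometric :
  isometric (@trace_zero_integers L)
    (fun x : L => ((signed_radical L)%:~R)^-1 * trace_form x)
    [set: 'rV[int]_l.-1] (fun v => (An_form v)%:~R).
Proof.
have [phi [phiD phi_inj phiM phi_surj phi_q]] := tame_lattice Ge.
have inM v : @trace_zero_integers L (phi v).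
  have [Av tv] := phiM v; split; first exact: (proj2 (ring_of_integersP iota _) Av).
  by apply: ratrC_inj; rewrite ratr_trQ tv !rmorph0.
have surjM x : @trace_zero_integers L x -> exists v, x = phi v.
  move=> [Ox tx]; apply: phi_surj; first exact: (proj1 (ring_of_integersP iota x) Ox).
  by apply: (@emb_inj K); rewrite rmorph0; apply: etrans (esym (ratr_trQ x)) _; rewrite tx rmorph0.
(* The inverse of phi must be defined on all of L; outside the lattice it takes the dummy value 0,
   which [isometric] does not see. *)
have /choice[f fP] : forall x : L, exists v : 'rV[int]_l.-1, @trace_zero_integers L x -> x = phi v.
  by move=> x; have [/surjM[v Dv]|nM] := pselect (@trace_zero_integers L x); [exists v | exists 0].
exists f; split.
- split=> [//|x y|v _].
    by rewrite !inE => Mx My fxy; rewrite (fP x Mx) fxy -(fP y My).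
  by exists (phi v); [apply: inM | apply: phi_inj; rewrite -fP].
- move=> x y Mx My; apply: phi_inj.
  have Dxy : x + y = phi (f x + f y) by rewrite phiD -(fP x Mx) -(fP y My).
  have Mxy : @trace_zero_integers L (x + y) by rewrite Dxy; apply: inM.
  by rewrite -Dxy -(fP _ Mxy).
move=> x Mx; rewrite signed_radicalE.
have -> : trace_form x = (N * An_form (f x))%:~R.
  apply: ratrC_inj; rewrite /trace_form /trace_bilin ratr_trQ ratr_int.
  by have := phi_q (f x); rewrite -(fP x Mx).
by rewrite rmorphM mulKf // intr_eq0.
Qed.

End TameCyclicField.

Theorem theorem2p9 (l : nat) (L : splittingFieldType rat)
    (prime_l : prime l)
    (galois_L : galois 1%VS {:L})
    (gal_L : 'Gal({:L} / 1%VS) \isog Zp l)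
    (tame_L : ~ ramified L l) :
  isometric (@trace_zero_integers L)
    (fun x : L => ((signed_radical L)%:~R)^-1 * trace_form x)
    [set: 'rV[int]_l.-1] (fun v => (An_form v)%:~R).
Proof.
have cardG : #|{: gal_of {:L}}| = l.
  by rewrite -cardsT -galT (card_isog gal_L) card_Zp ?prime_gt0.
subst l; have [iota _] := exists_embedding galois_L.
pose K := galois_field_of galois_L prime_l iota.
have tame_K p : p = #|gf_group K| -> ~ inertial K p.
  by move=> -> /(inertial_ramified prime_l).
have [l2|l_odd] := even_prime prime_l.
  have [N [m [e Ge]]] := exists_quadratic_tame_generator (L := K) l2 (tame_K 2%N (esym l2)).
  exact: tame_isometric Ge.
have [N [m [e Ge]]] := exists_odd_tame_generator (L := K) l_odd (tame_K _ erefl).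
exact: tame_isometric Ge.
Qed.
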